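(* Let $n\ge2$, $p>0$ and $a>0$. Among all compact embedded $C^1$-hypersurfaces $\Sigma\subset\mathbb{R}^n$ without boundary and with given surface area $\mathscr{H}^{n-1}(\Sigma)=a$, the round sphere uniquely (up to isometries of $\mathbb{R}^n$) minimizes the energy $\|\mathcal{K}_{\mathrm{tp}}[\Sigma]\|_{L^p(\Sigma,\mathscr{H}^{n-1})}$. If $p>n-1$, the same holds true among all $(n-1)$-fine sets $\Sigma\in\mathscr{F}(n-1)$ in $\mathbb{R}^n$ with $\mathscr{H}^{n-1}(\Sigma)=a$.
   Context: Put $m=n-1$. $G(n,m)$ is the Grassmannian of $m$-dimensional linear subspaces of $\mathbb{R}^n$; $\mathscr{H}^m$ is the $m$-dimensional Hausdorff measure; $\mathbb{B}^n(x,r)$ is the open ball, $\overline{\mathbb{B}}(x,r)$ the closed ball. Global tangent-point curvature: for a map $H\colon\Sigma\to G(n,m)$, $\mathcal{K}_{\mathrm{tp}}[\Sigma](x)=\mathcal{K}_{\mathrm{tp}}(x,H(x)):=\sup_{y\in\Sigma}\frac{1}{R_{\mathrm{tp}}(x,y;H(x))}$, where $R_{\mathrm{tp}}(x,y;H):=\frac{|y-x|^2}{2\,\mathrm{dist}(y,x+H)}$, and $1/R_{\mathrm{tp}}(x,y;H):=0$ if $y\in x+H$ (in particular if $y=x$). For a $C^1$-submanifold $\Sigma$ one takes $H(x)=T_x\Sigma$, the tangent space; for a general $m$-fine set, a map $H\colon\Sigma\to G(n,m)$ is arbitrary but fixed. The energy is $\|\mathcal{K}_{\mathrm{tp}}[\Sigma]\|_{L^p(\Sigma,\mathscr{H}^m)}=\left(\int_\Sigma\mathcal{K}_{\mathrm{tp}}[\Sigma](x)^p\,d\mathscr{H}^m(x)\right)^{1/p}$,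 also for $0<p<1$, and is $+\infty$ if the function is not in $L^p$. Beta numbers: $\beta_\Sigma(x,r):=\frac1r\inf\{\sup_{z\in\Sigma\cap\mathbb{B}^n(x,r)}\mathrm{dist}(z,x+H): H\in G(n,m)\}$. Bilateral beta numbers: $\theta_\Sigma(x,r):=\frac1r\inf\{d_{\mathscr{H}}(\Sigma\cap\overline{\mathbb{B}}(x,r),(x+H)\cap\overline{\mathbb{B}}(x,r)): H\in G(n,m)\}$, where $d_{\mathscr{H}}(E,F):=\sup_{y\in E}\mathrm{dist}(y,F)+\sup_{z\in F}\mathrm{dist}(z,E)$. $m$-fine sets: a compact set $\Sigma\subset\mathbb{R}^n$ is $m$-fine, $\Sigma\in\mathscr{F}(m)$, if there are constants $A_\Sigma>0$ and $M_\Sigma\ge2$ such that for all $x\in\Sigma$ and all $0<r\le\mathrm{diam}\,\Sigma$: (i) $\mathscr{H}^m(\Sigma\cap\mathbb{B}^n(x,r))\ge A_\Sigma r^m$, and (ii) $\theta_\Sigma(x,r)\le M_\Sigma\,\beta_\Sigma(x,r)$. *)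

(* Defs.v *)
From HB Require Import structures.
From mathcomp Require Import all_boot all_order all_algebra.
From mathcomp Require Import all_classical all_reals all_analysis.
From mathcomp Require Import measurable_realfun.

Set Implicit Arguments.
Unset Strict Implicit.
Unset Printing Implicit Defensive.

Import Order.TTheory GRing.Theory Num.Theory.
Import numFieldNormedType.Exports.

Local Open Scope classical_set_scope.
Local Open Scope ring_scope.

(* R^n is 'rV[R]_n.  The library norm on matrices is the sup norm: it is used
   below only for the topology, for continuity and for differentiability, which
   do not depend on the choice of the norm.  All metric notions use [enorm]. *)

Section euclidean.
Context {R : realType} {n : nat}.
Implicit Types (x y v : 'rV[R]_n) (A E F L : set 'rV[R]_n) (r : R).

Definition enorm v : R := Num.sqrt (\sum_(i < n) v ord0 i ^+ 2).

Definition eball x r : set 'rV[R]_n := [set y | enorm (y - x) < r].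

Definition ecball x r : set 'rV[R]_n := [set y | enorm (y - x) <= r].

Definition esphere x r : set 'rV[R]_n := [set y | enorm (y - x) = r].

(* Only meaningful for nonempty F: [inf set0] is 0. *)
Definition edist y F : R := inf [set enorm (y - z) | z in F].

(* The diameter is -oo for the empty set. *)
Definition ediam A : \bar R :=
  ereal_sup [set (enorm (z.1 - z.2))%:E | z in A `*` A].

Definition hausdorff_dist E F : \bar R :=
  (ereal_sup [set (edist y F)%:E | y in E] +
   ereal_sup [set (edist z E)%:E | z in F])%E.

Definition congruent A E : Prop :=
  exists phi : 'rV[R]_n -> 'rV[R]_n,
    (forall x y, enorm (phi x - phi y) = enorm (x - y)) /\ A = phi @` E.

(* G(n, m), a subspace being identified with its set of points. *)
Definition grassmannian (m : nat) : set (set 'rV[R]_n) :=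
  [set L | exists W : {vspace 'rV[R]_n}, \dim W = m /\ L = [set` W]].

Definition affine x L : set 'rV[R]_n := [set x + v | v in L].

End euclidean.

Section hausdorff_measure.
Context {R : realType} {n : nat}.
Implicit Types (A B C : set 'rV[R]_n) (m : nat) (d : R).
Local Open Scope ereal_scope.

(* omega_m = pi^(m/2) / Gamma(m/2 + 1), computed by the recurrence
   omega_(m+2) = 2 pi / (m + 2) * omega_m. *)
Fixpoint unit_ball_volume m : R :=
  match m with
  | 0 => 1%R
  | 1 => 2%R
  | m'.+2 => (2 * pi / m%:R * unit_ball_volume m')%R
  end.

Definition hausdorff_gauge m C : \bar R :=
  if C == set0 then 0
  else (unit_ball_volume m)%:E * (ediam C * (2^-1)%:E) ^+ m.

Definition hausdorff_cover d A : set (set 'rV[R]_n)^nat :=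
  [set C | (forall k, ediam (C k) <= d%:E) /\ A `<=` \bigcup_k C k].

Definition hausdorff_premeasure m d A : \bar R :=
  ereal_inf [set \sum_(k <oo) hausdorff_gauge m (C k) | C in hausdorff_cover d A].

(* The supremum is the limit as d -> 0, the premeasure being nonincreasing
   in d. *)
Definition hausdorff_measure m A : \bar R :=
  ereal_sup [set hausdorff_premeasure m d A | d in [set d | (0 < d)%R]].

Lemma unit_ball_volume_ge0 m : (0 <= unit_ball_volume m)%R.
Proof.
suff: (0 <= unit_ball_volume m)%R /\ (0 <= unit_ball_volume m.+1)%R by case.
elim: m => [|m [IH1 IH2]]; first by split; rewrite /= ?ler01 ?ler0n.
split=> //; rewrite [unit_ball_volume _]/= -/(unit_ball_volume m).
by rewrite !mulr_ge0// ?pi_ge0// invr_ge0.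
Qed.

Lemma enorm_ge0 (v : 'rV[R]_n) : (0 <= enorm v)%R.
Proof. exact: sqrtr_ge0. Qed.

Lemma ediam_set0 : ediam (set0 : set 'rV[R]_n) = -oo.
Proof. by rewrite /ediam set0X image_set0 ereal_sup0. Qed.

Lemma hausdorff_gauge_ge0 m C : 0 <= hausdorff_gauge m C.
Proof.
rewrite /hausdorff_gauge; case: ifPn => // /set0P[x Cx].
rewrite mule_ge0 ?lee_fin ?unit_ball_volume_ge0// expe_ge0// mule_ge0//.
apply: (@le_trans _ _ (enorm (x - x))%:E); first by rewrite lee_fin enorm_ge0.
by apply: ereal_sup_ubound; exists (x, x).
Qed.

Lemma hausdorff_premeasure_ge0 m d A : 0 <= hausdorff_premeasure m d A.
Proof.
apply: le_ereal_inf_tmp => _ [C _ <-].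
by apply: nneseries_ge0 => k _ _; exact: hausdorff_gauge_ge0.
Qed.

Lemma hausdorff_premeasure0 m d : hausdorff_premeasure m d set0 = 0.
Proof.
apply/eqP; rewrite eq_le hausdorff_premeasure_ge0 andbT.
apply: ereal_inf_lbound; exists (fun=> set0).
  by split=> // k; rewrite ediam_set0 leNye.
by rewrite eseries0// => k _ _; rewrite /hausdorff_gauge eqxx.
Qed.

Lemma le_hausdorff_premeasure m d :
  {homo hausdorff_premeasure m d : A B / A `<=` B >-> A <= B}.
Proof.
move=> A B AB; apply: ereal_inf_le_tmp => _ [C [dC BC] <-].
by exists C => //; split=> //; exact: subset_trans BC.
Qed.

Lemma hausdorff_premeasure_sigma_subadditive m d :
  sigma_subadditive (hausdorff_premeasure m d).
Proof.
set mu := hausdorff_premeasure m d; set g := hausdorff_gauge m.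
have mu_ge0 := hausdorff_premeasure_ge0 m d : forall A, 0 <= mu A.
have g_ge0 := hausdorff_gauge_ge0 m : forall C, 0 <= g C.
move=> A; have [[i ioo]|] := pselect (exists i, mu (A i) = +oo).
  rewrite (eseries_pinfty _ _ ioo) ?leey// => k _.
  by rewrite -ltNye (lt_le_trans _ (mu_ge0 _)).
rewrite -forallNE => Aoo.
apply/lee_addgt0Pr => _/posnumP[e].
rewrite (le_trans _ (epsilon_trick _ _ _))//.
pose P k (B : (set 'rV[R]_n)^nat) := hausdorff_cover d (A k) B /\
  \sum_(j <oo) g (B j) <= mu (A k) + (e%:num / (2 ^ k.+1)%:R)%:E.
have [G PG] : {G : ((set 'rV[R]_n)^nat)^nat & forall k, P k (G k)}.
  apply: (@choice _ _ P) => k.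
  have muAfin : mu (A k) \is a fin_num by rewrite ge0_fin_numE// ltey; apply/eqP.
  have ek : (0 < e%:num / (2 ^ k.+1)%:R :> R)%R by [].
  have [_ [B AB <-] muB] := lb_ereal_inf_adherent ek muAfin.
  by exists B; split=> //; exact/ltW.
have gG_ge0 x : 0 <= (g \o uncurry G) x by exact: g_ge0.
apply: (@le_trans _ _ (\esum_(i in setT) (g \o uncurry G) i)).
  apply: ereal_inf_lbound => /=.
  have /card_esym/ppcard_eqP[f] := card_nat2.
  exists (uncurry G \o f).
    split=> [i|]; first by rewrite /=; case: (f i) => k j; exact: (PG k).1.1.
    apply: (@subset_trans _ (\bigcup_k \bigcup_j G k j)) => [t [i _]|].
      by move=> /(PG i).1.2 -[j _ ?]; exists i => //; exists j.
    move=> t [i _ [j _ Bijt]]; exists (f^-1%FUN (i, j)) => //=.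
    by rewrite invK ?inE.
  rewrite -(esum_pred_image (g \o uncurry G) _ xpredT) ?[fun=> _]set_true//.
  by rewrite image_eq.
rewrite (_ : esum _ _ = \sum_(i <oo) \sum_(j <oo) g (G i j)); last first.
  pose J : nat -> set (nat * nat) := fun i => [set (i, j) | j in setT].
  rewrite (_ : setT = \bigcup_k J k); last first.
    by rewrite predeqE => -[k l]; split=> // _; exists k => //; exists l.
  rewrite esum_bigcupT //=; last first.
    apply/trivIsetP => i j _ _ ij.
    rewrite predeqE => -[k l] /=; split => //= -[] [_] _ [<-{k} _].
    by move=> [l' _] [] /esym/eqP; rewrite (negbTE ij).
  rewrite -(image_id [set: nat]) -fun_true esum_pred_image//; last first.
    by move=> k _; exact: esum_ge0.
  apply: eq_eseriesr => /= j _.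
  rewrite -(esum_pred_image (g \o uncurry G) (pair j) predT)//=; last first.
    by move=> ? ? _ _; exact: (@can_inj _ _ _ snd).
  by congr esum; rewrite predeqE => -[k l]; split; move=> [i _ <-]; exists i.
apply: lee_nneseries => [k _ _|k _]; last by have [] := PG k.
by apply: nneseries_ge0 => j _ _; exact: g_ge0.
Qed.

Lemma hausdorff_measure0 m : hausdorff_measure m set0 = 0.
Proof.
rewrite /hausdorff_measure (_ : [set _ | _ in _] = [set 0]) ?ereal_sup1//.
apply/seteqP; split=> [_ [d _ <-]|_ ->]; first exact: hausdorff_premeasure0.
by exists 1%R; [exact: ltr01|exact: hausdorff_premeasure0].
Qed.

Lemma hausdorff_measure_ge0 m A : 0 <= hausdorff_measure m A.
Proof.
apply: (le_trans (hausdorff_premeasure_ge0 m 1 A)).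
by apply: ereal_sup_ubound; exists 1%R => //=; exact: ltr01.
Qed.

Lemma le_hausdorff_measure m :
  {homo hausdorff_measure m : A B / A `<=` B >-> A <= B}.
Proof.
move=> A B AB; apply: ge_ereal_sup => _ [d d0 <-].
apply: (le_trans (le_hausdorff_premeasure m d AB)).
by apply: ereal_sup_ubound; exists d.
Qed.

Lemma hausdorff_measure_sigma_subadditive m :
  sigma_subadditive (hausdorff_measure m).
Proof.
move=> A; apply: ge_ereal_sup => _ [d d0 <-].
apply: (le_trans (hausdorff_premeasure_sigma_subadditive m d A)).
apply: lee_nneseries => [k _ _|k _]; first exact: hausdorff_premeasure_ge0.
by apply: ereal_sup_ubound; exists d.
Qed.

HB.instance Definition _ m := isOuterMeasure.Build R 'rV[R]_n
  (hausdorff_measure m) (hausdorff_measure0 m) (hausdorff_measure_ge0 m)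
  (@le_hausdorff_measure m) (@hausdorff_measure_sigma_subadditive m).

End hausdorff_measure.

Section submanifolds.
Context {R : realType} {n : nat}.
Implicit Types (x v : 'rV[R]_n) (S U V L : set 'rV[R]_n).

Definition C1_on U (f : 'rV[R]_n -> 'rV[R]_n) : Prop :=
  forall y, U y ->
    differentiable f y /\ forall v, {for y, continuous (fun z => 'd f z v)}.

(* Embedded m-dimensional C^1-submanifold without boundary: around each of its
   points, a C^1-diffeomorphism Phi : U -> V with inverse Psi flattens S to an
   m-dimensional subspace L. *)
Definition C1_submanifold (m : nat) S : Prop :=
  forall x, S x -> exists U V L (Phi Psi : 'rV[R]_n -> 'rV[R]_n),
    [/\ [/\ open U, open V & U x],
        C1_on U Phi /\ C1_on V Psi,
        (forall y, U y -> V (Phi y) /\ Psi (Phi y) = y) /\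
        (forall z, V z -> U (Psi z) /\ Phi (Psi z) = z),
        grassmannian m L &
        Phi @` (S `&` U) = L `&` V].

Definition compact_C1_hypersurface S : Prop :=
  compact S /\ C1_submanifold n.-1 S.

(* Velocities at x of the C^1-curves in S through x. *)
Definition tangent_space S x : set 'rV[R]_n :=
  [set v | exists (c : R -> 'rV[R]_n) (e : R),
    [/\ 0 < e, c 0 = x, derive1 c 0 = v &
        forall t, `|t| < e ->
          [/\ S (c t), derivable c t 1 & {for t, continuous (derive1 c)}]]].

End submanifolds.

Section tangent_point_energy.
Context {R : realType} {n : nat}.
Implicit Types (x y : 'rV[R]_n) (S L : set 'rV[R]_n) (p : R).
Implicit Type H : 'rV[R]_n -> set 'rV[R]_n.

Definition Rtp x y L : R := enorm (y - x) ^+ 2 / (2 * edist y (affine x L)).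

Definition inv_Rtp x y L : R :=
  if y \in affine x L then 0 else (Rtp x y L)^-1.

(* A map H : S -> G(n, m) is represented by a total function, whose values
   outside S play no role. *)
Definition Ktp S H x : \bar R :=
  ereal_sup [set (inv_Rtp x y (H x))%:E | y in S].

(* The L^p norm on S with respect to the m-dimensional Hausdorff measure, on
   its sigma-algebra of Caratheodory-measurable sets; +oo if the integrand is
   not measurable. *)
Definition tp_energy (m : nat) p S H : \bar R :=
  let Hm : {outer_measure set 'rV[R]_n -> \bar R} := hausdorff_measure m in
  let T := caratheodory_type Hm in
  let mu : {measure set T -> \bar R} := Hm in
  let f : T -> \bar R := Ktp S H \_ S in
  if `[< measurable_fun [set: T] f >] then Lnorm mu p%:E f else +oo%E.

End tangent_point_energy.

Section fine_sets.
Context {R : realType} {n : nat}.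
Implicit Types (x : 'rV[R]_n) (S L : set 'rV[R]_n) (r : R) (m : nat).
Local Open Scope ereal_scope.

Definition beta_number m S x r : \bar R :=
  (r^-1)%:E * ereal_inf
    [set ereal_sup [set (edist z (affine x L))%:E | z in S `&` eball x r]
      | L in grassmannian m].

Definition theta_number m S x r : \bar R :=
  (r^-1)%:E * ereal_inf
    [set hausdorff_dist (S `&` ecball x r) (affine x L `&` ecball x r)
      | L in grassmannian m].

Definition fine_set m S : Prop :=
  compact S /\ exists A M : R, [/\ (0 < A)%R, (2 <= M)%R &
    forall x r, S x -> (0 < r)%R -> r%:E <= ediam S ->
      (A * r ^+ m)%:E <= hausdorff_measure m (S `&` eball x r) /\
      theta_number m S x r <= M%:E * beta_number m S x r].

End fine_sets.

(* Main.v *)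
Require Import Defs.
From HB Require Import structures.
From mathcomp Require Import all_boot all_order all_algebra.
From mathcomp Require Import all_classical all_reals all_analysis.
From mathcomp Require Import measurable_realfun ring lra.
Import Order.TTheory GRing.Theory Num.Theory.
Import numFieldNormedType.Exports.
Local Open Scope classical_set_scope.
Local Open Scope ring_scope.

Set Implicit Arguments.
Unset Strict Implicit.
Unset Printing Implicit Defensive.

(** Write m = n - 1 and let Sigma be one of the competitors.  If the tangent
    point curvature K of Sigma at x is at most 1/rho, then Sigma misses the two
    open balls of radius rho that touch x + H(x) at x
    ([Ktp_tangent_ball]).  Near x the set Sigma is a hypersurface whose two
    sides contain the two balls, and a compact hypersurface separates space:
    the complement of Sigma carries a two-valued colouring, locally constant,
    that changes across Sigma and is constant near infinity
    ([ex_global_side_function]).  The two touching balls therefore have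
    different colours, so one of them does not have the colour of infinity, and
    every ray issuing from its centre meets Sigma
    ([tangent_ball_enclosed]).  Radial projection onto the boundary of that
    ball is then 1-Lipschitz on Sigma and onto, so the area of Sigma is at
    least the area of the sphere of radius rho ([encloses_area]).

    Let r be the radius for which the sphere has area a.  The last inequality
    forbids K < 1/r anywhere on Sigma, while K is identically 1/r on the sphere
    ([Ktp_sphere]); hence the sphere minimizes.  In case of equality K cannot
    exceed 1/r everywhere ([tp_energy_gt]), so some touching ball of radius
    exactly r is enclosed.  If Sigma left the boundary of this ball, the radial
    projection would contract by a factor less than 1 near some point, where
    Sigma has positive measure ([locally_flat_measure_gt0]), and the area of
    Sigma would be more than a.  So Sigma is that sphere ([encloses_rigid]).

    The argument asks of Sigma only that it is locally flat, i.e. that it is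
    carried to a hyperplane by local homeomorphisms of the ambient space, and
    that it crosses at x from one touching ball to the other.  For
    C^1-hypersurfaces the defining diffeomorphisms do this
    ([C1_enclosure]).  For fine sets of finite energy with p > m, Markov's
    inequality and the lower density bound produce, in each ball B(x, s), a
    point of Sigma where K is at most a constant times s^(-m/p).  So the beta
    numbers, and by fineness the bilateral ones, decay like s^(1 - m/p)
    ([fine_flat_decay]).  These bounds are summable over dyadic scales, so the
    approximating planes hardly tilt from one scale to the next, and Sigma is
    locally a Lipschitz graph ([reifenberg_flattening]). *)

(** * Euclidean geometry in coordinates *)

Lemma subrBB (V : zmodType) (x y z : V) : (x - z) - (y - z) = x - y.
Proof. by rewrite opprB addrA subrK. Qed.

Section euclidean_geometry.
Context {R : realType} {n : nat}.
Implicit Types (x y z u v w : 'rV[R]_n) (a b t : R).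

Definition dot x y : R := \sum_(i < n) x ord0 i * y ord0 i.

Lemma dotC x y : dot x y = dot y x.
Proof. by apply: eq_bigr => i _; rewrite mulrC. Qed.

Lemma dotDl x y z : dot (x + y) z = dot x z + dot y z.
Proof. by rewrite /dot -big_split; apply: eq_bigr => i _; rewrite mxE mulrDl. Qed.

Lemma dotZl a x y : dot (a *: x) y = a * dot x y.
Proof. by rewrite /dot big_distrr /=; apply: eq_bigr => i _; rewrite mxE mulrA. Qed.

Lemma dotNl x y : dot (- x) y = - dot x y.
Proof. by rewrite -scaleN1r dotZl mulN1r. Qed.

Lemma dotBl x y z : dot (x - y) z = dot x z - dot y z.
Proof. by rewrite dotDl dotNl. Qed.

Lemma dotDr x y z : dot x (y + z) = dot x y + dot x z.
Proof. by rewrite !(dotC x) dotDl. Qed.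

Lemma dotZr a x y : dot x (a *: y) = a * dot x y.
Proof. by rewrite !(dotC x) dotZl. Qed.

Lemma dotNr x y : dot x (- y) = - dot x y.
Proof. by rewrite !(dotC x) dotNl. Qed.

Lemma dotBr x y z : dot x (y - z) = dot x y - dot x z.
Proof. by rewrite dotDr dotNr. Qed.

Lemma dot0l x : dot 0 x = 0.
Proof. by rewrite -(scale0r 0) dotZl mul0r. Qed.

Lemma dot0r x : dot x 0 = 0.
Proof. by rewrite dotC dot0l. Qed.

Definition dotE := (dotDl, dotDr, dotNl, dotNr, dotZl, dotZr, dot0l, dot0r).

Lemma dot_ge0 x : 0 <= dot x x.
Proof. by apply: sumr_ge0 => i _; rewrite -expr2 sqr_ge0. Qed.

Lemma enorm_sqr x : enorm x ^+ 2 = dot x x.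
Proof. by rewrite sqr_sqrtr//; apply: sumr_ge0 => i _; rewrite sqr_ge0. Qed.

Lemma enorm_subZ_sqr x y t :
  enorm (x - t *: y) ^+ 2 = enorm x ^+ 2 - 2 * t * dot x y + t ^+ 2 * enorm y ^+ 2.
Proof. rewrite !enorm_sqr !dotE (dotC y x); ring. Qed.

Lemma dot_eq0 x : (dot x x == 0) = (x == 0).
Proof.
apply/eqP/eqP => [|->]; last by rewrite dot0l.
move=> /psumr_eq0P x0; apply/rowP => i; rewrite mxE.
by apply/eqP; rewrite -sqrf_eq0 expr2 x0// => j _; rewrite -expr2 sqr_ge0.
Qed.

Lemma enorm_eq0 x : (enorm x == 0) = (x == 0).
Proof. by rewrite -sqrf_eq0 enorm_sqr dot_eq0. Qed.

Lemma enorm0 : enorm (0 : 'rV[R]_n) = 0.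
Proof. by apply/eqP; rewrite enorm_eq0. Qed.

Lemma enorm_gt0 x : (0 < enorm x) = (x != 0).
Proof. by rewrite lt_def enorm_ge0 enorm_eq0 andbT. Qed.

Lemma enormZ a x : enorm (a *: x) = `|a| * enorm x.
Proof.
apply/eqP; rewrite -(@eqrXn2 _ 2)// ?mulr_ge0 ?enorm_ge0//.
by rewrite exprMn !enorm_sqr !dotE real_normK ?num_real// expr2 mulrA.
Qed.

Lemma enormN x : enorm (- x) = enorm x.
Proof. by rewrite -scaleN1r enormZ normrN1 mul1r. Qed.

Lemma enormBC x y : enorm (x - y) = enorm (y - x).
Proof. by rewrite -enormN opprB. Qed.

Lemma cauchy_schwarz_sqr x y : dot x y ^+ 2 <= dot x x * dot y y.
Proof.
have [->|y0] := eqVneq y 0; first by rewrite !dot0r mulr0 expr0n.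
have yy : 0 < dot y y by rewrite lt_def dot_ge0 dot_eq0 y0.
have := dot_ge0 (dot y y *: x - dot x y *: y).
rewrite !dotE (dotC y x) => h.
rewrite -subr_ge0 -(pmulr_rge0 _ yy); apply: le_trans h _.
rewrite le_eqVlt; apply/orP; left; apply/eqP; ring.
Qed.

Lemma cauchy_schwarz x y : `|dot x y| <= enorm x * enorm y.
Proof.
rewrite -(@ler_pXn2r _ 2)// ?nnegrE ?mulr_ge0 ?enorm_ge0//.
by rewrite exprMn !enorm_sqr real_normK ?num_real// cauchy_schwarz_sqr.
Qed.

Lemma dot_le x y : dot x y <= enorm x * enorm y.
Proof. exact: le_trans (ler_norm _) (cauchy_schwarz x y). Qed.

Lemma ler_enormD x y : enorm (x + y) <= enorm x + enorm y.
Proof.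
rewrite -(@ler_pXn2r _ 2)// ?nnegrE ?addr_ge0 ?enorm_ge0//.
rewrite sqrrD !enorm_sqr !dotE (dotC y x).
have := dot_le x y; set N := _ * enorm y; lra.
Qed.

Lemma ler_enormB x y : enorm (x - y) <= enorm x + enorm y.
Proof. by rewrite -[leRHS](congr1 (+%R (enorm x)) (enormN y)) ler_enormD. Qed.

Lemma enorm_triangle z x y : enorm (x - y) <= enorm (x - z) + enorm (z - y).
Proof. by apply: le_trans (ler_enormD _ _); rewrite addrA subrK. Qed.

Lemma ler_dist_enorm x y : `|enorm x - enorm y| <= enorm (x - y).
Proof.
have h1 := enorm_triangle y x 0; have h2 := enorm_triangle x y 0.
rewrite !subr0 in h1 h2; rewrite (enormBC y x) in h2.
by rewrite ler_norml; apply/andP; split; lra.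
Qed.

Lemma dot_delta x i : dot x (delta_mx 0 i) = x ord0 i.
Proof.
rewrite /dot (bigD1 i)//= mxE !eqxx mulr1 big1 ?addr0// => j ji.
by rewrite mxE (negbTE ji) andbF mulr0.
Qed.

Lemma enorm_delta i : enorm (delta_mx 0 i : 'rV[R]_n) = 1.
Proof.
by apply/eqP; rewrite -(@eqrXn2 _ 2)// ?enorm_ge0// enorm_sqr dot_delta mxE !eqxx expr1n.
Qed.

Lemma ler_coord_enorm x i : `|x ord0 i| <= enorm x.
Proof. by rewrite -dot_delta (le_trans (cauchy_schwarz _ _))// enorm_delta mulr1. Qed.

Lemma ler_norm_enorm x : `|x| <= enorm x.
Proof.
rewrite [`|x|]mx_normrE; apply/bigmax_leP; split; first exact: enorm_ge0.
by move=> [i j] _ /=; rewrite ord1 ler_coord_enorm.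
Qed.

Lemma ler_enorm_norm x : enorm x <= n%:R * `|x|.
Proof.
rewrite -(@ler_pXn2r _ 2)// ?nnegrE ?mulr_ge0 ?enorm_ge0//.
rewrite enorm_sqr /dot.
apply: (@le_trans _ _ (\sum_(i < n) `|x| ^+ 2)).
  apply: ler_sum => i _; rewrite -expr2 -(real_normK (num_real (x _ _))).
  rewrite ler_pXn2r ?nnegrE//.
  rewrite [`|x|]mx_normrE.
  exact: (le_bigmax (0 : R) (fun ij : 'I_1 * 'I_n => `|x ij.1 ij.2|) (ord0, i)).
rewrite sumr_const card_ord -[leLHS]mulr_natl exprMn ler_wpM2r// ?exprn_ge0//.
by rewrite -natrX ler_nat; case: n => // k; rewrite expnS expn1 leq_pmulr.
Qed.

Lemma nbhs_eball x (e : R) : 0 < e -> nbhs x (eball x e).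
Proof.
move=> e0; have n0 : 0 < n.+1%:R :> R by rewrite ltr0n.
apply/nbhs_ballP; exists (e / n.+1%:R); first exact: divr_gt0.
move=> y; rewrite -ball_normE /= => h; rewrite /eball /= enormBC.
apply: le_lt_trans (ler_enorm_norm _) _.
rewrite ltr_pdivlMr// in h; apply: le_lt_trans h.
by rewrite mulrC ler_wpM2l// ler_nat.
Qed.

Lemma nbhs_eballP x (A : set 'rV[R]_n) :
  nbhs x A <-> exists e : R, 0 < e /\ eball x e `<=` A.
Proof.
split=> [/nbhs_ballP[e /= e0 eA]|[e [e0 eA]]]; last first.
  by apply: (@filterS _ (nbhs x) _ _ _ eA); exact: nbhs_eball.
exists e; split=> // y xy; apply: eA; rewrite -ball_normE /=.
by apply: le_lt_trans (ler_norm_enorm _) _; rewrite enormBC.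
Qed.

(** The topology of row vectors comes from the sup norm, all estimates from
    the Euclidean one; this lemma and [nbhs_eballP] are the passage between
    them, by equivalence of the norms. *)
Lemma continuous_at_eball {V : normedModType R} (f : 'rV[R]_n -> V) x :
  {for x, continuous f} <-> forall e : R, 0 < e -> exists d : R, 0 < d /\
    forall y, enorm (y - x) < d -> `|f x - f y| < e.
Proof.
split=> [fx e e0|h].
  have /cvgrPdist_lt/(_ e e0)/nbhs_eballP[d [d0 dP]] := fx.
  by exists d; split=> // y yx; exact: dP.
apply/(@cvgrPdist_lt _ _ _ _ (nbhs_filter x)) => e e0; apply/nbhs_eballP.
by have [d [d0 dP]] := h _ e0; exists d.
Qed.

Lemma dot_continuous y : continuous (fun x => dot x y).
Proof.
move=> x; apply/continuous_at_eball => e e0.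
have y1 : 0 < enorm y + 1 by rewrite ltr_wpDl ?enorm_ge0.
exists (e / (enorm y + 1)); split=> [|z]; first by rewrite divr_gt0.
rewrite -dotBl => h; apply: le_lt_trans (cauchy_schwarz _ _) _.
move: h; rewrite ltr_pdivlMr// enormBC => h; apply: le_lt_trans h.
by rewrite ler_wpM2l ?enorm_ge0// lerDl.
Qed.

Lemma enorm_continuous : continuous (enorm : 'rV[R]_n -> R).
Proof.
move=> x; apply/continuous_at_eball => e e0; exists e; split=> // y yx.
by apply: le_lt_trans (ler_dist_enorm _ _) _; rewrite enormBC.
Qed.

End euclidean_geometry.

(** * Hyperplanes *)

Section hyperplanes.
Context {R : realType} {n : nat}.
Implicit Types (x y z u v w g : 'rV[R]_n) (L : set 'rV[R]_n).

Definition normalize u : 'rV[R]_n := (enorm u)^-1 *: u.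

Lemma enorm_normalize u : u != 0 -> enorm (normalize u) = 1.
Proof.
move=> u0; rewrite enormZ ger0_norm ?invr_ge0 ?enorm_ge0// mulVf//.
by rewrite enorm_eq0.
Qed.

Lemma normalizeK u : u != 0 -> enorm u *: normalize u = u.
Proof. by move=> u0; rewrite scalerA divff ?scale1r// enorm_eq0. Qed.

Lemma dot_unit u : enorm u = 1 -> dot u u = 1.
Proof. by move=> u1; rewrite -enorm_sqr u1 expr1n. Qed.

Lemma unit_neq0 u : enorm u = 1 -> u != 0.
Proof. by move=> u1; rewrite -enorm_eq0 u1 oner_eq0. Qed.

Definition dotr g v : R^o := dot v g.

Lemma dotr_is_linear g : linear (dotr g).
Proof. by move=> a u v; rewrite /dotr !dotE. Qed.

HB.instance Definition _ g := GRing.isLinear.Build R 'rV[R]_n R^o *:%R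
  (dotr g) (dotr_is_linear g).

Definition hyperplane g : set 'rV[R]_n := [set v | dot v g = 0].

Let dotf g : 'Hom('rV[R]_n, R^o) := linfun (dotr g).

Let lker_dotfE g : [set` lker (dotf g)] = hyperplane g.
Proof.
by apply/seteqP; split=> v /=; rewrite memv_ker lfunE /= /dotr => /eqP.
Qed.

Let dim_lker_dotf g : g != 0 -> \dim (lker (dotf g)) = n.-1.
Proof.
move=> g0; have := limg_ker_dim (dotf g) fullv; rewrite capfv dimvf /dim /= mul1n.
have -> : \dim (limg (dotf g)) = 1%N.
  apply/eqP; rewrite eqn_leq; apply/andP; split.
    by rewrite (leq_trans (dimvS (subvf _)))// dimvf.
  rewrite lt0n dimv_eq0; apply: contra g0 => /eqP h.
  have : dotf g g \in limg (dotf g) by rewrite memv_img ?memvf.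
  by rewrite h memv0 lfunE /= /dotr dot_eq0.
by rewrite addn1 => /(congr1 predn) /= ->.
Qed.

Lemma hyperplane_grassmannian g : g != 0 -> grassmannian n.-1 (hyperplane g).
Proof.
by move=> g0; exists (lker (dotf g)); rewrite lker_dotfE dim_lker_dotf.
Qed.

(** A basis of W, written as the columns of a matrix with n rows and n - 1
    columns, has a nonzero left kernel, i.e. a common normal; equality of
    dimensions then turns the inclusion of W in a hyperplane into equality. *)
Lemma grassmannianP L : (0 < n)%N -> grassmannian n.-1 L ->
  exists g, enorm g = 1 /\ L = hyperplane g.
Proof.
move=> n0 [W [dW ->]].
pose B : 'M[R]_(n, \dim W) := \matrix_(i, j) (vbasis W)`_j ord0 i.
have [g [g0 gB]] : exists g, g != 0 /\ g *m B = 0.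
  have : \rank (kermx B) != 0%N.
    rewrite mxrank_ker -lt0n subn_gt0 (leq_ltn_trans (rank_leq_col _))// dW.
    by case: (n) n0.
  rewrite mxrank_eq0 => /rowV0Pn[g /sub_kermxP gB g0].
  by exists g.
have Wg : [set` W] `<=` hyperplane g.
  move=> v /= /coord_vbasis ->; rewrite /hyperplane /=.
  rewrite -/(dotr g _) linear_sum big1// => i _; rewrite /= /dotr.
  rewrite dotZl; apply/eqP; rewrite mulf_eq0; apply/orP; right; apply/eqP.
  move/rowP/(_ i): gB; rewrite !mxE => <-.
  by apply: eq_bigr => j _; rewrite !mxE mulrC.
exists (normalize g); split; first exact: enorm_normalize.
have -> : hyperplane (normalize g) = hyperplane g.
  apply/seteqP; split=> v; rewrite /hyperplane /= dotZr; last by move=> ->; rewrite mulr0.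
  by move/eqP; rewrite mulf_eq0 invr_eq0 enorm_eq0 (negbTE g0) => /eqP.
rewrite -lker_dotfE; suff -> : W = lker (dotf g) by [].
apply/eqP; rewrite eqEdim dim_lker_dotf// dW leqnn andbT.
apply/subvP => v vW; suff : [set` lker (dotf g)] v by [].
by rewrite lker_dotfE; exact: Wg.
Qed.

(** Exchanging two coordinates of g, one with its sign changed and the others
    replaced by 0, gives a vector orthogonal to g. *)
Lemma ex_dot0 g : (2 <= n)%N -> exists u, enorm u = 1 /\ dot u g = 0.
Proof.
move=> n2; pose i0 : 'I_n := Ordinal (ltnW n2); pose i1 : 'I_n := Ordinal n2.
have [g0|g0] := eqVneq (g ord0 i0) 0.
  exists (delta_mx 0 i0); rewrite enorm_delta; split=> //.
  by rewrite dotC dot_delta.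
pose w := g ord0 i1 *: delta_mx 0 i0 - g ord0 i0 *: delta_mx 0 i1 : 'rV[R]_n.
have w0 : w != 0.
  apply: contra g0 => /eqP/rowP/(_ i1).
  by rewrite !mxE !eqxx /= mulr0 sub0r mulr1 => /eqP; rewrite oppr_eq0.
exists (normalize w); rewrite enorm_normalize//; split=> //.
rewrite dotZl !dotE ![dot (delta_mx _ _) _]dotC !dot_delta.
by rewrite (mulrC (g ord0 i1)) subrr mulr0.
Qed.

End hyperplanes.

(** * Locally constant functions and the sides of a locally flat set *)

Section locally_constant.
Context {R : realType}.

(** Connectedness of the unit interval. *)
Lemma locally_constant_segment (f : R -> bool) :
  (forall t, 0 <= t <= 1 -> exists e : R, 0 < e /\
     forall s, 0 <= s <= 1 -> `|s - t| < e -> f s = f t) ->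
  f 0 = f 1.
Proof.
move=> floc.
(* C b is open, and its trace on [0, 1] is the set where f takes the value b *)
pose C b := \bigcup_(p in [set p : R * R | [/\ 0 <= p.1 <= 1, 0 < p.2, f p.1 = b &
  forall s, 0 <= s <= 1 -> `|s - p.1| < p.2 -> f s = f p.1]]) (ball p.1 p.2 : set R).
have oC b : open (C b) by apply: bigcup_open => p [_ p0 _ _]; exact: ball_open.
have CP b t : 0 <= t <= 1 -> C b t <-> f t = b.
  move=> t01; split=> [[p [p01 p0 <- fp] pt]|<-].
    by apply: fp => //; rewrite distrC.
  have [e [e0 eP]] := floc t t01.
  by exists (t, e) => //; rewrite -ball_normE /= subrr normr0.
have := @segment_connected R 0 1 (`[0, 1] `&` C (f 0)).
have h01 (t : R) : `[0, 1]%classic t -> 0 <= t <= 1 by rewrite /= in_itv.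
have i0 : 0 <= (0 : R) <= 1 by rewrite lexx ler01.
have i1 : 0 <= (1 : R) <= 1 by rewrite lexx ler01.
move=> cn; suff : (`[0, 1]%classic `&` C (f 0)) (1 : R) by case=> _ /CP <-.
rewrite cn; [by rewrite /= in_itv | | by exists (C (f 0)) |].
- by exists 0; split; [rewrite /= in_itv|exact/CP].
- exists (~` C (~~ f 0)); first exact: open_closedC.
  apply/seteqP; split=> t [t01 Ct]; split=> //; have CPt b := CP b t (h01 _ t01).
    by move/CPt: Ct => ft /CPt; rewrite ft; case: (f 0).
  apply/CPt; apply/eqP; apply: contra_notT Ct => ft0; apply/CPt.
  by move: ft0; case: (f t); case: (f 0).
Qed.

End locally_constant.

Section separation.
Context {R : realType} {n : nat}.
Implicit Types (x y z u v c g nu : 'rV[R]_n) (S U V W : set 'rV[R]_n).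
Implicit Types (f : 'rV[R]_n -> bool) (Phi Psi : 'rV[R]_n -> 'rV[R]_n).

Definition eopen W := forall y, W y -> exists e : R, 0 < e /\ eball y e `<=` W.

Definition econtinuous_at x Phi := forall e : R, 0 < e ->
  exists d : R, 0 < d /\ forall y, enorm (y - x) < d -> enorm (Phi y - Phi x) < e.

Definition convex_set W := forall u v (t : R), W u -> W v -> 0 <= t <= 1 ->
  W (u + t *: (v - u)).

Definition locally_constant_off S W f := forall y, W y -> ~ S y ->
  exists e : R, 0 < e /\ forall z, eball y e z -> f z = f y.

(** A two-colouring of W minus S that tells the two sides of S apart.  The
    second clause only asks that both colours occur near each point of S.  It
    does not refer to a chart, so colourings can be glued; near a point of a
    locally flat set it forces the colours to be exchanged across S
    ([side_function_opposite]). *)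
Definition side_function S W f := locally_constant_off S W f /\
  forall y (e : R), W y -> S y -> 0 < e ->
    exists u v, [/\ eball y e u, eball y e v, ~ S u, ~ S v & f u != f v].

(** A homeomorphism Phi from U to V, with inverse Psi, carrying S to the
    hyperplane normal to g.  Continuity is all that is asked, so that both
    C^1-diffeomorphisms and the shears straightening Lipschitz graphs
    qualify. *)
Definition flattening S U V Phi Psi g :=
  [/\ eopen U /\ eopen V,
      forall y, U y -> [/\ V (Phi y), Psi (Phi y) = y & econtinuous_at y Phi],
      forall z, V z -> [/\ U (Psi z), Phi (Psi z) = z & econtinuous_at z Psi],
      g != 0 & forall y, U y -> S y <-> dot (Phi y) g = 0].

Definition locally_flat S := forall x, S x ->
  exists U V Phi Psi g, U x /\ flattening S U V Phi Psi g.

Lemma eball_convex x (r : R) : convex_set (eball x r).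
Proof.
move=> u v t; rewrite /eball /= => xu xv /andP[t0 t1].
have -> : u + t *: (v - u) - x = (1 - t) *: (u - x) + t *: (v - x).
  by apply/rowP => i; rewrite !mxE; ring.
apply: le_lt_trans (ler_enormD _ _) _; rewrite !enormZ.
rewrite (ger0_norm t0) ger0_norm ?subr_ge0//.
have [->|t00] := eqVneq t 0; first by rewrite subr0 mul0r addr0 mul1r.
have tt : 0 < t by rewrite lt_def t00.
have h1 : (1 - t) * enorm (u - x) <= (1 - t) * r by rewrite ler_wpM2l ?subr_ge0// ltW.
have h2 : t * enorm (v - x) < t * r by rewrite ltr_pM2l.
lra.
Qed.

Lemma eball_center x (r : R) : 0 < r -> eball x r x.
Proof. by rewrite /eball /= subrr enorm0. Qed.

Lemma eball_open x (r : R) : eopen (eball x r).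
Proof.
move=> y xy; exists (r - enorm (y - x)); split; first by rewrite subr_gt0.
move=> z; rewrite /eball /= => zy.
by have := enorm_triangle y z x; lra.
Qed.

Lemma locally_constant_path S W f (p : R -> 'rV[R]_n) :
  locally_constant_off S W f ->
  (forall t, 0 <= t <= 1 -> W (p t) /\ ~ S (p t)) ->
  (forall t e : R, 0 <= t <= 1 -> 0 < e -> exists d : R, 0 < d /\
     forall s, 0 <= s <= 1 -> `|s - t| < d -> enorm (p s - p t) < e) ->
  f (p 0) = f (p 1).
Proof.
move=> fW pW pc; apply: (@locally_constant_segment R (f \o p)) => t t01.
have [Wt St] := pW t t01; have [e [e0 fe]] := fW _ Wt St.
have [d [d0 dP]] := pc t e t01 e0.
by exists d; split=> // s s01 st /=; apply: fe; exact: dP.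
Qed.

Lemma line_continuous u v (t e : R) : 0 < e -> exists d : R, 0 < d /\
  forall s, `|s - t| < d -> enorm ((u + s *: v) - (u + t *: v)) < e.
Proof.
move=> e0; have v1 : 0 < enorm v + 1 by rewrite ltr_wpDl ?enorm_ge0.
exists (e / (enorm v + 1)); split=> [|s]; first exact: divr_gt0.
rewrite opprD addrACA subrr add0r -scalerBl enormZ ltr_pdivlMr// => h; apply: le_lt_trans h.
by rewrite ler_wpM2l// lerDl.
Qed.

Lemma locally_constant_convex S W f C : locally_constant_off S W f ->
  C `<=` W -> C `&` S = set0 -> convex_set C ->
  forall u v, C u -> C v -> f u = f v.
Proof.
move=> fW CW CS cC u v Cu Cv.
have := @locally_constant_path S W f (fun t => u + t *: (v - u)) fW.
rewrite scale0r addr0 scale1r [u + _]addrC subrK; apply.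
  move=> t t01; have Ct : C (u + t *: (v - u)) by exact: cC.
  split; first exact: CW.
  by move=> St; have : (C `&` S) (u + t *: (v - u)) by []; rewrite CS.
move=> t e _ e0; have [d [d0 dP]] := line_continuous u (v - u) t e0.
by exists d; split=> // s _; exact: dP.
Qed.

(** Near y, each of the two sides of S is the image under Psi of a half ball,
    which is convex; images of segments join any two points on one side while
    avoiding S. *)
Lemma flattening_sides S U V Phi Psi g y (e : R) :
  flattening S U V Phi Psi g -> U y -> 0 < e ->
  S y -> exists d : R, [/\ 0 < d, d <= e, eball y d `<=` U &
    forall f, locally_constant_off S (eball y e) f ->
      forall u v, eball y d u -> eball y d v ->
      0 < dot (Phi u) g * dot (Phi v) g -> f u = f v].
Proof.
move=> [[oU oV] PhiP PsiP g0 SP] Uy e0 Sy.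
have [Vy PsiPhi cPhi] := PhiP y Uy.
have [d1 [d10 d1V]] := oV _ Vy.
have [_ _ /(_ e e0) [d2 [d20 d2P]]] := PsiP _ Vy.
pose d3 := Num.min d1 d2; have d30 : 0 < d3 by rewrite lt_min d10.
have [d4 [d40 d4P]] := cPhi _ d30.
have [d5 [d50 d5P]] := oU _ Uy.
exists (Num.min e (Num.min d4 d5)); split.
- by rewrite !lt_min e0 d40.
- by rewrite ge_min lexx.
- by move=> z; rewrite /eball /= !lt_min => /and3P[_ _ ?]; exact: d5P.
move=> f fe u v; rewrite /eball /= !lt_min => /and3P[ue u4 u5] /and3P[ve v4 v5] uv.
have Uu : U u by exact: d5P. have Uv : U v by exact: d5P.
have [_ Ku _] := PhiP u Uu; have [_ Kv _] := PhiP v Uv.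
have cB := @eball_convex (Phi y) d3.
pose q t := Phi u + t *: (Phi v - Phi u).
have qB t : 0 <= t <= 1 -> eball (Phi y) d3 (q t).
  by apply: cB; rewrite /eball /=; exact: d4P.
have qV t : 0 <= t <= 1 -> V (q t).
  by move=> /qB; rewrite /eball /= lt_min => /andP[? _]; exact: d1V.
have := @locally_constant_path S (eball y e) f (Psi \o q) fe.
rewrite /= /q scale0r addr0 scale1r [Phi u + _]addrC subrK Ku Kv; apply.
  move=> t t01; split.
    have := qB _ t01; rewrite /eball /= lt_min => /andP[_ h].
    by rewrite -[y in _ - y]PsiPhi; exact: d2P.
  have [Ut Kt _] := PsiP _ (qV t t01) => /(SP _ Ut).
  rewrite Kt /q !dotE => h; move: t01 uv => /andP[t0 t1].
  set a := dot (Phi u) g in h *; set b := dot (Phi v) g in h *.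
  have [a0|a0|a0] := ltrgtP 0 a; last by rewrite -a0 mul0r ltxx.
    rewrite pmulr_rgt0// => b0.
    have [tt|tt] := eqVneq t 0; first by rewrite tt in h; lra.
    have : 0 < t * b by rewrite mulr_gt0// lt_def tt.
    have : 0 <= (1 - t) * a by rewrite mulr_ge0 ?subr_ge0// ltW.
    lra.
  rewrite nmulr_rgt0// => b0.
  have [tt|tt] := eqVneq t 0; first by rewrite tt in h; lra.
  have : t * b < 0 by rewrite pmulr_rlt0// lt_def tt.
  have : (1 - t) * a <= 0 by rewrite mulr_ge0_le0 ?subr_ge0// ltW.
  lra.
move=> t e1 t01 e10; have [_ _ /(_ e1 e10) [d6 [d60 d6P]]] := PsiP _ (qV t t01).
have [d7 [d70 d7P]] := line_continuous (Phi u) (Phi v - Phi u) t d60.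
exists d7; split=> // s s01 st; apply: d6P; exact: d7P.
Qed.

Lemma same_sign_trichotomy (a b c : R) : a != 0 -> b != 0 -> c != 0 ->
  a * b < 0 -> 0 < c * a \/ 0 < c * b.
Proof.
move=> a0 b0 c0 ab.
case: (ltrgtP 0 a) a0 => // a1 _; case: (ltrgtP 0 c) c0 => // c1 _.
- by left; rewrite mulr_gt0.
- by right; rewrite nmulr_rgt0// -(pmulr_rlt0 _ a1).
- by right; rewrite pmulr_rgt0// -(nmulr_rlt0 _ a1).
- by left; rewrite nmulr_rgt0.
Qed.

(** Near y the complement of S has two sides, on each of which f is constant;
    since f takes both values, it takes opposite values on them. *)
Lemma side_function_opposite S W f U V Phi Psi g y (e : R) :
  side_function S W f -> flattening S U V Phi Psi g -> U y -> W y ->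
  S y -> 0 < e -> eball y e `<=` W ->
  exists d : R, [/\ 0 < d, d <= e, eball y d `<=` U &
    forall u v, eball y d u -> eball y d v ->
      dot (Phi u) g * dot (Phi v) g < 0 -> f u = ~~ f v].
Proof.
move=> [fW f2] flat Uy Wy Sy e0 eW.
have [d [d0 de dU dP]] := flattening_sides flat Uy e0 Sy.
exists d; split=> // u v yu yv uv.
have fe : locally_constant_off S (eball y e) f by move=> z /eW; exact: fW.
have [u' [v' [yu' yv' Su' Sv' uv']]] := f2 y d Wy Sy d0.
have [_ _ _ _ SP] := flat.
have nz z : eball y d z -> ~ S z -> dot (Phi z) g != 0.
  by move=> /dU Uz Sz; apply/eqP => /(SP _ Uz).
have {}nzu : dot (Phi u) g != 0 by apply: contraTneq uv => ->; rewrite mul0r ltxx.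
have {}nzv : dot (Phi v) g != 0 by apply: contraTneq uv => ->; rewrite mulr0 ltxx.
have K z : eball y d z -> ~ S z -> f z = f u \/ f z = f v.
  move=> yz Sz; have := same_sign_trichotomy nzu nzv (nz _ yz Sz) uv.
  by case=> h; [left|right]; exact: (dP f).
by move: uv'; case: (K u') => // ->; case: (K v') => // ->; case: (f u); case: (f v).
Qed.

Lemma side_function_nonempty S W f y (e : R) : side_function S W f -> W y -> 0 < e ->
  exists z, eball y e z /\ ~ S z.
Proof.
move=> [_ f2] Wy e0; have [Sy|Sy] := pselect (S y).
  by have [u [v [yu _ Su _ _]]] := f2 y e Wy Sy e0; exists u.
by exists y; split=> //; exact: eball_center.
Qed.

Lemma eballW x (a b : R) : a <= b -> eball x a `<=` eball x b.
Proof. by move=> ab y; rewrite /eball /= => /lt_le_trans; exact. Qed.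

(** The exclusive or of two side functions does not change across S, since
    both change; so it extends to a locally constant function on W, which is
    constant by convexity. *)
Lemma side_function_rigid S W f1 f2 : locally_flat S -> eopen W ->
  side_function S W f1 -> side_function S W f2 -> convex_set W ->
  exists b, forall z, W z -> ~ S z -> f1 z = b (+) f2 z.
Proof.
move=> flatS oW F1 F2 cW.
have key y : W y -> exists b (e : R), [/\ 0 < e, eball y e `<=` W &
    forall z, eball y e z -> ~ S z -> f1 z (+) f2 z = b].
  move=> Wy; have [e [e0 eW]] := oW y Wy; have [Sy|Sy] := pselect (S y); last first.
    have [e1 [e10 P1]] := F1.1 y Wy Sy; have [e2 [e20 P2]] := F2.1 y Wy Sy.
    exists (f1 y (+) f2 y), (Num.min e (Num.min e1 e2)).
    split; [by rewrite !lt_min e0 e10| |].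
      by apply: subset_trans eW; apply: eballW; rewrite ge_min lexx.
    by move=> z; rewrite /eball /= !lt_min => /and3P[_ z1 z2] _; rewrite P1 ?P2.
  have [U [V [Phi [Psi [g [Ux flat]]]]]] := flatS _ Sy.
  have [d1 [d10 d1e d1U P1]] := side_function_opposite F1 flat Ux Wy Sy e0 eW.
  have d1W : eball y d1 `<=` W by apply: subset_trans eW; exact: eballW.
  have [d2 [d20 d2e d2U P2]] := side_function_opposite F2 flat Ux Wy Sy d10 d1W.
  have [d3 [d30 d3e d3U P3]] := flattening_sides flat Ux d20 Sy.
  have W3 : eball y d3 `<=` W by apply: subset_trans d1W; apply: eballW; exact: le_trans d2e.
  have [u [_ [yu _ Su _ _]]] := F1.2 y d3 Wy Sy d30.
  exists (f1 u (+) f2 u), d3; split=> // z yz Sz.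
  have yz2 : eball y d2 z by exact: eballW yz.
  have yu2 : eball y d2 u by exact: eballW yu.
  have yz1 : eball y d1 z by exact: eballW yz2.
  have yu1 : eball y d1 u by exact: eballW yu2.
  have [_ _ _ _ SP] := flat.
  have nz w : eball y d3 w -> ~ S w -> dot (Phi w) g != 0.
    by move=> /d3U Uz ?; apply/eqP => /(SP _ Uz).
  case: (ltrgtP 0 (dot (Phi z) g * dot (Phi u) g)) => h.
  - have L f : locally_constant_off S W f -> f z = f u.
      move=> fW; apply: P3 => // w /(eballW d2e)/d1W; exact: fW.
    by rewrite (L f1 F1.1) (L f2 F2.1).
  - by rewrite (P1 z u)// (P2 z u)//; case: (f1 u); case: (f2 u).
  - by move/esym/eqP: h; rewrite mulf_eq0 (negbTE (nz _ yz Sz)) (negbTE (nz _ yu Su)).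
(* the extension to W of the exclusive or: its value at a point of S is the
   common value near that point, which exists by [key] and is unambiguous
   because S has empty interior *)
pose h y := `[< exists e : R, 0 < e /\ forall z, eball y e z -> ~ S z -> f1 z (+) f2 z >].
have hloc y : W y -> exists e : R, 0 < e /\ forall z, W z -> eball y e z -> h z = h y.
  move=> Wy; have [b [e [e0 eW be]]] := key y Wy; exists e; split=> // z _ yz.
  have hb w : eball y e w -> h w = b.
    move=> yw; have [e1 [e10 e1P]] := eball_open yw.
    have hw v : eball w e1 v -> ~ S v -> f1 v (+) f2 v = b by move=> /e1P; exact: be.
    apply/asboolP/idP => [[e2 [e20 e2P]]|bT].
      have e30 : 0 < Num.min e1 e2 by rewrite lt_min e10.
      have [v [wv Sv]] := side_function_nonempty F1 (eW _ yw) e30.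
      rewrite -(hw v)//; first by apply: e2P => //; apply: eballW wv; rewrite ge_min lexx orbT.
      by apply: eballW wv; rewrite ge_min lexx.
    by exists e1; split=> // v wv Sv; rewrite hw.
  by rewrite !hb//; exact: eball_center.
have hc y z : W y -> W z -> h y = h z.
  move=> Wy Wz.
  have := @locally_constant_segment R (fun t => h (y + t *: (z - y))).
  rewrite /= scale0r addr0 scale1r [y + _]addrC subrK; apply => t t01.
  have Wt : W (y + t *: (z - y)) by exact: cW.
  have [e [e0 eP]] := hloc _ Wt.
  have [d [d0 dP]] := line_continuous y (z - y) t e0.
  by exists d; split=> // s s01 st; apply: eP; [exact: cW|exact: dP].
have [[w Ww]|nW] := pselect (exists w, W w); last by exists true => z Wz; case: nW; exists z.
exists (h w) => z Wz Sz; rewrite (hc _ _ Ww Wz).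
suff -> : h z = f1 z (+) f2 z by case: (f1 z); case: (f2 z).
have [b [e [e0 eW be]]] := key z Wz.
apply/asboolP/idP => [[e1 [e10 e1P]]|bz]; first by apply: e1P => //; exact: eball_center.
exists e; split=> // v zv Sv; rewrite be// -(be z)//; exact: eball_center.
Qed.

End separation.

(** * Global sides of a compact locally flat set *)

Section enclosure.
Context {R : realType} {n : nat}.
Implicit Types (x y z u v c g nu : 'rV[R]_n) (S U V W : set 'rV[R]_n).
Implicit Types (f : 'rV[R]_n -> bool) (Phi Psi : 'rV[R]_n -> 'rV[R]_n).
Implicit Types (a b : 'I_n -> R).

Definition eclosed S := eopen (~` S).

Lemma side_function_ext S W f f' : eclosed S -> eopen W -> side_function S W f' ->
  (forall z, W z -> ~ S z -> f z = f' z) -> side_function S W f.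
Proof.
move=> cS oW [f1 f2] ff'; split=> [y Wy Sy|y e Wy Sy e0].
  have [e1 [e10 P1]] := f1 y Wy Sy; have [e2 [e20 P2]] := cS y Sy.
  have [e3 [e30 P3]] := oW y Wy.
  exists (Num.min e1 (Num.min e2 e3)); split; first by rewrite !lt_min e10 e20.
  move=> z; rewrite /eball /= !lt_min => /and3P[z1 z2 z3].
  by rewrite !ff' ?P1//; [exact: P3|exact: P2].
have [e3 [e30 P3]] := oW y Wy.
have m0 : 0 < Num.min e e3 by rewrite lt_min e0.
have [u [v [yu yv Su Sv uv]]] := f2 y _ Wy Sy m0.
exists u, v; split=> //.
- by apply: eballW yu; rewrite ge_min lexx.
- by apply: eballW yv; rewrite ge_min lexx.
by rewrite !ff'//; apply: P3; [apply: eballW yv|apply: eballW yu]; rewrite ge_min lexx orbT.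
Qed.

Lemma side_functionW S W W' f : W' `<=` W -> side_function S W f -> side_function S W' f.
Proof.
move=> W'W [f1 f2]; split=> [y /W'W|y e /W'W]; first exact: f1.
exact: f2.
Qed.

Lemma side_functionU S W1 W2 f : side_function S W1 f -> side_function S W2 f ->
  side_function S (W1 `|` W2) f.
Proof.
by move=> F1 F2; split=> [y|y e] []; [exact: F1.1|exact: F2.1|exact: F1.2|exact: F2.2].
Qed.

Lemma side_functionN S W f : side_function S W f -> side_function S W (fun z => ~~ f z).
Proof.
move=> [f1 f2]; split=> [y Wy Sy|y e Wy Sy e0].
  by have [e [e0 P]] := f1 y Wy Sy; exists e; split=> // z /P ->.
have [u [v [yu yv Su Sv uv]]] := f2 y e Wy Sy e0; exists u, v; split=> //.
by rewrite (inj_eq (inv_inj negbK)).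
Qed.

(** Two side functions that agree up to a sign b on the overlap of their
    domains fit together once one of them is multiplied by b. *)
Lemma side_function_glue S W1 W2 f1 f2 (b : bool) : eclosed S -> eopen W1 -> eopen W2 ->
  side_function S W1 f1 -> side_function S W2 f2 ->
  (forall z, W1 z -> W2 z -> ~ S z -> f1 z = b (+) f2 z) ->
  exists f, side_function S (W1 `|` W2) f /\
    (forall z, W2 z -> ~ S z -> f z = b (+) f2 z).
Proof.
move=> cS o1 o2 F1 F2 F12.
pose f z := if `[< W1 z >] then f1 z else b (+) f2 z.
have fW2 z : W2 z -> ~ S z -> f z = b (+) f2 z.
  by rewrite /f => W2z Sz; case: asboolP => // W1z; exact: F12.
exists f; split=> //; apply: side_functionU.
  by apply: side_function_ext F1 _ => // z W1z _; rewrite /f asboolT.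
have : side_function S W2 (fun z => b (+) f2 z).
  by case: (b); [exact: (side_functionN F2)|exact: F2].
by move/side_function_ext; apply.
Qed.

(** The sign of dot (Phi z) g; both signs occur near y, at the images under Psi
    of Phi y moved slightly along g in the two directions. *)
Lemma ex_local_side_function S x : locally_flat S -> S x ->
  exists (e : R) f, 0 < e /\ side_function S (eball x e) f.
Proof.
move=> flatS Sx; have [U [V [Phi [Psi [g [Ux [[oU oV] PhiP PsiP g0 SP]]]]]]] := flatS x Sx.
have [e [e0 eU]] := oU x Ux; exists e, (fun z => 0 < dot (Phi z) g); split=> //; split.
  move=> y xy Sy; have Uy := eU _ xy.
  have yg : dot (Phi y) g != 0 by apply/eqP => /(SP _ Uy).
  have [_ _ cy] := PhiP y Uy.
  have e1 : 0 < `|dot (Phi y) g| / (enorm g) by rewrite divr_gt0 ?normr_gt0// enorm_gt0.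
  have [d [d0 dP]] := cy _ e1; exists d; split=> // z yz.
  have := dP z yz; rewrite ltr_pdivlMr ?enorm_gt0// => /(le_lt_trans (cauchy_schwarz _ _)).
  rewrite dotBl ltr_norml => /andP[h1 h2].
  case: (ltrgtP 0 (dot (Phi y) g)) yg h1 h2 => // h _.
    by rewrite gtr0_norm// => h1 h2; apply/idP; lra.
  by rewrite ltr0_norm// => h1 h2; apply/negbTE; rewrite -leNgt; lra.
move=> y e1 xy Sy e10; have Uy := eU _ xy; have /(SP _ Uy) yg := Sy.
have [Vy PsiPhi _] := PhiP y Uy; have [_ _ /(_ e1 e10) [d1 [d10 d1P]]] := PsiP _ Vy.
have [d2 [d20 d2P]] := oV _ Vy.
pose s := Num.min d1 d2 / (2 * enorm g).
have s0 : 0 < s by rewrite divr_gt0 ?mulr_gt0 ?lt_min ?d10 ?enorm_gt0.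
have sg : enorm (s *: g) < Num.min d1 d2.
  have ng : enorm g != 0 by rewrite enorm_eq0.
  rewrite enormZ gtr0_norm// (_ : s * _ = Num.min d1 d2 / 2); last by rewrite /s; field.
  have : 0 < Num.min d1 d2 by rewrite lt_min d10.
  lra.
have gg : 0 < dot g g by rewrite lt_def dot_eq0 g0 dot_ge0.
have K (r : R) : `|r| = 1 -> [/\ eball y e1 (Psi (Phi y + (r * s) *: g)), 
    U (Psi (Phi y + (r * s) *: g)) &
    dot (Phi (Psi (Phi y + (r * s) *: g))) g = r * s * dot g g].
  move=> r1; have : enorm (Phi y + (r * s) *: g - Phi y) < Num.min d1 d2.
    by rewrite addrC addKr -scalerA enormZ r1 mul1r.
  rewrite lt_min => /andP[h1 h2].
  have [UP KP _] := PsiP _ (d2P _ h2).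
  by split=> //; [rewrite /eball /= -[y in _ - y]PsiPhi; exact: d1P|rewrite KP !dotE yg add0r].
have [B1 U1 D1] := K 1 (normr1 _); have [B2 U2 D2] := K (-1) (normrN1 _).
have sgg : 0 < s * dot g g by rewrite mulr_gt0.
exists (Psi (Phi y + (1 * s) *: g)), (Psi (Phi y + (-1 * s) *: g)); split=> //.
- by move/(SP _ U1); rewrite D1; lra.
- by move/(SP _ U2); rewrite D2; lra.
by rewrite D1 D2 mul1r mulN1r mulNr oppr_gt0 sgg ltNge ltW.
Qed.

Lemma side_function_disjoint S W (b : bool) : (forall z, W z -> ~ S z) ->
  side_function S W (fun=> b).
Proof.
by move=> WS; split=> [y _ _|y e Wy Sy _]; [exists 1; split|case: (WS y Wy Sy)].
Qed.

Lemma eopen_open (W : set 'rV[R]_n) : eopen W <-> open W.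
Proof.
split=> [oW|oW y Wy]; last by apply/nbhs_eballP; exact: open_nbhs_nbhs.
by rewrite openE => y /oW /nbhs_eballP.
Qed.

Lemma compact_eclosed S : compact S -> eclosed S.
Proof.
move=> cS; apply/eopen_open; rewrite openC; apply: compact_closed cS.
exact: norm_hausdorff.
Qed.

(** A Lebesgue number for the covering of S by the balls of
    [ex_local_side_function]; balls away from S carry constant side functions. *)
Lemma ex_uniform_side_function S : compact S -> locally_flat S ->
  exists e : R, 0 < e /\ forall x, exists f, side_function S (eball x e) f.
Proof.
move=> cS flatS.
pose P (e : R) x := exists f, side_function S (eball x e) f.
have /compact_near_coveringP/(_ R (0^'+) P _) := cS.
have L x : S x -> \forall x' \near x & e \near 0^'+, P e x'.
  move=> Sx; have [e [f [e0 fe]]] := ex_local_side_function flatS Sx.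
  have e20 : 0 < e / 2 by rewrite divr_gt0.
  exists (eball x (e / 2), [set d | d < e / 2]).
    by split; [exact: nbhs_eball|exact: nbhs_right_lt].
  move=> [x' d] [/= xx' dP]; exists f; apply: side_functionW fe => z.
  rewrite /eball /= => h; apply: le_lt_trans (enorm_triangle x' _ _) _.
  by move: xx'; rewrite /eball /= => ?; lra.
move=> /(_ L) [d' /= d'0 dP'].
have [d [d0 dP]] : exists d : R, 0 < d /\ S `<=` P (d / 2).
  exists d'; split=> //; apply: dP' => /=; last by rewrite divr_gt0.
  by rewrite /ball_ /= sub0r normrN gtr0_norm ?divr_gt0// gtr_pMr// invf_lt1// ltr1n.
(* a ball of radius d / 4 that meets S at y lies in the ball of radius d / 2
   about y *)
exists (d / 4); rewrite divr_gt0//; split=> // x.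
have [[y [xy Sy]]|nS] := pselect (exists y, eball x (d / 4) y /\ S y); last first.
  by exists (fun=> true); apply: side_function_disjoint => z xz Sz; apply: nS; exists z.
have d2 : P (d / 2) y by exact: dP.
case: d2 => f fP; exists f; apply: side_functionW fP => z.
rewrite /eball /= => h; apply: le_lt_trans (enorm_triangle x _ _) _.
by move: xy; rewrite /eball /= (enormBC y) => ?; lra.
Qed.

Definition box a b : set 'rV[R]_n := [set z | forall i, a i < z ord0 i < b i].

Definition upd a (k : 'I_n) (t : R) i := if i == k then t else a i.

Lemma box_open a b : eopen (box a b).
Proof.
move=> y yab.
pose e := \big[Num.min/1]_(i < n) Num.min (y ord0 i - a i) (b i - y ord0 i).
exists e; split.
  by apply: lt_bigmin => // i _; rewrite lt_min !subr_gt0 yab.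
move=> z yz i; have /andP[y1 y2] := yab i.
have : e <= Num.min (y ord0 i - a i) (b i - y ord0 i) by exact: bigmin_le.
rewrite le_min => /andP[e1 e2].
have := le_lt_trans (ler_coord_enorm (z - y) i) yz.
by rewrite !mxE ltr_norml => /andP[z1 z2]; apply/andP; split; lra.
Qed.

Lemma box_convex a b : convex_set (box a b).
Proof.
move=> u v t ub vb /andP[t0 t1] i; rewrite !mxE.
have [->|t00] := eqVneq t 0; first by rewrite mul0r addr0; exact: ub.
have tt : 0 < t by rewrite lt_def t00.
have /andP[u1 u2] := ub i; have /andP[v1 v2] := vb i.
have h1 : t * a i < t * v ord0 i by rewrite ltr_pM2l.
have h2 : t * v ord0 i < t * b i by rewrite ltr_pM2l.
have h3 : (1 - t) * a i <= (1 - t) * u ord0 i by rewrite ler_wpM2l ?subr_ge0// ltW.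
have h4 : (1 - t) * u ord0 i <= (1 - t) * b i by rewrite ler_wpM2l ?subr_ge0// ltW.
by apply/andP; split; lra.
Qed.

Lemma convex_setI W1 W2 : convex_set W1 -> convex_set W2 -> convex_set (W1 `&` W2).
Proof. by move=> c1 c2 u v t [u1 u2] [v1 v2] t01; split; [exact: c1|exact: c2]. Qed.

Lemma eopenI W1 W2 : eopen W1 -> eopen W2 -> eopen (W1 `&` W2).
Proof.
move=> o1 o2 y [/o1[d1 [d10 P1]] /o2[d2 [d20 P2]]].
exists (Num.min d1 d2); split; first by rewrite lt_min d10.
by move=> z; rewrite /eball /= lt_min => /andP[? ?]; split; [exact: P1|exact: P2].
Qed.

(** Boxes are simply connected, so the local choices of sign can be made
    coherently.  Concretely, one lengthens the box in one coordinate at a time: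
    a box is the union of a shorter one and of a slab of width h, whose
    intersection is a box, hence convex, so that [side_function_rigid] provides
    the sign needed for gluing. *)
Lemma ex_box_side_function S a b : compact S -> locally_flat S ->
  exists f, side_function S (box a b) f.
Proof.
move=> cS flatS; have [e [e0 eP]] := ex_uniform_side_function cS flatS.
(* a box with all sides at most h lies in a ball of radius e *)
pose h := e / n.+1%:R.
have h0 : 0 < h by rewrite divr_gt0 ?ltr0n.
have clS := compact_eclosed cS.
(* the first k sides are arbitrary, the others have length at most h *)
have Q k : (k <= n)%N -> forall a b, (forall i : 'I_n, (k <= i)%N -> b i - a i <= h) ->
    exists f, side_function S (box a b) f.
  elim: k => [_ {}a {}b ab|k IH kn].
    have [f fP] := eP (\row_i a i); exists f; apply: side_functionW fP => z zab.
    rewrite /eball /=; apply: le_lt_trans (ler_enorm_norm _) _.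
    have : `|z - \row_i a i| <= h.
      rewrite [`|_|]mx_normrE; apply/bigmax_leP; split; first exact: ltW.
      move=> [i j] _ /=; rewrite ord1 !mxE.
      have /andP[z1 z2] := zab j; have := ab j (leq0n _).
      by rewrite ger0_norm; lra.
    move=> zh; apply: (@le_lt_trans _ _ (n%:R * h)); first by rewrite ler_wpM2l.
    rewrite /h mulrA ltr_pdivrMr ?ltr0n// mulrC ltr_pM2l// ltr_nat//.
  pose K : 'I_n := Ordinal kn.
  (* the k-th side has length at most h + j h / 2; the overlap of the two pieces
     has width h / 2 *)
  have QQ j : forall a b, (forall i : 'I_n, (k.+1 <= i)%N -> b i - a i <= h) ->
      b K - a K <= h + j%:R * (h / 2) -> exists f, side_function S (box a b) f.
    elim: j => [|j IHj] {}a {}b ab abK.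
      apply: IH => [|i]; first exact: ltnW.
      rewrite leq_eqVlt => /predU1P[ki|]; last exact: ab.
      have -> : i = K by apply: val_inj; rewrite /= ki.
      by move: abK; rewrite mul0r addr0.
    have [abh|abh] := leP (b K - a K) h.
      apply: IH => [|i]; first exact: ltnW.
      rewrite leq_eqVlt => /predU1P[ki|]; last exact: ab.
      by have -> : i = K by apply: val_inj; rewrite /= ki.
    have up (c : 'I_n -> R) t (i : 'I_n) : (k < i)%N -> upd c K t i = c i.
      by rewrite /upd; case: eqP => // ->; rewrite ltnn.
    have upK (c : 'I_n -> R) t : upd c K t K = t by rewrite /upd eqxx.
    have [f1 F1] : exists f, side_function S (box a (upd b K (b K - h / 2))) f.
      apply: IHj => [i ki|]; first by rewrite up//; exact: ab.
      by rewrite upK; move: abK; rewrite -natr1; lra.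
    have [f2 F2] : exists f, side_function S (box (upd a K (b K - h)) b) f.
      apply: IH => [|i]; first exact: ltnW.
      rewrite leq_eqVlt => /predU1P[ki|ki]; last by rewrite up//; exact: ab.
      have -> : i = K by apply: val_inj; rewrite /= ki.
      by rewrite upK; lra.
    set W1 := box a _ in F1; set W2 := box _ b in F2.
    have o1 : eopen W1 by exact: box_open.
    have o2 : eopen W2 by exact: box_open.
    have [c cP] := side_function_rigid flatS (eopenI o1 o2)
      (side_functionW (@subIsetl _ _ _) F1) (side_functionW (@subIsetr _ _ _) F2)
      (convex_setI (@box_convex _ _) (@box_convex _ _)).
    have [f [fP _]] := @side_function_glue S W1 W2 f1 f2 c clS o1 o2 F1 F2
      (fun z (z1 : W1 z) (z2 : W2 z) => cP z (conj z1 z2)).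
    exists f; apply: side_functionW fP => z zab.
    have [zK|zK] := ltP (z ord0 K) (b K - h / 2); [left|right] => i; rewrite /upd.
      by case: eqP => // ->; have /andP[-> _] := zab K.
    case: eqP => // ->; have /andP[_ ->] := zab K; rewrite andbT.
    by apply: lt_le_trans zK; lra.
  move=> {}a {}b ab; pose j := Num.bound `|(b K - a K) / (h / 2)|.
  apply: (QQ j) => //.
  have : (b K - a K) / (h / 2) < j%:R by exact: (le_lt_trans (ler_norm _) (archi_boundP (normr_ge0 _))).
  rewrite ltr_pdivrMr ?divr_gt0// => ?.
  by lra.
by apply: (Q n (leqnn _)) => i; rewrite leqNgt ltn_ord.
Qed.

End enclosure.

(** * A touching ball is enclosed *)

Section enclosure_theorem.
Context {R : realType} {n : nat}.
Implicit Types (x y z u v c g nu : 'rV[R]_n) (S U V W : set 'rV[R]_n).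
Implicit Types (f : 'rV[R]_n -> bool) (Phi Psi : 'rV[R]_n -> 'rV[R]_n).

Lemma compact_enorm_bounded S : compact S ->
  exists M : R, 0 < M /\ forall z, S z -> enorm z <= M.
Proof.
move=> /compact_bounded[N [_ NP]]; exists (n%:R * (`|N| + 1) + 1); split.
  by rewrite ltr_wpDl// mulr_ge0// addr_ge0.
move=> z Sz; apply: le_trans (ler_enorm_norm z) _.
have : `|z| <= `|N| + 1.
  by apply: NP => //; rewrite (le_lt_trans (ler_norm _))// ltrDl.
move=> h; have : n%:R * `|z| <= n%:R * (`|N| + 1) by rewrite ler_wpM2l.
lra.
Qed.

Definition outside (M : R) : set 'rV[R]_n := [set z | exists i, M < `|z ord0 i|].

Lemma outside_open M : eopen (outside M).
Proof.
move=> z [i Mz]; exists (`|z ord0 i| - M); split; first by rewrite subr_gt0.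
move=> w zw; exists i; have := le_lt_trans (ler_coord_enorm (w - z) i) zw.
rewrite !mxE => h; have := ler_normB (w ord0 i) (w ord0 i - z ord0 i).
by rewrite opprB addrCA subrr addr0; lra.
Qed.

(** Outside the cube that contains S, the shell is a union of convex slabs, one
    for each face of the cube; f is constant on each slab, and slabs of
    different directions overlap.  Opposite slabs are disjoint and are linked
    through a slab in another direction, which exists because 2 <= n: on the
    line, the two ends of the shell can be on different sides. *)
Lemma side_function_shell S f (M : R) : (2 <= n)%N -> 0 < M ->
  side_function S (box (fun=> - (M + 2)) (fun=> M + 2)) f ->
  (forall z, S z -> ~ outside M z) ->
  exists b, forall z, box (fun=> - (M + 2)) (fun=> M + 2) z -> outside M z -> f z = b.
Proof.
move=> n2 M0 [fS _] SM; set W := box _ _.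
(* the slab beyond the face z_i = +M or -M, and e i s the point above its
   centre *)
pose C (i : 'I_n) (s : bool) := W `&` [set z | M < (-1) ^+ s * z ord0 i].
pose e i (s : bool) : 'rV[R]_n := ((-1) ^+ s * (M + 1)) *: delta_mx 0 i.
have s2 (s : bool) : (-1) ^+ s * (-1) ^+ s = 1 :> R by rewrite -signr_addb addbb.
have cC i s : convex_set (C i s).
  apply: convex_setI; first exact: box_convex.
  move=> u v t /= ub vb /andP[t0 t1]; rewrite !mxE.
  have [->|t00] := eqVneq t 0; first by rewrite mul0r addr0.
  have tt : 0 < t by rewrite lt_def t00.
  have h1 : t * M < t * ((-1) ^+ s * v ord0 i) by rewrite ltr_pM2l.
  have h2 : (1 - t) * M <= (1 - t) * ((-1) ^+ s * u ord0 i) by rewrite ler_wpM2l ?subr_ge0// ltW.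
  by set a := (-1) ^+ s in h1 h2 *; lra.
have Cout i s z : C i s z -> outside M z.
  move=> [_ /= h]; exists i; apply: lt_le_trans h _.
  by rewrite (le_trans (ler_norm _))// normrM normr_sign mul1r.
have fC i s z w : C i s z -> C i s w -> f z = f w.
  apply: (locally_constant_convex fS) => //; first by move=> ? [].
  by rewrite -subset0 => v [/Cout ? /SM].
have Cij i j s t : i != j -> exists z, C i s z /\ C j t z.
  move=> ij; exists (e i s + e j t).
  have ei : (e i s + e j t) ord0 i = (-1) ^+ s * (M + 1).
    by rewrite !mxE !eqxx (negbTE ij) /= mulr1 mulr0 addr0.
  have ej : (e i s + e j t) ord0 j = (-1) ^+ t * (M + 1).
    by rewrite !mxE !eqxx eq_sym (negbTE ij) /= mulr1 mulr0 add0r.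
  have We : W (e i s + e j t).
    move=> k; rewrite -ltr_norml.
    have [->|ki] := eqVneq k i; first by rewrite ei normrM normr_sign mul1r ger0_norm; lra.
    have [->|kj] := eqVneq k j; first by rewrite ej normrM normr_sign mul1r ger0_norm; lra.
    by rewrite !mxE (negbTE ki) (negbTE kj) !andbF !mulr0 addr0 normr0; lra.
  by split; split=> //=; rewrite ?ei ?ej mulrA s2; lra.
have Cee i s : C i s (e i s).
  split=> [k|]; last by rewrite /= !mxE !eqxx /= mulr1 mulrA s2; lra.
  rewrite -ltr_norml mxE normrM normrM normr_sign mul1r mxE eqxx /=.
  by case: (k == i) => /=; rewrite ?normr1 ?normr0 ger0_norm; lra.
have fij i j (s t : bool) : i != j -> f (e i s) = f (e j t).
  by move=> ij; have [z [z1 z2]] := Cij i j s t ij; rewrite (fC i s _ z)// (fC j t _ z).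
pose i0 : 'I_n := Ordinal (ltnW n2); pose i1 : 'I_n := Ordinal n2.
have i01 : i0 != i1 by [].
exists (f (e i0 false)) => z Wz [i Mz].
pose s := z ord0 i < 0.
have Cz : C i s z.
  split=> //; suff : M < (-1) ^+ s * z ord0 i by [].
  rewrite mulr_sign /s; case: (ltP (z ord0 i) 0) => z0 /=; first by rewrite -ltr0_norm.
  by rewrite -(ger0_norm z0).
rewrite (fC i s z (e i s))//; have [->|ii0] := eqVneq i i0; last exact: fij.
by rewrite (fij i0 i1 s false)//; apply: fij; rewrite eq_sym.
Qed.

(** A side function on a large box, extended by its constant value near the
    boundary; normalized to be false near infinity. *)
Lemma ex_global_side_function S : (2 <= n)%N -> compact S -> locally_flat S ->
  exists f (M : R), side_function S setT f /\ forall z, outside M z -> f z = false.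
Proof.
move=> n2 cS flatS; have [M [M0 MP]] := compact_enorm_bounded cS.
have SM z : S z -> ~ outside M z.
  move=> /MP zM [i]; rewrite ltNge => /negP; apply.
  exact: le_trans (ler_coord_enorm _ _) zM.
have [f fP] := ex_box_side_function (fun=> - (M + 2)) (fun=> M + 2) cS flatS.
have [b bP] := side_function_shell n2 M0 fP SM.
have F2 : side_function S (outside M) (fun=> false).
  by apply: side_function_disjoint => z Mz /SM.
have agree z : box (fun=> - (M + 2)) (fun=> M + 2) z -> outside M z -> ~ S z ->
    f z = b (+) false.
  by move=> z1 z2 _; rewrite addbF; exact: bP.
have [F [FP Ff]] := side_function_glue (compact_eclosed cS) (@box_open _ _ _ _)
  (@outside_open M) fP F2 (b := b) agree.
have FT : side_function S setT F.
  apply: side_functionW FP => z _.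
  have [Mz|Mz] := pselect (outside M z); [by right|left] => i.
  rewrite -ltr_norml; have : `|z ord0 i| <= M.
    by rewrite leNgt; apply/negP => h; apply: Mz; exists i.
  lra.
have FM z : outside M z -> F z = b.
  by move=> Mz; rewrite Ff// ?addbF// => /SM.
exists (fun z => b (+) F z), M; split=> [|z Mz]; last by rewrite FM// addbb.
by case: (b); [exact: (side_functionN FT)|exact: FT].
Qed.

(** The inequality on S says that the balls of radius rho centred at
    x + rho nu and x - rho nu miss S, so each has a single colour.  They
    contain x + t nu and x - t nu for small t, where a global side function
    takes different values.  The ball whose colour is not that of infinity is
    separated from infinity by S: no ray from its centre avoids S. *)
Theorem tangent_ball_enclosed S x nu (rho : R) U V Phi Psi g :
  (2 <= n)%N -> compact S -> locally_flat S -> S x ->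
  enorm nu = 1 -> 0 < rho ->
  (forall y, S y -> `|dot (y - x) nu| * (2 * rho) <= enorm (y - x) ^+ 2) ->
  U x -> flattening S U V Phi Psi g ->
  (forall d : R, 0 < d -> exists t, 0 < t < d /\
     dot (Phi (x + t *: nu)) g * dot (Phi (x - t *: nu)) g < 0) ->
  exists c, (forall y, S y -> rho <= enorm (y - c)) /\
    forall u, enorm u = 1 -> exists t, rho <= t /\ S (c + t *: u).
Proof.
move=> n2 cS flatS Sx nu1 rho0 Srho Ux flat cross.
have [F [M [FS FM]]] := ex_global_side_function n2 cS flatS.
have [d [d0 d1 dU dP]] := side_function_opposite FS flat Ux I Sx ltr01 (fun _ _ => I).
have m0 : 0 < Num.min d rho by rewrite lt_min d0.
have [t [/andP[t0]]] := cross _ m0; rewrite lt_min => /andP[td tr] sgn.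
have tnu (s : R) : `|s| = 1 -> eball x d (x + (s * t) *: nu).
  by move=> s1; rewrite /eball /= addrC addKr enormZ nu1 mulr1 normrM s1 mul1r gtr0_norm.
have opp : F (x + t *: nu) = ~~ F (x - t *: nu).
  apply: dP sgn; first by rewrite -[t]mul1r; apply: tnu; rewrite normr1.
  by rewrite -scaleNr -mulN1r; apply: tnu; rewrite normrN1.
have miss (s : R) y : `|s| = 1 -> S y -> rho <= enorm (y - (x + (s * rho) *: nu)).
  move=> s1 Sy; rewrite -(@ler_pXn2r _ 2)// ?nnegrE ?enorm_ge0 ?(ltW rho0)//.
  have := Srho y Sy; rewrite opprD addrA (enorm_subZ_sqr (y - x) nu) nu1 => h.
  have : s * dot (y - x) nu <= `|dot (y - x) nu|.
    by rewrite (le_trans (ler_norm _))// normrM s1 mul1r.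
  move=> /(ler_wpM2r (ltW rho0)) h2.
  have ss : s ^+ 2 = 1 by rewrite -real_normK ?num_real// s1 expr1n.
  rewrite exprMn ss; lra.
have enclosed (s : R) : `|s| = 1 -> F (x + (s * t) *: nu) ->
    exists c, (forall y, S y -> rho <= enorm (y - c)) /\
    forall u, enorm u = 1 -> exists t, rho <= t /\ S (c + t *: u).
  move=> s1 Fs; pose c := x + (s * rho) *: nu; exists c.
  split=> [y|u u1]; first exact: miss.
  have Fc : F c.
    rewrite -(_ : F (x + (s * t) *: nu) = F c)//.
    apply: (locally_constant_convex FS.1 (C := eball c rho)) => //.
    - rewrite -subset0 => y [cy Sy]; have := miss s y s1 Sy.
      by rewrite leNgt; move: cy; rewrite /eball /= => ->.
    - exact: eball_convex.
    - rewrite /eball /= /c opprD addrACA subrr add0r -scalerBl enormZ nu1 mulr1.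
      by rewrite -mulrBr normrM s1 mul1r ltr_norml; apply/andP; split; lra.
    - exact: eball_center.
  apply: contrapT => noS.
  have cSt (r : R) : 0 <= r -> ~ S (c + r *: u).
    move=> r0 Sr; apply: noS; exists r; split=> //.
    by have := miss s _ s1 Sr; rewrite addrC addKr enormZ u1 mulr1 ger0_norm.
  (* a parameter so large that c + T u is outside the cube of size M *)
  pose T : R := n%:R * (`|M| + 1) + enorm c.
  have n0 : 0 < n%:R :> R by rewrite ltr0n ltnW.
  have T0 : 0 <= T by rewrite addr_ge0 ?enorm_ge0// mulr_ge0// addr_ge0.
  have oT : outside M (c + T *: u).
    apply: contrapT => nT.
    have : enorm (c + T *: u) <= n%:R * `|M|.
      apply: le_trans (ler_enorm_norm _) _; rewrite ler_wpM2l//.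
      rewrite [leLHS]mx_normrE; apply/bigmax_leP; split=> // -[i j] _ /=; rewrite ord1.
      apply: le_trans (ler_norm M); rewrite leNgt; apply/negP => h.
      by apply: nT; exists j.
    have := ler_enormB (c + T *: u) c; rewrite addrC addKr enormZ u1 mulr1 ger0_norm//.
    by rewrite /T; lra.
  have : F c = F (c + T *: u).
    have := @locally_constant_path R n S setT F (fun r => c + (r * T) *: u) FS.1.
    rewrite mul0r scale0r addr0 mul1r; apply.
      by move=> r /andP[r0 _]; split=> //; apply: cSt; rewrite mulr_ge0.
    move=> r e _ e0; have [d' [d'0 d'P]] := line_continuous c (T *: u) r e0.
    by exists d'; split=> // q _ /d'P; rewrite !scalerA.
  by rewrite (FM _ oT) Fc.
have [Fp|Fm] := boolP (F (x + t *: nu)).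
  by apply: (enclosed 1); rewrite ?normr1 ?mul1r.
apply: (enclosed (-1)); first by rewrite normrN1.
by move: opp; rewrite (negbTE Fm) mulN1r scaleNr => /esym/negbFE.
Qed.

End enclosure_theorem.

(** * Hausdorff measure: Lipschitz images and coverings *)

Section hausdorff_lipschitz.
Context {R : realType} {n : nat}.
Implicit Types (x y z u v c : 'rV[R]_n) (A B C : set 'rV[R]_n) (m : nat).
Local Open Scope ereal_scope.

Lemma unit_ball_volume_gt0 m : (0 < unit_ball_volume m :> R)%R.
Proof.
suff: (0 < unit_ball_volume m :> R)%R /\ (0 < unit_ball_volume m.+1 :> R)%R by case.
elim: m => [|m [IH1 IH2]]; first by split; rewrite /= ?ltr01 ?ltr0n.
split=> //; rewrite [unit_ball_volume _]/= -/(unit_ball_volume m).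
by rewrite !mulr_gt0// ?pi_gt0// invr_gt0.
Qed.

Lemma ediam_le A (D : R) : (forall x y, A x -> A y -> (enorm (x - y) <= D)%R) ->
  ediam A <= D%:E.
Proof.
by move=> AD; apply: ge_ereal_sup => _ [[x y] [/= Ax Ay] <-]; rewrite lee_fin AD.
Qed.

Lemma le_ediam A x y : A x -> A y -> (enorm (x - y))%:E <= ediam A.
Proof. by move=> Ax Ay; apply: ereal_sup_ubound; exists (x, y). Qed.

Lemma hausdorff_gauge_le m A (D : R) : (0 <= D)%R ->
  (forall x y, A x -> A y -> (enorm (x - y) <= D)%R) ->
  hausdorff_gauge m A <= (unit_ball_volume m * (D / 2) ^+ m)%:E.
Proof.
move=> D0 AD; rewrite /hausdorff_gauge; case: ifPn => [_|/set0P[x Ax]].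
  by rewrite lee_fin mulr_ge0 ?unit_ball_volume_ge0// exprn_ge0// divr_ge0.
have xx := le_ediam Ax Ax; have := ediam_le AD.
case: (ediam A) xx => [r| |]//= r0; rewrite !lee_fin in r0 * => rD.
rewrite -EFinM -EFin_expe -EFinM lee_fin ler_wpM2l ?unit_ball_volume_ge0//.
have r0' := le_trans (enorm_ge0 _) r0.
by rewrite lerXn2r ?nnegrE ?divr_ge0// ler_pM2r.
Qed.

(** The diameter is only known to be an extended real, -oo for the empty set;
    here it is replaced by a real number D. *)
Lemma hausdorff_gaugeE m C x (d : R) : C x -> ediam C <= d%:E ->
  exists D : R, [/\ (0 <= D)%R, (forall y z, C y -> C z -> (enorm (y - z) <= D)%R) &
    hausdorff_gauge m C = (unit_ball_volume m * (D / 2) ^+ m)%:E].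
Proof.
move=> Cx Cd; have C0 : C != set0 by apply/set0P; exists x.
have xx := le_ediam Cx Cx; move: (@le_ediam C); rewrite /hausdorff_gauge (negbTE C0).
case: (ediam C) xx Cd => [D| |]//= D0 _ DP; exists D; split.
- by apply: le_trans (enorm_ge0 _) _; rewrite -lee_fin; exact: D0.
- by move=> y z Cy Cz; rewrite -lee_fin; exact: DP.
by rewrite EFinM EFin_expe EFinM.
Qed.

Lemma hausdorff_premeasure_le_measure m (d : R) A : (0 < d)%R ->
  hausdorff_premeasure m d A <= hausdorff_measure m A.
Proof. by move=> d0; apply: ereal_sup_ubound; exists d. Qed.

(** The images of the traces on A of a covering of A by sets of diameter at
    most d / L cover f(A) by sets of diameter at most d, and their gauges grow
    by at most L ^ m. *)
Lemma hausdorff_measure_lipschitz m A (f : 'rV[R]_n -> 'rV[R]_n) (L : R) : (0 < L)%R ->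
  (forall x y, A x -> A y -> (enorm (f x - f y) <= L * enorm (x - y))%R) ->
  hausdorff_measure m (f @` A) <= (L ^+ m)%:E * hausdorff_measure m A.
Proof.
move=> L0 fL; apply: ge_ereal_sup => _ [d /= d0 <-].
apply: (@le_trans _ _ ((L ^+ m)%:E * hausdorff_premeasure m (d / L) A)); last first.
  apply: lee_wpmul2l; first by rewrite lee_fin exprn_ge0// ltW.
  by apply: hausdorff_premeasure_le_measure; rewrite divr_gt0.
rewrite -lee_pdivrMl ?exprn_gt0//; apply: le_ereal_inf_tmp => _ [C [Cd AC] <-].
rewrite lee_pdivrMl ?exprn_gt0//.
have gC k : exists D : R, [/\ (0 <= D)%R, (D <= d / L)%R, (forall x y, C k x -> C k y -> (enorm (x - y) <= D)%R) &
    (unit_ball_volume m * (D / 2) ^+ m)%:E <= hausdorff_gauge m (C k) \/ C k = set0].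
  have [->|/set0P[x Cx]] := eqVneq (C k) set0.
    by exists 0%R; split=> //; [rewrite divr_ge0// ltW|right].
  have [D [D0 DP gD]] := hausdorff_gaugeE m Cx (Cd k).
  exists (Num.min D (d / L))%R; split.
  - by rewrite le_min D0 divr_ge0// ltW.
  - by rewrite ge_min lexx orbT.
  - move=> y z Cy Cz; rewrite le_min DP//= -lee_fin.
    exact: le_trans (le_ediam Cy Cz) (Cd k).
  - left; rewrite gD lee_fin ler_wpM2l ?unit_ball_volume_ge0// lerXn2r ?nnegrE//.
    + by rewrite divr_ge0// le_min D0 divr_ge0// ltW.
    + by rewrite divr_ge0.
    + by rewrite ler_pM2r// ge_min lexx.
apply: (@le_trans _ _ (\sum_(k <oo) hausdorff_gauge m (f @` (C k `&` A)))).
  apply: ereal_inf_lbound; exists (fun k => f @` (C k `&` A)) => //; split=> [k|].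
    apply: ediam_le => _ _ [x [Cx Ax] <-] [y [Cy Ay] <-].
    have [D [D0 Dd DP _]] := gC k; apply: le_trans (fL _ _ Ax Ay) _.
    by rewrite mulrC -ler_pdivlMr// (le_trans _ Dd)// DP.
  move=> _ [x Ax <-]; have [k _ Ckx] := AC x Ax.
  by exists k => //; exists x.
rewrite -nneseriesZl; last by move=> k _; exact: hausdorff_gauge_ge0.
apply: lee_nneseries => k _; first by move=> *; exact: hausdorff_gauge_ge0.
have [D [D0 Dd DP [gD|C0]]] := gC k; last first.
  by rewrite C0 set0I image_set0 /hausdorff_gauge eqxx mule0.
apply: (@le_trans _ _ (unit_ball_volume m * ((L * D) / 2) ^+ m)%:E).
  apply: hausdorff_gauge_le; first by rewrite mulr_ge0// ltW.
  move=> _ _ [x [Cx Ax] <-] [y [Cy Ay] <-]; apply: le_trans (fL _ _ Ax Ay) _.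
  by rewrite ler_pM2l// DP.
apply: le_trans (lee_wpmul2l _ gD); last by rewrite lee_fin exprn_ge0// ltW.
by rewrite -mulrA exprMn mulrCA.
Qed.

HB.instance Definition _ m d := isOuterMeasure.Build R 'rV[R]_n
  (hausdorff_premeasure m d) (hausdorff_premeasure0 m d)
  (hausdorff_premeasure_ge0 m d) (@le_hausdorff_premeasure R n m d)
  (@hausdorff_premeasure_sigma_subadditive R n m d).

Lemma hausdorff_premeasure_le_gauge m (d : R) C : ediam C <= d%:E ->
  hausdorff_premeasure m d C <= hausdorff_gauge m C.
Proof.
move=> Cd; pose F k : set 'rV[R]_n := if k is 0%N then C else set0.
apply: (@le_trans _ _ (\sum_(k <oo) hausdorff_gauge m (F k))).
  apply: ereal_inf_lbound; exists F => //; split=> [[|k]//=|x Cx].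
    by rewrite ediam_set0 leNye.
  by exists 0%N.
rewrite nneseries_recl//; last by move=> *; rewrite hausdorff_gauge_ge0.
rewrite eseries_cond/= eseries0 ?adde0// => -[|]//= k _ _.
by rewrite /hausdorff_gauge eqxx.
Qed.

Lemma outer_measure_finite_union (T : Type) (mu : {outer_measure set T -> \bar R})
    (I : eqType) (s : seq I) (F : I -> set T) (A : set T) :
  (forall x : T, A x -> exists2 i, i \in s & F i x) -> mu A <= \sum_(i <- s) mu (F i).
Proof.
elim: s A => [|i s IH] A AF.
  have -> : A = set0 by rewrite -subset0 => x /(AF x)[].
  by rewrite outer_measure0 big_nil.
rewrite big_cons; apply: (@le_trans _ _ (mu (F i `|` (A `\` F i)))).
  by apply: le_outer_measure => x Ax; have [|] := pselect (F i x); [left|right].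
apply: le_trans (outer_measureU2 _ _ _) _; apply: leeD => //; apply: IH => x [Ax Fx].
have [j] := AF x Ax; rewrite in_cons => /predU1P[->//|js Fj].
by exists j.
Qed.

Lemma hausdorff_measure_finite_cover m A (c : R) : (0 <= c)%R ->
  (forall d : R, (0 < d)%R -> exists (T : finType) (F : T -> set 'rV[R]_n) (D : R),
     [/\ (0 <= D <= d)%R, (forall t x y, F t x -> F t y -> (enorm (x - y) <= D)%R),
         (forall x, A x -> exists t, F t x) &
         (#|T|%:R * D ^+ m <= c)%R]) ->
  hausdorff_measure m A < +oo.
Proof.
move=> c0 cov; apply: (@le_lt_trans _ _ (unit_ball_volume m * c)%:E); last exact: ltry.
apply: ge_ereal_sup => _ [d /= d0 <-].
have [T [F [D [/andP[D0 Dd] FD AF TD]]]] := cov d d0.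
apply: le_trans (@outer_measure_finite_union _ _ T (enum T) F A _) _.
  by move=> x /AF[t Ft]; exists t => //; rewrite mem_enum.
apply: (@le_trans _ _ (\sum_(i <- enum T) (unit_ball_volume m * D ^+ m)%:E)).
  apply: lee_sum => t _; apply: le_trans (hausdorff_premeasure_le_gauge _ _) _.
    by apply: ediam_le => x y Fx Fy; apply: le_trans Dd; exact: FD Fx Fy.
  apply: le_trans (hausdorff_gauge_le _ D0 (FD t)) _.
  rewrite lee_fin ler_wpM2l ?unit_ball_volume_ge0// lerXn2r ?nnegrE ?divr_ge0//.
  by rewrite ler_pdivrMr// ler_peMr// ler1n.
rewrite sumEFin lee_fin big_const_seq count_predT -cardE iter_addr addr0.
rewrite -mulr_natl mulrCA ler_wpM2l ?unit_ball_volume_ge0//.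
Qed.

End hausdorff_lipschitz.

(** * Closed sets are Caratheodory measurable for Hausdorff measure *)

Section hausdorff_borel.
Context {R : realType} {n : nat}.
Implicit Types (x y z u v c : 'rV[R]_n) (A B C F X : set 'rV[R]_n) (m : nat).
Local Open Scope ereal_scope.

Lemma le_hausdorff_premeasure_diam m A (d1 d2 : R) : (d1 <= d2)%R ->
  hausdorff_premeasure m d2 A <= hausdorff_premeasure m d1 A.
Proof.
move=> d12; apply: ereal_inf_le_tmp => _ [C [Cd AC] <-]; exists C => //; split=> // k.
by apply: le_trans (Cd k) _; rewrite lee_fin.
Qed.

Lemma hausdorff_premeasure_separated m A B (d e : R) : (d < e)%R ->
  (forall x y, A x -> B y -> (e <= enorm (x - y))%R) ->
  hausdorff_premeasure m d A + hausdorff_premeasure m d B <=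
  hausdorff_premeasure m d (A `|` B).
Proof.
move=> de AB; apply: le_ereal_inf_tmp => _ [C [Cd ABC] <-].
pose CA k := if `[< C k `&` A = set0 >] then set0 else C k.
pose CB k := if `[< C k `&` A = set0 >] then C k else set0.
have -> : \sum_(k <oo) hausdorff_gauge m (C k) =
    \sum_(k <oo) (hausdorff_gauge m (CA k) + hausdorff_gauge m (CB k)).
  apply: eq_eseriesr => k _; rewrite /CA /CB; case: asboolP => _.
    by rewrite /hausdorff_gauge eqxx add0e.
  by rewrite [X in _ + X]/hausdorff_gauge eqxx adde0.
rewrite nneseriesD; [|by move=> *; exact: hausdorff_gauge_ge0..].
apply: leeD; apply: ereal_inf_lbound.
  exists CA => //; split=> [k|x Ax].
    by rewrite /CA; case: asboolP => // _; rewrite ediam_set0 leNye.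
  have [k _ Ckx] := ABC x (or_introl Ax); exists k => //; rewrite /CA; case: asboolP => // h.
  by have : (C k `&` A) x by []; rewrite h.
exists CB => //; split=> [k|y By].
  by rewrite /CB; case: asboolP => // _; rewrite ediam_set0 leNye.
have [k _ Cky] := ABC y (or_intror By); exists k => //; rewrite /CB; case: asboolP => // h.
exfalso; apply: h; rewrite -subset0 => x [Ckx Ax].
have := le_trans (le_ediam Ckx Cky) (Cd k); rewrite lee_fin => h.
by have := AB x y Ax By; lra.
Qed.

(** Sets of diameter less than e cannot meet both A and B, so a fine covering of
    the union splits into a covering of A and one of B: Hausdorff measure is a
    metric outer measure. *)
Lemma hausdorff_measure_separated m A B (e : R) : (0 < e)%R ->
  (forall x y, A x -> B y -> (e <= enorm (x - y))%R) ->
  hausdorff_measure m A + hausdorff_measure m B <= hausdorff_measure m (A `|` B).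
Proof.
move=> e0 AB; set X := hausdorff_measure m (A `|` B).
have key (d1 d2 : R) : (0 < d1)%R -> (0 < d2)%R ->
    hausdorff_premeasure m d1 A + hausdorff_premeasure m d2 B <= X.
  move=> d10 d20; pose d := (Num.min (e / 2) (Num.min d1 d2))%R.
  have d0 : (0 < d)%R by rewrite !lt_min d10 d20 divr_gt0.
  have dd1 : (d <= d1)%R by rewrite !ge_min lexx orbT.
  have dd2 : (d <= d2)%R by rewrite !ge_min lexx !orbT.
  apply: (@le_trans _ _ (hausdorff_premeasure m d A + hausdorff_premeasure m d B)).
    by apply: leeD; exact: le_hausdorff_premeasure_diam.
  apply: le_trans (hausdorff_premeasure_le_measure _ _ d0).
  apply: (@hausdorff_premeasure_separated _ _ _ _ e) => //.
  by rewrite gt_min; apply/orP; left; lra.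
have [->|Xoo] := eqVneq X +oo; first by rewrite leey.
have fin (d1 : R) : (0 < d1)%R -> hausdorff_premeasure m d1 A \is a fin_num.
  move=> d10; rewrite ge0_fin_numE ?hausdorff_premeasure_ge0//.
  apply: (@le_lt_trans _ _ X); last by rewrite ltey.
  by apply: le_trans (key d1 d1 d10 d10); rewrite leeDl ?hausdorff_premeasure_ge0.
have keyB (d1 : R) : (0 < d1)%R -> hausdorff_premeasure m d1 A + hausdorff_measure m B <= X.
  move=> d10; rewrite -leeBrDl ?fin//; apply: ge_ereal_sup => _ [d2 /= d20 <-].
  by rewrite leeBrDl ?fin// key.
have finB : hausdorff_measure m B \is a fin_num.
  rewrite ge0_fin_numE ?hausdorff_measure_ge0//.
  apply: (@le_lt_trans _ _ X); last by rewrite ltey.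
  by apply: le_trans (keyB 1%R ltr01); rewrite leeDr ?hausdorff_premeasure_ge0.
rewrite -leeBrDr//; apply: ge_ereal_sup => _ [d1 /= d10 <-].
by rewrite leeBrDr// keyB.
Qed.

(** Caratheodory's criterion for metric outer measures.  Let A k be the part of
    X at distance at least 1/(k+1) from F.  Since A k is at a positive distance
    from F, additivity holds for it, and it remains to see that H (A k) tends
    to H (X minus F).  The rings D k = A k+1 minus A k of equal parity are at
    positive distances from one another, so their measures sum to at most H X;
    hence the series of all H (D k) converges and its tails vanish. *)
Lemma closed_caratheodory m F : eclosed F ->
  caratheodory_measurable (hausdorff_measure m) F.
Proof.
move=> cF; apply: le_caratheodory_measurable => X.
pose H : set 'rV[R]_n -> \bar R := hausdorff_measure m.
change (H (X `&` F) + H (X `&` ~` F) <= H X).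
have [->|Xoo] := eqVneq (H X) +oo; first by rewrite leey.
pose r k : R := (k.+1%:R^-1)%R.
have r0 k : (0 < r k)%R by rewrite invr_gt0.
have rS k : (r k.+1 < r k)%R by rewrite ltf_pV2 ?posrE// ltr_nat.
pose A k := X `&` [set x | forall y, F y -> (r k <= enorm (x - y))%R].
pose D k := A k.+1 `\` A k.
have AS k : A k `<=` A k.+1.
  by move=> x [Xx Ax]; split=> // y /Ax; exact/le_trans/ltW.
have AX k : A k `<=` X by move=> x [].
have HA k : H (A k) <= H X by apply: le_hausdorff_measure.
have HXfin : H X \is a fin_num by rewrite ge0_fin_numE ?hausdorff_measure_ge0// ltey.
have fin Y : Y `<=` X -> H Y \is a fin_num.
  move=> YX; rewrite ge0_fin_numE ?hausdorff_measure_ge0//.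
  by apply: le_lt_trans (le_hausdorff_measure _ YX) _; rewrite ltey.
have sep k : H (D k.+1) + H (A k) <= H (A k.+2).
  apply: (@le_trans _ _ (H (D k.+1 `|` A k))); last first.
    by apply: le_hausdorff_measure => x [[? _]//|/AS/AS].
  apply: (@hausdorff_measure_separated _ _ _ (r k - r k.+1)); first by rewrite subr_gt0.
  move=> x y [[Xx _] nA] [Xy Ay].
  have [z [Fz xz]] : exists z, F z /\ (enorm (x - z) < r k.+1)%R.
    apply: contrapT => h; apply: nA; split=> // z Fz.
    by rewrite leNgt; apply/negP => h'; apply: h; exists z.
  have := enorm_triangle x y z; rewrite (enormBC y x) => h.
  by have := Ay z Fz; lra.
(* both parities at once: each ring is added to the A of its own parity *)
have sumD N : \sum_(k < N) H (D k.+1) + (H (A 0%N) + H (A 1%N)) <= H (A N) + H (A N.+1).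
  elim: N => [|N IH]; first by rewrite big_ord0 add0e.
  rewrite big_ord_recr /= addeAC.
  apply: (@le_trans _ _ (H (A N) + H (A N.+1) + H (D N.+1))); first exact: leeD2r.
  by rewrite addeAC addeC leeD2l// addeC.
have sumfin : \sum_(k <oo) H (D k) < +oo.
  rewrite nneseries_recl//; last by move=> *; exact: hausdorff_measure_ge0.
  rewrite lte_add_pinfty//.
    by rewrite -ge0_fin_numE ?hausdorff_measure_ge0// fin// => x [/AX].
  apply: (@le_lt_trans _ _ (H X + H X)); last by rewrite lte_add_pinfty ?ltey.
  apply: lime_le.
    by apply: is_cvg_nneseries => *; exact: hausdorff_measure_ge0.
  apply: nearW => -[|N].
    by rewrite big_geq// adde_ge0 ?hausdorff_measure_ge0.
  rewrite big_add1 big_mkord; apply: le_trans (leeD (HA N) (HA N.+1)).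
  by apply: le_trans (sumD N); rewrite leeDl// adde_ge0 ?hausdorff_measure_ge0.
have bnd N : H (X `&` F) + H (X `&` ~` F) <= H X + \sum_(N <= k <oo) H (D k).
  apply: (@le_trans _ _ (H (X `&` F) + (H (A N) + \sum_(N <= k <oo) H (D k)))).
    apply: leeD2l; apply: le_trans (leeD2l _ (outer_measure_sigma_subadditive_tail _ _ _)).
    apply: le_trans (outer_measureU2 _ _ _); apply: le_outer_measure => x [Xx Fx].
    have [e [e0 eF]] := cF x Fx.
    have [k ke] : exists k, (r k <= e)%R.
      have := archi_boundP (ltW (divr_gt0 ltr01 e0)); set k := Num.bound _ => h.
      exists k; rewrite /r -[e]invrK lef_pV2 ?posrE ?invr_gt0//.
      by rewrite -div1r (le_trans (ltW h))// ler_nat.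
    have Ak : A k x.
      split=> // y Fy; apply: le_trans ke _; rewrite leNgt; apply/negP => h.
      by apply: (eF y) => //; rewrite /eball /= enormBC.
    have [AN|AN] := pselect (A N x); [by left|right].
    have ex : exists j, `[< A j x >] by exists k; apply/asboolP.
    case: (ex_minnP ex) => j /asboolP Ajx jmin.
    have Nj : (N < j)%N.
      rewrite ltnNge; apply/negP => jN; apply: AN.
      elim: N jN => [|N IH]; first by rewrite leqn0 => /eqP <-.
      by rewrite leq_eqVlt => /predU1P[<-//|/IH/AS].
    case: j Ajx jmin Nj => // j Ajx jmin Nj; exists j; first by rewrite /= /mkset ltnNge; apply/negP; rewrite -ltnS Nj.
    split=> // Ajx'; have : (j < j)%N by apply: jmin; apply/asboolP.
    by rewrite ltnn.
  rewrite addeA leeD2r//; apply: le_trans (hausdorff_measure_separated _ (r0 N) _) _.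
    by move=> x y [_ Fx] [_ Ay]; rewrite enormBC; exact: Ay.
  by apply: le_hausdorff_measure => x [[]//|/AX].
have tail := nneseries_tail_cvg sumfin (fun k _ => hausdorff_measure_ge0 m (D k)).
have cv : (H X + \sum_(N <= k <oo) H (D k)) @[N --> \oo] --> H X + 0.
  apply: cvgeD; [by rewrite fin_num_adde_defr|exact: cvg_cst|exact: tail].
rewrite adde0 in cv; apply: cvge_to_ge cv _; exact: nearW.
Qed.

End hausdorff_borel.

(** * Hausdorff measure of a cube face *)

Section hausdorff_hyperplane.
Context {R : realType} {m : nat}.
Implicit Types (x y z u v c e : 'rV[R]_m.+1) (A B C F X : set 'rV[R]_m.+1).

Definition face (i : 'I_m.+1) (s : R) : set 'rV[R]_m.+1 :=
  [set z | z ord0 i = s /\ forall j, j != i -> 0 <= z ord0 j <= 1].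

Definition grid_point (i : 'I_m.+1) (s : R) (N : nat) (q : {ffun 'I_m -> 'I_N}) :
    'rV[R]_m.+1 :=
  \row_j (if unlift i j is Some k then (q k)%:R / N%:R else s).

Lemma grid_point_lift i s N (q : {ffun 'I_m -> 'I_N}) k :
  grid_point i s q ord0 (lift i k) = (q k)%:R / N%:R.
Proof. by rewrite mxE liftK. Qed.

Lemma grid_point_face i s N (q : {ffun 'I_m -> 'I_N}) : face i s (grid_point i s q).
Proof.
split=> [|j ji]; first by rewrite mxE unlift_none.
case: (unliftP i j) ji => [k ->|->]; rewrite ?eqxx// => _; rewrite grid_point_lift.
have N0 : (0 < N)%N by case: (N) (q k) => // -[].
apply/andP; split; first by rewrite divr_ge0.
by rewrite ler_pdivrMr ?ltr0n// mul1r ler_nat ltnW.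
Qed.

(** Subdivide the face into N ^ m cubes of side 1/N. *)
Lemma hausdorff_measure_face_fin i (s : R) : (hausdorff_measure m (face i s) < +oo)%E.
Proof.
pose c : R := (m.+1%:R) ^+ m.
apply: (@hausdorff_measure_finite_cover R m.+1 m (face i s) c).
  by rewrite exprn_ge0.
move=> d d0; pose k := Num.bound (m.+1%:R / d); pose N := k.+1.
have N0 : 0 < N%:R :> R by rewrite ltr0n.
have Nd : m.+1%:R / N%:R <= d.
  rewrite ler_pdivrMr// mulrC -ler_pdivrMr//.
  have := archi_boundP (ltW (divr_gt0 (ltr0Sn R m) d0)).
  by move=> /ltW /le_trans; apply; rewrite ler_nat.
pose F (q : {ffun 'I_m -> 'I_N}) : set 'rV[R]_m.+1 :=
  [set z | z ord0 i = s /\ forall k, (q k)%:R / N%:R <= z ord0 (lift i k) <= (q k).+1%:R / N%:R].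
exists {ffun 'I_m -> 'I_N}, F, (m.+1%:R / N%:R); split.
- by rewrite Nd andbT divr_ge0.
- move=> q x y [xi xP] [yi yP]; apply: le_trans (ler_enorm_norm _) _.
  rewrite ler_wpM2l// [leLHS]mx_normrE; apply/bigmax_leP; split; first by rewrite invr_ge0 ltW.
  move=> [a j] _ /=; rewrite ord1 !mxE; case: (unliftP i j) => [l ->|->]; last first.
    by rewrite xi yi subrr normr0 invr_ge0 ltW.
  have /andP[x1 x2] := xP l; have /andP[y1 y2] := yP l.
  have : (q l).+1%:R / N%:R = (q l)%:R / N%:R + N%:R^-1 :> R by rewrite -natr1 mulrDl mul1r.
  by move=> h; rewrite ler_norml; apply/andP; split; lra.
- move=> x [xi xP].
  have xl (l : 'I_m) : exists t : 'I_N, t%:R / N%:R <= x ord0 (lift i l) <= t.+1%:R / N%:R.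
    have /xP /andP[x0 x1] : lift i l != i by rewrite eq_sym neq_lift.
    have tr := truncn_itv (mulr_ge0 x0 (ltW N0)).
    set t := Num.trunc _ in tr; move: tr => /andP[t1 t2].
    have [tN|tN] := ltnP t N.
      by exists (Ordinal tN); rewrite ler_pdivrMr// t1 ler_pdivlMr// ltW.
    have x1' : x ord0 (lift i l) = 1.
      apply/eqP; rewrite eq_le x1/= -(ler_pM2r N0) mul1r; apply: le_trans t1.
      by rewrite ler_nat.
    (* a coordinate equal to 1 is put into the last interval *)
    exists ord_max; rewrite x1' /= ler_pdivrMr// mul1r ler_nat leqnSn/=.
    by rewrite ler_pdivlMr// mul1r.
  have [q qP] := choice xl.
  by exists [ffun l => q l]; split=> // l; rewrite ffunE.
- by rewrite card_ffun !card_ord natrX -exprMn mulrCA divff ?mulr1 ?gt_eqF.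
Qed.

(** Points of G are within distance D of one another, so each of their integer
    coordinates varies by at most K = floor (N D); reducing the coordinates
    modulo K + 1 is then injective on G. *)
Lemma grid_count i s N (G : {set {ffun 'I_m -> 'I_N}}) (D : R) : (0 < N)%N -> 0 <= D ->
  (forall p q, p \in G -> q \in G ->
    enorm (grid_point i s p - grid_point i s q) <= D) ->
  #|G|%:R <= (N%:R * D + 1) ^+ m.
Proof.
move=> N0 D0 GD; have Nr : 0 < N%:R :> R by rewrite ltr0n.
pose K := Num.trunc (N%:R * D).
have /andP[K1 K2] := truncn_itv (mulr_ge0 (ltW Nr) D0); rewrite -/K in K1 K2.
pose phi (q : {ffun 'I_m -> 'I_N}) : {ffun 'I_m -> 'I_K.+1} := [ffun l => inord (q l %% K.+1)].
have inj : {in G &, injective phi}.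
  move=> p q Gp Gq /ffunP pq; apply/ffunP => l; apply: val_inj.
  have /(congr1 (@nat_of_ord _)) := pq l; rewrite !ffunE !inordK ?ltn_mod// => pql.
  wlog ple : p q Gp Gq {pq} pql / (p l <= q l)%N => [H|].
    have [|/ltnW] := leqP (p l) (q l); [exact: H|by move=> h; rewrite (H q p)].
  have : (q l - p l <= K)%N.
    rewrite -(ler_nat R) natrB//.
    have : N%:R * enorm (grid_point i s p - grid_point i s q) < K.+1%:R.
      by apply: le_lt_trans K2; rewrite ler_wpM2l// ?GD// ltW.
    move=> h; rewrite -natrB// ler_nat -ltnS -(ltr_nat R) natrB//.
    apply: le_lt_trans h; rewrite mulrC -ler_pdivrMr//.
    apply: le_trans (ler_coord_enorm _ (lift i l)).
    by rewrite !mxE !liftK mulrBl distrC ler_norm.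
  move=> h; have : ((q l - p l) %% K.+1 = 0)%N.
    apply/eqP; rewrite -/(dvdn _ _) -eqn_mod_dvd// eq_sym; exact/eqP.
  rewrite modn_small// => /eqP; rewrite subn_eq0 => h2.
  by apply/eqP; rewrite eqn_leq ple h2.
rewrite -(card_in_imset inj).
apply: (@le_trans _ _ (#|{: {ffun 'I_m -> 'I_K.+1}}|%:R)).
  by rewrite ler_nat max_card.
rewrite card_ffun !card_ord natrX lerXn2r ?nnegrE//.
  by rewrite addr_ge0// mulr_ge0// ltW.
by rewrite -natr1 lerD2r.
Qed.

Lemma face_compact i s : compact (face i s).
Proof.
pose A j : set R := (if j == i then `[s, s] else `[0, 1])%classic.
have -> : face i s = [set v | forall j, A j (v ord0 j)]; last first.
  by apply: (@rV_compact R m.+1 A) => j; rewrite /A; case: (j == i); exact: segment_compact.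
rewrite /A; apply/seteqP; split=> v /=.
  move=> [vi vP] j; case: eqVneq => [->|ji] /=; last by rewrite in_itv /= vP.
  by rewrite in_itv /= vi lexx.
move=> vP; split=> [|j ji].
  by have := vP i; rewrite eqxx /= in_itv /= -eq_le => /eqP.
by have := vP j; rewrite (negbTE ji) /= in_itv.
Qed.

Definition face_measure_bound : R := unit_ball_volume m * (2 ^- m * (4 ^- m / 2)).

Lemma face_measure_bound_gt0 : 0 < face_measure_bound.
Proof. by rewrite mulr_gt0 ?unit_ball_volume_gt0// mulr_gt0 ?divr_gt0 ?invr_gt0 ?exprn_gt0. Qed.

(** A counting argument replaces Lebesgue measure.  Given a covering of the
    face, enlarge its members slightly to open sets and extract a finite
    covering by compactness.  Each of the N ^ m points of a grid lies in one of
    these sets, and a set of diameter D contains at most (N D + 1) ^ m of them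
    by [grid_count]; so the sum of the D ^ m is bounded below. *)
Lemma hausdorff_measure_face_ge i (s : R) : (0 < m)%N ->
  (face_measure_bound%:E <= hausdorff_measure m (face i s))%E.
Proof.
move=> m0; apply: (le_trans _ (hausdorff_premeasure_le_measure m (face i s) ltr01)).
apply: le_ereal_inf_tmp => _ [C [Cd FC] <-].
have [D DP] : exists D : nat -> R, forall k, [/\ 0 <= D k,
    forall x y, C k x -> C k y -> enorm (x - y) <= D k &
    ((unit_ball_volume m * (D k / 2) ^+ m)%:E <= hausdorff_gauge m (C k))%E].
  suff : forall k, exists D, [/\ 0 <= D, forall x y, C k x -> C k y -> enorm (x - y) <= D &
     ((unit_ball_volume m * (D / 2) ^+ m)%:E <= hausdorff_gauge m (C k))%E].
    by move=> /choice[D DP]; exists D.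
  move=> k; have [->|/set0P[x Cx]] := eqVneq (C k) set0.
    by exists 0; split=> //; rewrite mul0r expr0n gtn_eqF// mulr0 hausdorff_gauge_ge0.
  by have [d [d0 dP gd]] := hausdorff_gaugeE m Cx (Cd k); exists d; split=> //; rewrite gd.
(* the enlargements sum to so little, by the factor 4 ^- m, that they use up
   only half of the final bound *)
pose ep k : R := 4 ^- m / 4 / 2 ^+ k.+1.
have ep0 k : 0 < ep k by rewrite !divr_gt0 ?invr_gt0 ?exprn_gt0.
pose U k : set 'rV[R]_m.+1 := \bigcup_(c in C k) eball c (ep k).
have oU k : open (U k) by apply: bigcup_open => c _; apply/eopen_open; exact: eball_open.
have FU : face i s `<=` cover [set: nat] U.
  by move=> x /FC[k _ Ckx]; exists k => //; exists x => //; exact: eball_center.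
have := @face_compact i s; rewrite compact_cover => /(_ _ _ _ (fun k _ => oU k) FU)[J _ JF].
pose M := (\max_(k <- finmap.enum_fset J) k).+1.
have {}JF x : face i s x -> exists2 k : 'I_M, true & U k x.
  move=> /JF[k /= kJ Ukx].
  have kM : (k < M)%N by rewrite ltnS; exact: leq_bigmax_seq.
  by exists (Ordinal kM).
have Ud k x y : U k x -> U k y -> enorm (x - y) <= D k + 2 * ep k.
  move=> [c Cc cx] [c' Cc' cy]; have [_ /(_ c c' Cc Cc') h _] := DP k.
  have := enorm_triangle c x y; have := enorm_triangle c' c y.
  by move: cx cy; rewrite /eball /= (enormBC y); lra.
(* the grid is finer than all enlargements, so that the term 1 in
   [grid_count] is absorbed by them *)
pose N := (Num.bound (\sum_(k < M) (2 * ep k)^-1)).+1.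
have NM (k : 'I_M) : 1 <= N%:R * (2 * ep k).
  have p2 j : 0 < 2 * ep j by rewrite mulr_gt0.
  rewrite -ler_pdivrMr// div1r.
  apply: (@le_trans _ _ (\sum_(k < M) (2 * ep k)^-1)).
    rewrite (bigD1 k)//= lerDl; apply: sumr_ge0 => j _; rewrite invr_ge0; exact: ltW.
  have := @archi_boundP R (\sum_(k < M) (2 * ep k)^-1).
  move=> h; apply: (le_trans (ltW (h _))); last by rewrite ler_nat.
  by apply: sumr_ge0 => j _; rewrite invr_ge0; exact: ltW.
pose G (k : 'I_M) : {set {ffun 'I_m -> 'I_N}} := [set q | `[< U k (grid_point i s q) >]]%SET.
have Gk k : #|G k|%:R <= (N%:R * (2 * (D k + 2 * ep k))) ^+ m.
  have [Dk _ _] := DP k.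
  have D0 : 0 <= D k + 2 * ep k by rewrite addr_ge0// mulr_ge0// ltW.
  have := @grid_count i s N (G k) (D k + 2 * ep k) isT D0.
  have GU p q : p \in G k -> q \in G k ->
      enorm (grid_point i s p - grid_point i s q) <= D k + 2 * ep k.
    by rewrite !finset.inE => /asboolP Up /asboolP Uq; exact: (Ud k).
  move=> /(_ GU) h; apply: le_trans h _.
  have : 0 <= N%:R * D k by rewrite mulr_ge0.
  have := NM k => h1 h2.
  rewrite lerXn2r ?nnegrE//; [by rewrite addr_ge0// mulr_ge0|by rewrite mulr_ge0// mulr_ge0|].
  lra.
have cnt : (N ^ m <= \sum_(k < M) #|G k|)%N.
  have -> : (N ^ m = \sum_(q : {ffun 'I_m -> 'I_N}) 1)%N by rewrite sum1_card card_ffun !card_ord.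
  have -> : (\sum_(k < M) #|G k| = \sum_(q : {ffun 'I_m -> 'I_N}) \sum_(k < M) (q \in G k))%N.
    rewrite exchange_big; apply: eq_bigr => k _ /=.
    by rewrite -sum1_card big_mkcond; apply: eq_bigr => q _; case: (q \in G k).
  apply: leq_sum => q _; have [k _ Uk] := JF _ (@grid_point_face i s N q).
  rewrite (bigD1 k)//=; have -> : q \in G k by rewrite finset.inE; exact/asboolP.
  by [].
have Nm : 0 < N%:R ^+ m :> R by rewrite exprn_gt0.
have sum1 : 1 <= \sum_(k < M) (2 * (D k + 2 * ep k)) ^+ m.
  rewrite -(ler_pM2l Nm) mulr1 big_distrr /=.
  apply: (@le_trans _ _ (\sum_(k < M) #|G k|%:R)); first by rewrite -natrX -natr_sum ler_nat.
  by apply: ler_sum => k _; apply: le_trans (Gk k) _; rewrite exprMn.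
have four (k : 'I_M) : (2 * (D k + 2 * ep k)) ^+ m <= 4 ^+ m * (D k ^+ m + 2 * ep k).
  have [Dk _ _] := DP k.
  have e0 : 0 <= 2 * ep k by rewrite mulr_ge0// ltW.
  have e1 : 2 * ep k <= 1.
    rewrite /ep; have h1 : 4 ^- m <= 1 :> R by rewrite invf_le1 ?exprn_gt0// exprn_ege1// ler1n.
    have h2 : (2 ^+ k.+1)^-1 <= 1 :> R by rewrite invf_le1 ?exprn_gt0// exprn_ege1// ler1n.
    have h3 : 0 <= 4 ^- m :> R by rewrite invr_ge0 exprn_ge0.
    have : 4 ^- m / 2 ^+ k.+1 <= 1 :> R.
      by rewrite -[leRHS]mulr1 ler_pM// invr_ge0 exprn_ge0.
    lra.
  have em : (2 * ep k) ^+ m <= 2 * ep k.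
    by case: (m) m0 => // p _; rewrite exprS ler_piMr// exprn_ile1.
  have mx : 2 * (D k + 2 * ep k) <= 4 * Num.max (D k) (2 * ep k).
    have : D k <= Num.max (D k) (2 * ep k) by rewrite le_max lexx.
    have : 2 * ep k <= Num.max (D k) (2 * ep k) by rewrite le_max lexx orbT.
    lra.
  apply: (@le_trans _ _ ((4 * Num.max (D k) (2 * ep k)) ^+ m)).
    rewrite lerXn2r ?nnegrE//; first by rewrite mulr_ge0// addr_ge0.
    by rewrite mulr_ge0// le_max Dk.
  rewrite exprMn ler_wpM2l ?exprn_ge0//.
  have [h|h] := leP (D k) (2 * ep k).
    by rewrite (le_trans em)// lerDr exprn_ge0.
  by rewrite lerDl.
have epsum : \sum_(k < M) (2 * ep k) <= 4 ^- m / 2.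
  have : \sum_(k < M) (2 : R) ^- k.+1 <= 1.
    have geo p : \sum_(k < p) (2 : R) ^- k.+1 = 1 - 2 ^- p.
      elim: p => [|p IH]; first by rewrite big_ord0 expr0 invr1 subrr.
      rewrite big_ord_recr /= IH exprS invfM.
      by lra.
    by rewrite geo lerBlDr lerDl invr_ge0 exprn_ge0.
  move=> h; have h3 : 0 <= 4 ^- m / 2 :> R by rewrite divr_ge0// invr_ge0 exprn_ge0.
  have -> : \sum_(k < M) (2 * ep k) = 4 ^- m / 2 * \sum_(k < M) (2 : R) ^- k.+1.
    rewrite big_distrr /=; apply: eq_bigr => k _; rewrite /ep.
    by have := (4 : R) ^- m; have := (2 : R) ^- k.+1; move=> a b; lra.
  by rewrite -[leRHS]mulr1 ler_wpM2l.
have main : 4 ^- m / 2 <= \sum_(k < M) D k ^+ m.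
  have four0 : 0 < (4 : R) ^+ m by rewrite exprn_gt0.
  have : 1 <= 4 ^+ m * (\sum_(k < M) D k ^+ m + \sum_(k < M) (2 * ep k)).
    apply: le_trans sum1 _; rewrite -big_split big_distrr /=; exact: ler_sum.
  rewrite mulrC -ler_pdivrMr// div1r => h; lra.
apply: (@le_trans _ _ (\sum_(k < M) hausdorff_gauge m (C k))%E); last first.
  have := @nneseries_lim_ge R (fun k => hausdorff_gauge m (C k)) xpredT 0%N M
    (fun k _ _ => hausdorff_gauge_ge0 m (C k)).
  by rewrite big_mkord.
apply: (@le_trans _ _ (\sum_(k < M) (unit_ball_volume m * (D k / 2) ^+ m)%:E)%E); last first.
  by apply: lee_sum => k _; have [] := DP k.
rewrite sumEFin lee_fin -big_distrr /= ler_wpM2l ?unit_ball_volume_ge0//.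
have -> : \sum_(k < M) (D k / 2) ^+ m = 2 ^- m * \sum_(k < M) D k ^+ m.
  by rewrite big_distrr /=; apply: eq_bigr => k _; rewrite exprMn exprVn mulrC.
by rewrite ler_wpM2l// invr_ge0 exprn_ge0.
Qed.

End hausdorff_hyperplane.

(** * Hausdorff measure of spheres *)

Section sphere_measure.
Context {R : realType} {m : nat}.
Implicit Types (x y z u v w c e : 'rV[R]_m.+1) (A B C F X : set 'rV[R]_m.+1).

(** The face bound divided by the m-th power of the Lipschitz constant, for
    t = 1, of the map used in [hausdorff_measure_lines]. *)
Definition line_measure_bound : R :=
  face_measure_bound (R := R) (m := m) / ((2 * m.+1%:R) * (1 + m.+1%:R)) ^+ m.

Lemma line_measure_bound_gt0 : 0 < line_measure_bound.
Proof.
by rewrite divr_gt0 ?face_measure_bound_gt0// exprn_gt0// !mulr_gt0// addr_gt0.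
Qed.

Lemma ex_max_coord e : exists i, forall j, `|e ord0 j| <= `|e ord0 i|.
Proof.
have [i _ iP] := arg_maxP (fun j => `|e ord0 j|) (isT : xpredT (ord0 : 'I_m.+1)).
by exists i => j; exact: iP.
Qed.

(** Project A to a coordinate hyperplane along e.  The coordinate i dropped is
    one where e is largest, which bounds the Lipschitz constant of the oblique
    projection by 1 + (m + 1), whatever e is; after rescaling by k the image
    contains a cube face, by hypothesis. *)
Lemma hausdorff_measure_lines A e y (t : R) : (0 < m)%N -> e != 0 -> 0 < t ->
  (forall w, eball y t w -> exists s : R, A (w + s *: e)) ->
  ((line_measure_bound * t ^+ m)%:E <= hausdorff_measure m A)%E.
Proof.
move=> m0 e0 t0 Aw; have [i iP] := ex_max_coord e.
have ei : e ord0 i != 0.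
  apply: contra e0 => /eqP ei; apply/eqP/rowP => j; rewrite mxE.
  by apply/eqP; rewrite -normr_le0; have := iP j; rewrite ei normr0.
have n0 : 0 < m.+1%:R :> R by [].
pose p z := z - (z ord0 i / e ord0 i) *: e.
have pB z w : p z - p w = p (z - w).
  by rewrite /p; apply/rowP => j; rewrite !mxE; ring.
have pe z s : p (z + s *: e) = p z.
  by rewrite /p; apply/rowP => j; rewrite !mxE; field.
have pL z : enorm (p z) <= (1 + m.+1%:R) * enorm z.
  apply: le_trans (ler_enormB _ _) _; rewrite mulrDl mul1r lerD2l enormZ normrM normfV.
  have ee : enorm e <= m.+1%:R * `|e ord0 i|.
    apply: le_trans (ler_enorm_norm _) _; rewrite ler_pM2l//.
    by rewrite [leLHS]mx_normrE; apply/bigmax_leP; split=> // -[a j] _ /=; rewrite ord1 iP.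
  rewrite -mulrA [_^-1 * _]mulrC mulrA ler_pdivrMr ?normr_gt0//.
  rewrite mulrC [leRHS]mulrAC; apply: ler_pM => //; first exact: enorm_ge0.
  exact: ler_coord_enorm.
pose k : R := 2 * m.+1%:R / t.
have k0 : 0 < k by rewrite divr_gt0// mulr_gt0.
pose f z := k *: (p z - p y).
have sub : face i 0 `<=` f @` A.
  move=> q [qi qP]; have [|s As] := Aw (y + k^-1 *: q).
    rewrite /eball /= addrC addKr enormZ gtr0_norm ?invr_gt0//.
    rewrite mulrC ltr_pdivrMr// /k mulrCA divff ?gt_eqF// mulr1.
    apply: (@le_lt_trans _ _ m.+1%:R); last by rewrite ltr_pMl// ltr1n.
    rewrite -[leRHS]mulr1; apply: le_trans (ler_enorm_norm _) _; rewrite ler_pM2l//.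
    rewrite [leLHS]mx_normrE; apply/bigmax_leP; split=> // -[a j] _ /=; rewrite ord1.
    have [->|/qP/andP[q0 q1]] := eqVneq j i; first by rewrite qi normr0.
    by rewrite ger0_norm.
  exists (y + k^-1 *: q + s *: e) => //; rewrite /f pe pB addrC addKr.
  rewrite /p mxE qi mulr0 mul0r scale0r subr0 scalerA divff ?scale1r//.
  by rewrite gt_eqF.
have L0 : 0 < k * (1 + m.+1%:R) by rewrite mulr_gt0// addr_gt0.
have fL z w : A z -> A w -> enorm (f z - f w) <= k * (1 + m.+1%:R) * enorm (z - w).
  move=> _ _; rewrite /f -scalerBr enormZ gtr0_norm// -mulrA ler_pM2l//.
  by rewrite subrBB pB; exact: pL.
have h := le_trans (hausdorff_measure_face_ge i 0 m0)
  (le_trans (le_hausdorff_measure m sub) (hausdorff_measure_lipschitz m L0 fL)).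
rewrite -lee_pdivrMl ?exprn_gt0// in h; apply: le_trans h.
rewrite -EFinM lee_fin /line_measure_bound /k.
rewrite !exprMn !invfM exprVn invrK le_eqVlt; apply/orP; left; apply/eqP.
by ring.
Qed.

(** Radial projection onto the unit sphere contracts the exterior of the ball
    of radius r by 1 / r: with u, v the directions of x, y, and a, b their
    norms, |x - y|^2 = (a - b)^2 + a b |u - v|^2. *)
Lemma normalize_lipschitz x y (r : R) : 0 < r -> r <= enorm x -> r <= enorm y ->
  enorm (normalize x - normalize y) <= r^-1 * enorm (x - y).
Proof.
move=> r0 rx ry; have x0 : x != 0 by rewrite -enorm_gt0 (lt_le_trans r0).
have y0 : y != 0 by rewrite -enorm_gt0 (lt_le_trans r0).
rewrite mulrC ler_pdivlMr// -(@ler_pXn2r _ 2)// ?nnegrE ?mulr_ge0 ?enorm_ge0 ?(ltW r0)//.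
have xy : x - y = enorm x *: normalize x - enorm y *: normalize y by rewrite !normalizeK.
rewrite exprMn xy; have := dot_unit (enorm_normalize x0); have := dot_unit (enorm_normalize y0).
have := dot_le (normalize x) (normalize y); rewrite !enorm_normalize// mulr1.
move: rx ry; clear xy; move: (normalize x) (normalize y) => u v rx ry uv vv uu.
rewrite !enorm_sqr !dotE (dotC v u) uu vv.
move: (enorm x) (enorm y) (dot u v) rx ry uv => a b d ra rb uv.
have h : 0 <= (a - b) ^+ 2 by rewrite sqr_ge0.
have : r * r <= a * b by rewrite ler_pM// ltW.
move=> /(ler_wpM2r (_ : 0 <= 2 - 2 * d)) h2; have {}h2 := h2 ltac:(lra).
lra.
Qed.

Lemma hausdorff_measure_sphere_scale c (r : R) : 0 < r ->
  hausdorff_measure m (esphere c r) =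
  ((r ^+ m)%:E * hausdorff_measure m (esphere (0 : 'rV[R]_m.+1) 1))%E.
Proof.
move=> r0; apply/eqP; rewrite eq_le; apply/andP; split.
  have -> : esphere c r = (fun z => c + r *: z) @` esphere 0 1.
    apply/seteqP; split=> [z zr|_ [z z1 <-]]; rewrite /esphere /=.
      exists (r^-1 *: (z - c)); last by rewrite scalerA divff ?gt_eqF// scale1r addrC subrK.
      have zr' : enorm (z - c) = r := zr.
      by rewrite /esphere /= subr0 enormZ zr' gtr0_norm ?invr_gt0// mulVf ?gt_eqF.
    move: z1; rewrite /esphere /= subr0 => z1.
    by rewrite addrC addKr enormZ z1 mulr1 gtr0_norm.
  apply: hausdorff_measure_lipschitz => // x y _ _.
  by rewrite opprD addrACA subrr add0r -scalerBr enormZ gtr0_norm.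
rewrite -lee_pdivlMl ?exprn_gt0// -exprVn.
have -> : esphere 0 1 = (fun z => r^-1 *: (z - c)) @` esphere c r.
  apply/seteqP; split=> [z|_ [z zr <-]]; rewrite /esphere /= subr0; last first.
    have zr' : enorm (z - c) = r := zr.
    by rewrite enormZ zr' gtr0_norm ?invr_gt0// mulVf ?gt_eqF.
  move=> z1.
  exists (c + r *: z); last by rewrite addrC addKr scalerA mulVf ?gt_eqF// scale1r.
  by rewrite /esphere /= addrC addKr enormZ z1 mulr1 gtr0_norm.
apply: hausdorff_measure_lipschitz => [|x y _ _]; first by rewrite invr_gt0.
by rewrite -scalerBr enormZ gtr0_norm ?invr_gt0// opprB addrA subrK.
Qed.

(** The sphere is the radial projection of the surface of a cube of side 1
    about the origin; the faces are at distance 1/2 from the centre, so the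
    projection is 2-Lipschitz on them. *)
Lemma hausdorff_measure_unit_sphere_fin :
  (hausdorff_measure m (esphere (0 : 'rV[R]_m.+1) 1) < +oo)%E.
Proof.
(* h is the centre of the unit cube, whose faces are face i 0 and face i 1 *)
pose h : 'rV[R]_m.+1 := const_mx 2^-1.
pose f z := normalize (z - h).
pose s (b : bool) : R := b%:R.
pose I := ('I_m.+1 * bool)%type.
have cov x : esphere (0 : 'rV[R]_m.+1) 1 x ->
    exists2 k : I, k \in enum [set: I]%SET & (f @` face k.1 (s k.2)) x.
  rewrite /esphere /= subr0 => x1; have [i iP] := ex_max_coord x.
  have xi : 0 < `|x ord0 i|.
    rewrite lt_def normr_ge0 andbT; apply/eqP => xi0.
    have : enorm x = 0.
      apply/eqP; rewrite enorm_eq0; apply/eqP/rowP => j; rewrite mxE; apply/eqP.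
      by rewrite -normr_le0 -xi0.
    by rewrite x1 => /eqP; rewrite oner_eq0.
  pose k : R := (2 * `|x ord0 i|)^-1.
  have k0 : 0 < k by rewrite invr_gt0 mulr_gt0.
  have kx j : `|k * x ord0 j| <= 2^-1.
    rewrite normrM gtr0_norm// /k invfM -mulrA ler_piMr// mulrC ler_pdivrMr// mul1r.
    exact: iP.
  exists (i, 0 < x ord0 i); first by rewrite mem_enum finset.in_setT.
  exists (k *: x + h).
    split=> [|j _].
      rewrite !mxE /s /= /k invfM -mulrA; case: ltP => xi0.
        by rewrite gtr0_norm// mulVf ?gt_eqF// -[true%:R]/(1 : R); lra.
      rewrite ler0_norm// invrN mulNr mulVf; first by rewrite mulrN1 addNr.
      by rewrite -normr_eq0 gt_eqF.
    by rewrite !mxE; have := kx j; rewrite ler_norml => /andP[? ?]; apply/andP; split; lra.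
  rewrite /f addrK /normalize enormZ x1 mulr1 gtr0_norm// scalerA mulVf ?scale1r//.
  by rewrite gt_eqF.
apply: le_lt_trans (@outer_measure_finite_union R _ (hausdorff_measure m) I _ _ _ cov) _.
apply: (@le_lt_trans _ _ (\sum_(k <- enum [set: I]%SET) (2 ^+ m)%:E * hausdorff_measure m (face k.1 (s k.2)))%E).
  apply: lee_sum => -[i b] _; apply: hausdorff_measure_lipschitz => // x y.
  have far z : face i (s b) z -> 2^-1 <= enorm (z - h).
    move=> [zi _]; apply: le_trans (ler_coord_enorm _ i); rewrite !mxE zi /s.
    case: (b); first by rewrite -[true%:R]/(1 : R) ger0_norm; lra.
    by rewrite -[false%:R]/(0 : R) sub0r normrN ger0_norm; lra.
  move=> Fx Fy; apply: le_trans (normalize_lipschitz _ (far x Fx) (far y Fy)) _; first by [].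
  by rewrite invrK opprB addrA subrK.
rewrite big_seq; apply: (big_ind (fun a => a < +oo)%E) => // [a b|[i b] _].
  exact: lte_add_pinfty.
apply: lte_mul_pinfty => //; last exact: hausdorff_measure_face_fin.
Qed.

(** The parameter s is a root of a quadratic equation, whose discriminant is
    positive because w is inside the sphere. *)
Lemma line_hits_sphere c w e (r : R) : enorm e = 1 -> enorm (w - c) < r ->
  exists s, enorm (w + s *: e - c) = r.
Proof.
move=> e1 wr; have r0 : 0 < r by exact: le_lt_trans (enorm_ge0 _) wr.
pose b := dot (w - c) e; pose D := b ^+ 2 + (r ^+ 2 - enorm (w - c) ^+ 2).
have D0 : 0 <= D.
  rewrite addr_ge0 ?sqr_ge0// subr_ge0 lerXn2r ?nnegrE ?enorm_ge0 ?(ltW r0)//.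
  exact: ltW.
pose s := - b + Num.sqrt D; exists s.
apply/eqP; rewrite -(@eqrXn2 _ 2)// ?enorm_ge0 ?(ltW r0)//; apply/eqP.
have -> : w + s *: e - c = (w - c) - (- s) *: e by rewrite scaleNr opprK addrAC.
rewrite enorm_subZ_sqr e1 -/b.
have := sqr_sqrtr D0; rewrite /s; move: (Num.sqrt D) => q.
rewrite /D; lra.
Qed.

Lemma hausdorff_measure_unit_sphere_gt0 : (0 < m)%N ->
  (0 < hausdorff_measure m (esphere (0 : 'rV[R]_m.+1) 1))%E.
Proof.
move=> m0; pose e : 'rV[R]_m.+1 := delta_mx 0 ord0.
have e1 : enorm e = 1 by rewrite enorm_delta.
apply: lt_le_trans (@hausdorff_measure_lines _ e 0 1 m0 (unit_neq0 e1) ltr01 _).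
  by rewrite lte_fin expr1n mulr1 line_measure_bound_gt0.
by move=> w /(line_hits_sphere e1)[s sP]; exists s.
Qed.

(** By scaling, since the area of the unit sphere is positive and finite. *)
Lemma ex_sphere_of_measure (a : R) : (0 < m)%N -> 0 < a -> exists r : R, 0 < r /\
  forall c, hausdorff_measure m (esphere c r) = a%:E.
Proof.
move=> m0 a0; have := hausdorff_measure_unit_sphere_fin.
have := hausdorff_measure_unit_sphere_gt0 m0.
have sc := hausdorff_measure_sphere_scale.
case: (hausdorff_measure m (esphere 0 1)) sc => // s sc; rewrite lte_fin => s0 _.
exists ((a / s) `^ (m%:R^-1)); split; first by rewrite powR_gt0// divr_gt0.
move=> c; rewrite sc ?powR_gt0 ?divr_gt0// -powR_mulrn ?powR_ge0// -powRrM.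
rewrite mulVf ?pnatr_eq0 -?lt0n// powRr1 ?divr_ge0 ?(ltW a0) ?(ltW s0)//.
by rewrite -EFinM divfK// gt_eqF.
Qed.

End sphere_measure.

(** * Area and rigidity of enclosing sets *)

Section enclosed_sphere_area.
Context {R : realType} {m : nat}.
Implicit Types (x y z u v w c e : 'rV[R]_m.+1) (S A B : set 'rV[R]_m.+1).

Definition encloses S c (r : R) := (forall y, S y -> r <= enorm (y - c)) /\
  forall u, enorm u = 1 -> exists t, r <= t /\ S (c + t *: u).

Definition radial c (r : R) z := c + r *: normalize (z - c).

Lemma radial_lipschitz c (r d : R) x y : 0 < r -> 0 < d ->
  d <= enorm (x - c) -> d <= enorm (y - c) ->
  enorm (radial c r x - radial c r y) <= r / d * enorm (x - y).
Proof.
move=> r0 d0 dx dy; rewrite /radial opprD addrACA subrr add0r -scalerBr enormZ.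
rewrite gtr0_norm// -mulrA ler_pM2l// -(subrBB x y c); exact: normalize_lipschitz.
Qed.

Lemma radial_surj S c (r : R) : encloses S c r -> 0 < r ->
  esphere c r `<=` radial c r @` S.
Proof.
move=> [_ enc] r0 z zc; have zr : enorm (z - c) = r := zc.
have z0 : z - c != 0 by rewrite -enorm_gt0 zr.
have [t [rt St]] := enc _ (enorm_normalize z0).
exists (c + t *: normalize (z - c)) => //; rewrite /radial [c + _ - c]addrC addKr.
rewrite [normalize (t *: _)]/normalize enormZ enorm_normalize// mulr1.
have t0 : 0 < t by exact: lt_le_trans rt.
rewrite gtr0_norm// [t^-1 *: _]scalerA mulVf ?gt_eqF// scale1r -zr normalizeK//.
by rewrite addrC subrK.
Qed.

(** The radial projection onto the sphere maps S onto it, and is 1-Lipschitz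
    outside the ball. *)
Lemma encloses_area S c (r : R) : 0 < r -> encloses S c r ->
  (hausdorff_measure m (esphere c r) <= hausdorff_measure m S)%E.
Proof.
move=> r0 Sc; apply: le_trans (le_hausdorff_measure m (radial_surj Sc r0)) _.
have : forall x y, S x -> S y -> enorm (radial c r x - radial c r y) <= 1 * enorm (x - y).
  move=> x y Sx Sy; rewrite -(divff (lt0r_neq0 r0)).
  by apply: radial_lipschitz => //; exact: Sc.1.
by move=> /(hausdorff_measure_lipschitz m ltr01); rewrite expr1n mul1e.
Qed.

(** If S had a point y outside the sphere, then near y, where S has positive
    measure, the radial projection would contract by a factor k < 1; the image
    of S would be too small to cover the sphere.  Splitting the measure of S
    into the parts near y and away from y is where measurability of closed sets
    is needed.  Once S is contained in the sphere, it is all of it since every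
    ray from c meets S. *)
Lemma encloses_rigid S c (r : R) : (0 < m)%N -> 0 < r -> encloses S c r ->
  (forall y (d : R), S y -> 0 < d -> (0 < hausdorff_measure m (S `&` eball y d))%E) ->
  (hausdorff_measure m S < +oo)%E ->
  (hausdorff_measure m S <= hausdorff_measure m (esphere c r))%E -> S = esphere c r.
Proof.
move=> m0 r0 Sc Spos Sfin Sle.
have sub : S `<=` esphere c r.
  move=> y Sy; apply/eqP; rewrite eq_le Sc.1// andbT leNgt; apply/negP => ry.
  pose d := (enorm (y - c) - r) / 2; have d0 : 0 < d by rewrite divr_gt0// subr_gt0.
  have far z : eball y d z -> r + d <= enorm (z - c).
    rewrite /eball /= => zy; have := enorm_triangle z y c; rewrite (enormBC y z).
    by rewrite /d in zy *; lra.
  pose F := ~` eball y d.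
  have cF : eclosed F by rewrite /eclosed setCK; exact: eball_open.
  have HS : (hausdorff_measure m S = hausdorff_measure m (S `&` F) +
     hausdorff_measure m (S `&` eball y d))%E.
    by rewrite (closed_caratheodory m cF S) /F setCK.
  pose k := r / (r + d).
  have rd : 0 < r + d by rewrite addr_gt0.
  have k0 : 0 < k by rewrite divr_gt0.
  have k1 : k ^+ m < 1.
    by rewrite exprn_ilt1 ?(ltW k0) -?lt0n// ltr_pdivrMr// mul1r ltrDl.
  have h1 : (hausdorff_measure m (radial c r @` (S `&` F)) <= hausdorff_measure m (S `&` F))%E.
    have : forall x z, (S `&` F) x -> (S `&` F) z -> enorm (radial c r x - radial c r z) <= 1 * enorm (x - z).
      move=> x z [Sx _] [Sz _]; rewrite -(divff (lt0r_neq0 r0)).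
      by apply: radial_lipschitz => //; exact: Sc.1.
    by move=> /(hausdorff_measure_lipschitz m ltr01); rewrite expr1n mul1e.
  have h2 : (hausdorff_measure m (radial c r @` (S `&` eball y d)) <=
      (k ^+ m)%:E * hausdorff_measure m (S `&` eball y d))%E.
    apply: hausdorff_measure_lipschitz => // x z [_ Fx] [_ Fz].
    by apply: radial_lipschitz => //; exact: far.
  have h3 : (hausdorff_measure m (esphere c r) <= hausdorff_measure m (S `&` F) +
     (k ^+ m)%:E * hausdorff_measure m (S `&` eball y d))%E.
    apply: le_trans (leeD h1 h2); apply: le_trans (outer_measureU2 (hausdorff_measure m) _ _).
    apply: le_hausdorff_measure => z /(radial_surj Sc r0)[w Sw <-].
    by have [Fw|/contrapT Fw] := pselect (F w); [left|right]; exists w.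
  have pos := Spos y d Sy d0.
  have := le_trans Sle h3; rewrite HS; move: Sfin pos; rewrite HS.
  have := hausdorff_measure_ge0 m (S `&` F).
  case: (hausdorff_measure m (S `&` F)) => [f| |]//= f0;
  case: (hausdorff_measure m (S `&` eball y d)) => [g| |]//= _.
  rewrite lte_fin -EFinM -!EFinD lee_fin lerD2l => g0.
  by rewrite -{1}[g]mul1r ler_pM2r// leNgt k1.
apply/seteqP; split=> // z zc; have zr : enorm (z - c) = r := zc.
have z0 : z - c != 0 by rewrite -enorm_gt0 zr.
have [t [rt St]] := Sc.2 _ (enorm_normalize z0).
have t0 : 0 < t by exact: lt_le_trans rt.
have : enorm (c + t *: normalize (z - c) - c) = r by exact: sub.
rewrite addrC addKr enormZ enorm_normalize// mulr1 gtr0_norm// => tr.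
by move: St; rewrite tr -zr normalizeK// addrC subrK.
Qed.

(** Choose u and v near y on different sides of S.  Every segment parallel to
    v - u that starts close to u ends close to v, hence crosses S, so
    [hausdorff_measure_lines] applies. *)
Lemma locally_flat_measure_gt0 S y (e : R) : (0 < m)%N -> locally_flat S -> eclosed S ->
  S y -> 0 < e -> (0 < hausdorff_measure m (S `&` eball y e))%E.
Proof.
move=> m0 flatS cS Sy e0.
have [e1 [f [e10 fP]]] := ex_local_side_function flatS Sy.
pose d := Num.min e e1; have d0 : 0 < d by rewrite lt_min e0.
have y1 : eball y e1 y by exact: eball_center.
have [u [v [yu yv Su Sv uv]]] := fP.2 y d y1 Sy d0.
have dd : eball y d `<=` eball y e1 by apply: eballW; rewrite ge_min lexx orbT.
have de : eball y d `<=` eball y e by apply: eballW; rewrite ge_min lexx.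
have [du [du0 duP]] := fP.1 u (dd _ yu) Su; have [dv [dv0 dvP]] := fP.1 v (dd _ yv) Sv.
have [eu [eu0 euP]] := eball_open yu; have [ev [ev0 evP]] := eball_open yv.
have uv0 : v - u != 0 by apply: contraNneq uv => /eqP; rewrite subr_eq0 => /eqP ->.
pose t := Num.min (Num.min du dv) (Num.min eu ev).
have t0 : 0 < t by rewrite !lt_min du0 dv0 eu0.
have pos := @hausdorff_measure_lines R m (S `&` eball y e) (v - u) u t m0 uv0 t0.
apply: lt_le_trans (pos _).
  by rewrite lte_fin mulr_gt0 ?line_measure_bound_gt0 ?exprn_gt0.
move=> w; rewrite /eball /= !lt_min => /andP[/andP[wu wv] /andP[weu wev]].
have wy : eball y d w by exact: euP.
pose w' := w + 1 *: (v - u).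
have w'v : w' - v = w - u.
  by rewrite /w'; apply/rowP => i; rewrite !mxE; ring.
have wy' : eball y d w' by apply: evP; rewrite /eball /= w'v.
apply: contrapT => nS.
have : f w = f w'.
  have := @locally_constant_path R m.+1 S (eball y e1) f (fun s => w + s *: (v - u)) fP.1.
  rewrite scale0r addr0; apply.
    move=> s s01; have ws : eball y d (w + s *: (v - u)).
      have -> : v - u = w' - w by rewrite /w'; apply/rowP => i; rewrite !mxE; ring.
      exact: (eball_convex wy wy').
    split; first exact: dd.
    by move=> Ss; apply: nS; exists s; split=> //; exact: de.
  move=> s r _ r0; have [q [q0 qP]] := line_continuous w (v - u) s r0.
  by exists q; split=> // s' _; exact: qP.
rewrite (duP w)// (dvP w'); last by rewrite /eball /= w'v.
by move/eqP; rewrite (negbTE uv).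
Qed.

End enclosed_sphere_area.

(** * Bounds on the energy *)

Section Lnorm_bounds.
Context d (T : measurableType d) (R : realType) (mu : {measure set T -> \bar R}).
Implicit Types (f h : T -> \bar R) (B : set T).
Local Open Scope ereal_scope.

Lemma integral_ge_cst h B (k : R) : measurable_fun setT h -> (forall x, 0 <= h x) ->
  measurable B -> (0 <= k)%R -> (forall x, B x -> k%:E <= h x) ->
  k%:E * mu B <= \int[mu]_x h x.
Proof.
move=> mh h0 mB k0 kh; rewrite -integral_cst//.
apply: (@le_trans _ _ (\int[mu]_(x in B) h x)); last exact: ge0_subset_integral.
apply: ge0_le_integral => //; exact: measurable_funTS.
Qed.

(** Otherwise the integral over B of the positive function h - k would vanish,
    so that h = k almost everywhere on B. *)
Lemma integral_gt_cst h B (k : R) : measurable_fun setT h -> (forall x, 0 <= h x) ->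
  measurable B -> (0 <= k)%R -> (forall x, B x -> k%:E < h x) ->
  0 < mu B -> mu B < +oo ->
  k%:E * mu B < \int[mu]_x h x.
Proof.
move=> mh h0 mB k0 kh B0 Boo; rewrite ltNge; apply/negP => hle.
have mhB : measurable_fun B h by exact: measurable_funTS.
pose g x := h x - k%:E.
have mg : measurable_fun B g by apply: emeasurable_funB => //; exact: measurable_cst.
have g0 x : B x -> 0 <= g x by move=> Bx; rewrite sube_ge0// ltW// kh.
have Boof : mu B \is a fin_num by rewrite ge0_fin_numE.
have hB : \int[mu]_(x in B) h x = \int[mu]_(x in B) g x + k%:E * mu B.
  rewrite -integral_cst// -ge0_integralD//.
  by apply: eq_integral => x _; rewrite /g subeK.
have g_int : \int[mu]_(x in B) `|g x| = 0.
  have -> : \int[mu]_(x in B) `|g x| = \int[mu]_(x in B) g x.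
    by apply: eq_integral => x /set_mem Bx; rewrite gee0_abs// g0.
  apply/eqP; rewrite eq_le integral_ge0// andbT.
  have : \int[mu]_(x in B) h x <= k%:E * mu B.
    by apply: le_trans hle; apply: ge0_subset_integral.
  by rewrite hB -[leRHS]add0e leeD2rE// fin_numM.
move/(ae_eq_integral_abs mu mB mg): g_int => [N [mN N0 BN]].
have : mu B <= 0.
  rewrite -N0; apply: le_measure; rewrite ?inE// => x Bx; apply: BN => /= h1.
  have := h1 Bx; rewrite /g => h2; have := kh x Bx.
  by rewrite -sube_gt0 h2 ltxx.
by rewrite leNgt B0.
Qed.

Lemma Lnorm_ge_cst f B (p k : R) : (0 < p)%R -> measurable_fun setT f ->
  (forall x, 0 <= f x) -> measurable B -> (0 <= k)%R -> (forall x, B x -> k%:E <= f x) ->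
  (k `^ p)%:E * mu B <= 'N[mu]_p%:E[f] `^ p.
Proof.
move=> p0 mf f0 mB k0 kf; rewrite poweR_Lnorm ?gt_eqF//; apply: integral_ge_cst => //.
- apply: (measurableT_comp (measurable_poweR p)); exact: measurableT_comp.
- by move=> x; rewrite poweR_ge0.
- by rewrite powR_ge0.
- move=> x Bx; rewrite gee0_abs// -poweR_EFin; apply: gt0_ler_poweR; rewrite ?(ltW p0)//.
  + by rewrite in_itv/= lee_fin k0 leey.
  + by rewrite in_itv/= f0 leey.
  + exact: kf.
Qed.

Lemma Lnorm_gt_cst f B (p k : R) : (0 < p)%R -> measurable_fun setT f ->
  (forall x, 0 <= f x) -> measurable B -> (0 <= k)%R -> (forall x, B x -> k%:E < f x) ->
  0 < mu B -> mu B < +oo ->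
  (k `^ p)%:E * mu B < 'N[mu]_p%:E[f] `^ p.
Proof.
move=> p0 mf f0 mB k0 kf B0 Boo; rewrite poweR_Lnorm ?gt_eqF//; apply: integral_gt_cst => //.
- apply: (measurableT_comp (measurable_poweR p)); exact: measurableT_comp.
- by move=> x; rewrite poweR_ge0.
- by rewrite powR_ge0.
- move=> x Bx; rewrite gee0_abs//; have := kf x Bx; case: (f x) => [r| |]//.
    by rewrite lte_fin poweR_EFin lte_fin => kr; rewrite gt0_ltr_powR// ?nnegrE// ltW// (le_lt_trans k0).
  by move=> _; rewrite poweRyr ?gt_eqF// ltry.
Qed.

Lemma Lnorm_restrict_cst f B (p k : R) : (0 < p)%R -> measurable B -> (0 <= k)%R ->
  (forall x, B x -> f x = k%:E) ->
  'N[mu]_p%:E[f \_ B] `^ p = (k `^ p)%:E * mu B.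
Proof.
move=> p0 mB k0 fk; rewrite poweR_Lnorm ?gt_eqF// -integral_cst// [RHS]integral_mkcond.
apply: eq_integral => x _; rewrite !patchE; case: ifPn => [/set_mem Bx|_].
  by rewrite fk// gee0_abs ?lee_fin// poweR_EFin.
by rewrite abse0 poweR0r// gt_eqF.
Qed.

End Lnorm_bounds.

Section tp_energy_bounds.
Context {R : realType} {n : nat}.
Implicit Types (x y : 'rV[R]_n) (S L : set 'rV[R]_n) (p : R) (m : nat).
Implicit Type H : 'rV[R]_n -> set 'rV[R]_n.

Lemma edist_ge0 y L : (0 <= Defs.edist y L)%R.
Proof.
rewrite /Defs.edist; have [->|/set0P[z Lz]] := eqVneq L set0; first by rewrite image_set0 inf0.
by apply: lb_le_inf; [exists (enorm (y - z)); exists z => //|move=> _ [w _ <-]; exact: enorm_ge0].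
Qed.

Lemma inv_Rtp_ge0 x y L : (0 <= inv_Rtp x y L)%R.
Proof.
rewrite /inv_Rtp; case: ifP => // _.
by rewrite invr_ge0 /Rtp divr_ge0 ?exprn_ge0 ?enorm_ge0// mulr_ge0// edist_ge0.
Qed.

Local Open Scope ereal_scope.

Lemma Ktp_restrict_ge0 S H x : 0 <= (Ktp S H \_ S) x.
Proof.
rewrite patchE; case: ifPn => [/set_mem Sx|//]; apply: (@le_trans _ _ (inv_Rtp x x (H x))%:E).
  by rewrite lee_fin inv_Rtp_ge0.
by apply: ereal_sup_ubound; exists x.
Qed.

(* the measure space over which the energy is defined *)
Let Hm m : {outer_measure set 'rV[R]_n -> \bar R} := hausdorff_measure m.

Let mu m : {measure set (caratheodory_type (Hm m)) -> \bar R} := Hm m.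

Let measurable_closed m S : eclosed S -> measurable (S : set (caratheodory_type (Hm m))).
Proof. exact: closed_caratheodory. Qed.

(** A finite energy presupposes that the integrand is measurable; S itself is
    measurable because it is closed. *)
Lemma tp_energy_ge m p S H (k : R) : (0 < p)%R -> eclosed S -> (0 <= k)%R ->
  (forall x, S x -> k%:E <= Ktp S H x) -> tp_energy m p S H != +oo ->
  (k `^ p)%:E * hausdorff_measure m S <= tp_energy m p S H `^ p.
Proof.
move=> p0 cS k0 kK; rewrite /tp_energy; case: asboolP => // mf _.
apply: (@Lnorm_ge_cst _ _ _ (mu m)) => //; [exact: Ktp_restrict_ge0|exact: measurable_closed|].
by move=> x Sx; rewrite patchE mem_set// kK.
Qed.

Lemma tp_energy_gt m p S H (k : R) : (0 < p)%R -> eclosed S -> (0 <= k)%R ->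
  (forall x, S x -> k%:E < Ktp S H x) -> tp_energy m p S H != +oo ->
  0 < hausdorff_measure m S -> hausdorff_measure m S < +oo ->
  (k `^ p)%:E * hausdorff_measure m S < tp_energy m p S H `^ p.
Proof.
move=> p0 cS k0 kK; rewrite /tp_energy; case: asboolP => // mf _ S0 Sy.
apply: (@Lnorm_gt_cst _ _ _ (mu m)) => //; [exact: Ktp_restrict_ge0|exact: measurable_closed|].
by move=> x Sx; rewrite patchE mem_set// kK.
Qed.

Lemma tp_energy_cst m p S H (k : R) : (0 < p)%R -> eclosed S -> (0 <= k)%R ->
  (forall x, S x -> Ktp S H x = k%:E) ->
  tp_energy m p S H `^ p = (k `^ p)%:E * hausdorff_measure m S.
Proof.
move=> p0 cS k0 kK; rewrite /tp_energy; case: asboolP => [mf|nf].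
  by apply: (@Lnorm_restrict_cst _ _ _ (mu m)) => //; exact: measurable_closed.
exfalso; apply: nf.
have mS : measurable (S : set (caratheodory_type (Hm m))) by exact: measurable_closed.
rewrite (_ : Ktp S H \_ S = (cst k%:E) \_ S); last first.
  by apply/funext => x; rewrite !patchE; case: ifPn => // /set_mem /kK.
by apply/(measurable_restrictT _ mS); exact: measurable_cst.
Qed.

Lemma tp_energy_markov m p S H (t : R) : (0 < p)%R -> (0 <= t)%R ->
  tp_energy m p S H != +oo ->
  (t `^ p)%:E * hausdorff_measure m (S `&` [set x | t%:E < Ktp S H x]) <=
  tp_energy m p S H `^ p.
Proof.
move=> p0 t0; rewrite /tp_energy; case: asboolP => // mf _.
have -> : S `&` [set x | t%:E < Ktp S H x] = setT `&` [set x | t%:E < (Ktp S H \_ S) x].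
  rewrite setTI; apply/seteqP; split=> x /=; first by case=> Sx h; rewrite patchE mem_set.
  rewrite patchE; case: ifPn => [/set_mem Sx //|_].
  by rewrite lte_fin ltNge t0.
apply: (@Lnorm_ge_cst _ _ _ (mu m)) => //; [exact: Ktp_restrict_ge0| |by move=> x [_ /ltW]].
exact: emeasurable_fun_o_infty.
Qed.

Lemma poweR_le_tp_energy m p S H m' S' H' : (0 < p)%R ->
  tp_energy m p S H `^ p <= tp_energy m' p S' H' `^ p ->
  tp_energy m p S H <= tp_energy m' p S' H'.
Proof.
move=> p0 h; have ge0 q A K : 0 <= tp_energy q p A K.
  by rewrite /tp_energy; case: asboolP => // _; exact: Lnorm_ge0.
have E q A K : (tp_energy q p A K `^ p) `^ p^-1 = tp_energy q p A K.
  by rewrite -poweRrM divff ?gt_eqF// poweRe1.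
rewrite -[leLHS]E -[leRHS]E; apply: gt0_ler_poweR => //.
- by rewrite invr_ge0 ltW.
- by rewrite in_itv/= poweR_ge0 leey.
- by rewrite in_itv/= poweR_ge0 leey.
Qed.

End tp_energy_bounds.

(** * Tangent point curvature and touching balls *)

Section tangent_point_curvature.
Context {R : realType} {n : nat}.
Implicit Types (x y z v nu : 'rV[R]_n) (S L F : set 'rV[R]_n) (r : R).
Implicit Type H : 'rV[R]_n -> set 'rV[R]_n.

Local Notation edist := Defs.edist.

Lemma edist_le y z F : F z -> edist y F <= enorm (y - z).
Proof.
move=> Fz; apply: ge_inf; last by exists z.
by exists 0 => _ [w _ <-]; exact: enorm_ge0.
Qed.

Lemma le_edist y F (d : R) : F !=set0 -> (forall z, F z -> d <= enorm (y - z)) ->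
  d <= edist y F.
Proof.
move=> [z Fz] dF; apply: lb_le_inf; first by exists (enorm (y - z)); exists z.
by move=> _ [w Fw <-]; exact: dF.
Qed.

Lemma ex_edist_lt y F (d : R) : F !=set0 -> edist y F < d ->
  exists z, F z /\ enorm (y - z) < d.
Proof.
move=> F0 yd; apply: contrapT => h; move: yd; rewrite ltNge => /negP; apply.
by apply: le_edist => // z Fz; rewrite leNgt; apply/negP => ?; apply: h; exists z.
Qed.

(** Stated for subsets L of a hyperplane so that it applies to tangent spaces,
    for which velocities of curves directly give an inclusion. *)
Lemma dot_le_edist x y nu L : enorm nu = 1 -> L !=set0 -> L `<=` hyperplane nu ->
  `|dot (y - x) nu| <= edist y (affine x L).
Proof.
move=> nu1 [v0 Lv0] Lnu; apply: le_edist; first by exists (x + v0); exists v0.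
move=> _ [v Lv <-]; have -> : dot (y - x) nu = dot (y - (x + v)) nu.
  by have := Lnu v Lv; rewrite /hyperplane /= => vnu; rewrite !dotE vnu; ring.
by apply: le_trans (cauchy_schwarz _ _) _; rewrite nu1 mulr1.
Qed.

Lemma edist_hyperplane x y nu : enorm nu = 1 ->
  edist y (affine x (hyperplane nu)) = `|dot (y - x) nu|.
Proof.
move=> nu1; apply/eqP; rewrite eq_le; apply/andP; split; last first.
  by apply: dot_le_edist => //; exists 0; rewrite /hyperplane /= dot0l.
have Fz : affine x (hyperplane nu) (x + (y - x - dot (y - x) nu *: nu)).
  exists (y - x - dot (y - x) nu *: nu) => //.
  by rewrite /hyperplane /= !dotE dot_unit//; ring.
apply: le_trans (edist_le y Fz) _.
by rewrite opprD addrA opprB addrCA subrr addr0 enormZ nu1 mulr1.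
Qed.

(** The conclusion says that S does not meet the two open balls of radius r
    tangent at x to the hyperplane normal to nu. *)
Lemma Ktp_tangent_ball S H x nu r : enorm nu = 1 -> H x !=set0 ->
  H x `<=` hyperplane nu -> 0 < r -> (Ktp S H x <= (r^-1)%:E)%E ->
  forall y, S y -> `|dot (y - x) nu| * (2 * r) <= enorm (y - x) ^+ 2.
Proof.
move=> nu1 H0 Hnu r0 Kr y Sy.
have : ((inv_Rtp x y (H x))%:E <= (r^-1)%:E)%E.
  by apply: le_trans Kr; apply: ereal_sup_ubound; exists y.
rewrite lee_fin /inv_Rtp; case: ifPn => [/set_mem[v Hv <-] _|yH].
  have := Hnu v Hv; rewrite /hyperplane /= addrC addKr => ->.
  by rewrite normr0 mul0r exprn_ge0 ?enorm_ge0.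
rewrite /Rtp invf_div => h.
have h1 := dot_le_edist x y nu1 H0 Hnu.
have [yx|yx] := eqVneq y x; first by rewrite yx subrr dot0l normr0 mul0r exprn_ge0 ?enorm_ge0.
have e0 : 0 < enorm (y - x) ^+ 2 by rewrite exprn_gt0// enorm_gt0 subr_eq0.
rewrite ler_pdivrMr// in h.
have : r * (2 * edist y (affine x (H x))) <= r * (r^-1 * enorm (y - x) ^+ 2) by rewrite ler_pM2l.
rewrite mulVKf ?gt_eqF// => h2; apply: le_trans h2.
have -> : r * (2 * edist y (affine x (H x))) = edist y (affine x (H x)) * (2 * r) by ring.
by rewrite ler_wpM2r// mulr_ge0// ltW.
Qed.

Lemma sphere_dot r x y : esphere 0 r x -> esphere 0 r y ->
  dot (y - x) x = - (enorm (y - x) ^+ 2 / 2).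
Proof.
rewrite /esphere /= !subr0 => xr yr; have := enorm_sqr x; have := enorm_sqr y.
rewrite xr yr enorm_sqr !dotE (dotC x y); lra.
Qed.

Lemma hyperplane_normalize x : x != 0 -> hyperplane (normalize x) = hyperplane x.
Proof.
move=> x0; apply/seteqP; split=> v; rewrite /hyperplane /= dotZr; last by move=> ->; rewrite mulr0.
by move/eqP; rewrite mulf_eq0 invr_eq0 enorm_eq0 (negbTE x0) => /eqP.
Qed.

Lemma sphere_edist_hyperplane r x y : 0 < r -> esphere 0 r x -> esphere 0 r y ->
  edist y (affine x (hyperplane x)) = enorm (y - x) ^+ 2 / (2 * r).
Proof.
move=> r0 Sx Sy; have xr : enorm x = r by move: (Sx); rewrite /esphere /= subr0.
have x0 : x != 0 by rewrite -enorm_gt0 xr.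
rewrite -hyperplane_normalize// edist_hyperplane ?enorm_normalize// dotZr (sphere_dot Sx Sy).
rewrite mulrN normrN ger0_norm; last first.
  by rewrite mulr_ge0 ?invr_ge0 ?enorm_ge0// divr_ge0// exprn_ge0// enorm_ge0.
by rewrite xr; have := gt_eqF r0 => /negbT h; field.
Qed.

(** On the sphere |y - x|^2 = 2 r dist(y, x + H) by the chord formula
    ([sphere_edist_hyperplane]), so the tangent point radius of any two distinct
    points is r; the antipode of x provides one. *)
Lemma Ktp_sphere r H x : 0 < r -> esphere 0 r x -> H x = hyperplane x ->
  Ktp (esphere 0 r) H x = (r^-1)%:E.
Proof.
move=> r0 Sx Hx; have xr : enorm x = r by move: (Sx); rewrite /esphere /= subr0.
have x0 : x != 0 by rewrite -enorm_gt0 xr.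
have K y : esphere 0 r y -> y != x -> inv_Rtp x y (H x) = r^-1.
  move=> Sy yx; have e0 : 0 < enorm (y - x) ^+ 2 by rewrite exprn_gt0// enorm_gt0 subr_eq0.
  rewrite /inv_Rtp; case: ifPn => [/set_mem[v]|_].
    rewrite Hx /hyperplane /= => vx yE; have := sphere_dot Sx Sy.
    by rewrite -{1}yE addrC addKr vx; lra.
  rewrite /Rtp Hx (sphere_edist_hyperplane r0 Sx Sy).
  have h1 := lt0r_neq0 r0; have h2 := lt0r_neq0 e0.
  move: (enorm (y - x) ^+ 2) h2 => e h2.
  have -> : 2 * (e / (2 * r)) = e / r by field.
  by rewrite invf_div mulrAC divff// mul1r.
apply/eqP; rewrite eq_le; apply/andP; split.
  apply: ge_ereal_sup => _ [y Sy <-]; rewrite lee_fin.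
  have [->|yx] := eqVneq y x; last by rewrite K.
  rewrite /inv_Rtp ifT ?invr_ge0 ?(ltW r0)//; apply/mem_set; exists 0; last by rewrite addr0.
  by rewrite Hx /hyperplane /= dot0l.
have Nx : - x != x.
  by rewrite -subr_eq0 -opprD oppr_eq0 -mulr2n -scaler_nat scaler_eq0 pnatr_eq0.
apply: ereal_sup_ubound; exists (- x); last by rewrite K// /esphere /= subr0 enormN.
by rewrite /esphere /= subr0 enormN.
Qed.

End tangent_point_curvature.

(** * Inversions *)

Section inversion.
Context {R : realType} {n : nat}.
Implicit Types (x y z v w q : 'rV[R]_n) (r k : R).

(** Inversion in the sphere of centre q and squared radius k. *)
Definition inversion q k y := q + (k / dot (y - q) (y - q)) *: (y - q).

(** The derivative at z of the inversion, in the direction v. *)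
Definition dinversion q k z v :=
  (k / dot (z - q) (z - q)) *: v -
  (k * (2 * dot (z - q) v) / dot (z - q) (z - q) ^+ 2) *: (z - q).

Lemma inversion_sub q k y : inversion q k y - q = (k / dot (y - q) (y - q)) *: (y - q).
Proof. by rewrite /inversion addrC addKr. Qed.

Lemma dot_neq0 w : w != 0 -> dot w w != 0.
Proof. by rewrite dot_eq0. Qed.

Lemma inversion_neq q k y : k != 0 -> y != q -> inversion q k y != q.
Proof.
move=> k0 yq; have w0 : y - q != 0 by rewrite subr_eq0.
by rewrite -subr_eq0 inversion_sub scaler_eq0 mulf_eq0 invr_eq0 negb_or negb_or k0 dot_neq0.
Qed.

Lemma inversionK q k y : k != 0 -> y != q -> inversion q k (inversion q k y) = y.
Proof.
move=> k0 yq; have w0 : dot (y - q) (y - q) != 0 by rewrite dot_neq0// subr_eq0.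
rewrite {1}/inversion inversion_sub dotZl dotZr scalerA.
have -> : k / (k / dot (y - q) (y - q) * (k / dot (y - q) (y - q) * dot (y - q) (y - q))) *
    (k / dot (y - q) (y - q)) = 1.
  by move: w0; move: (dot _ _) => a a0; field; rewrite k0 a0.
by rewrite scale1r addrC subrK.
Qed.

Let coord_sub q (i : 'I_n) : 'rV[R]_n -> R := (fun y => y ord0 i : R) - cst (q ord0 i).

Let differentiable_coord_sub q i z : differentiable (coord_sub q i) z.
Proof.
apply: differentiableB; [exact: differentiable_coord|exact: differentiable_cst].
Qed.

Lemma differentiable_dot_sub q z : differentiable (fun y : 'rV[R]_n => dot (y - q) (y - q)) z.
Proof.
have -> : (fun y : 'rV[R]_n => dot (y - q) (y - q)) =
    \sum_(i < n) (coord_sub q i * coord_sub q i).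
  by apply/funext => y; rewrite fct_sumE /dot; apply: eq_bigr => i _; rewrite !mxE.
by apply: differentiable_sum => i; exact: differentiableM.
Qed.

(** Written as a sum of products of coordinate functions and of the inverse of
    the squared distance to q, so that the rules of calculus apply. *)
Lemma differentiable_inversion q k z : z != q -> differentiable (inversion q k) z.
Proof.
move=> zq; have N0 : dot (z - q) (z - q) != 0 by rewrite dot_neq0// subr_eq0.
pose N y : R := (dot (y - q) (y - q))^-1.
have dN : differentiable N z by apply: differentiableV => //; exact: differentiable_dot_sub.
have -> : inversion q k = cst q + \sum_(i < n)
    (fun y : 'rV[R]_n => ((k *: N) * coord_sub q i) y *: delta_mx 0 i).
  apply/funext => y; rewrite /inversion addrfctE /= fct_sumE; congr (_ + _).
  rewrite [X in _ *: X](row_sum_delta (y - q)) scaler_sumr; apply: eq_bigr => i _.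
  by rewrite scalerA; congr (_ *: _); rewrite !mxE.
apply: differentiableD; first exact: differentiable_cst.
apply: differentiable_sum => i; apply: differentiableZl; apply: differentiableM => //.
exact: differentiableZ.
Qed.

(** The difference quotient is computed exactly: N h is the squared distance
    from q to z + h v, and for h != 0 the quotient is g h, an expression that
    is continuous at 0. *)
Lemma derive_inversion q k z v : z != q -> 'D_v (inversion q k) z = dinversion q k z v.
Proof.
move=> zq; set w := z - q; have N0 : dot w w != 0 by rewrite dot_neq0// subr_eq0.
pose N (h : R) := dot w w + h * (2 * dot w v) + h ^+ 2 * dot v v.
have NE h : dot (h *: v + z - q) (h *: v + z - q) = N h.
  have -> : h *: v + z - q = w + h *: v by rewrite /w; apply/rowP => i; rewrite !mxE; ring.
  by rewrite /N; generalize w => u; rewrite !dotE (dotC v u); ring.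
pose g (h : R) := (k / N h) *: v - (k * (2 * dot w v + h * dot v v) / (dot w w * N h)) *: w.
have id0 : (fun h : R => h) @ (0 : R)^' --> (0 : R) by exact: cvg_within.
have cN : N @ (0 : R)^' --> dot w w.
  have -> : dot w w = dot w w + 0 * (2 * dot w v) + 0 ^+ 2 * dot v v.
    by rewrite expr0n /= !mul0r !addr0.
  apply: cvgD; first apply: cvgD; first exact: cvg_cst.
    by apply: cvgM => //; exact: cvg_cst.
  by apply: cvgM; [rewrite expr2; exact: cvgM|exact: cvg_cst].
have cg : g @ (0 : R)^' --> dinversion q k z v.
  rewrite /dinversion -/w; apply: cvgB; apply: cvgZr_tmp.
    by apply: cvgM; [exact: cvg_cst|exact: cvgV].
  have -> : k * (2 * dot w v) / dot w w ^+ 2 = k * (2 * dot w v + 0 * dot v v) / (dot w w * dot w w).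
    by rewrite mul0r addr0 expr2.
  apply: cvgM.
    apply: cvgM; first exact: cvg_cst.
    apply: cvgD; first exact: cvg_cst.
    by apply: cvgM => //; exact: cvg_cst.
  apply: cvgV; first by rewrite mulf_neq0.
  by apply: cvgM => //; exact: cvg_cst.
apply: cvg_lim => //; apply: cvg_trans cg; apply: near_eq_cvg.
have N1 : \forall h \near (0 : R)^', N h != 0 by apply: cvgr_neq0 cN N0.
have h1 : \forall h \near (0 : R)^', h != 0 by exact: nbhs_dnbhs_neq.
near=> h; have h0 : h != 0 by near: h. have Nh : N h != 0 by near: h.
rewrite /= /inversion NE -/w /g opprD addrACA subrr add0r.
have -> : h *: v + z - q = w + h *: v by rewrite /w; apply/rowP => i; rewrite !mxE; ring.
have hN : h * (2 * dot w v + h * dot v v) = N h - dot w w by rewrite /N; ring.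
have E1 : k * (2 * dot w v + h * dot v v) / (dot w w * N h) = h^-1 * (k / dot w w - k / N h).
  apply: (mulfI h0); rewrite !mulrA mulfV// mul1r -[h * k]mulrC -[k * h * _]mulrA hN.
  by field; rewrite N0 Nh.
rewrite E1; move: (k / N h) (k / dot w w) => a b.
apply/rowP => i; rewrite !mxE; field.
by rewrite h0.
Unshelve. all: by end_near. Qed.

Lemma continuous_dinversion q k v y : y != q -> {for y, continuous (fun z => dinversion q k z v)}.
Proof.
move=> yq; have N0 : dot (y - q) (y - q) != 0 by rewrite dot_neq0// subr_eq0.
have FF := @nbhs_filter _ y.
have cw : (z - q) @[z --> y] --> y - q by apply: cvgB; [exact: cvg_id|exact: cvg_cst].
have cN : dot (z - q) (z - q) @[z --> y] --> dot (y - q) (y - q).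
  have dc := differentiable_continuous (differentiable_dot_sub q y).
  exact: dc.
have cd : dot (z - q) v @[z --> y] --> dot (y - q) v.
  by apply: (@cvg_comp _ _ _ (fun z => z - q) (fun z => dot z v) _ _ _ cw); exact: dot_continuous.
rewrite /continuous_at /dinversion; apply: cvgB.
  by apply: cvgZr_tmp; apply: cvgM; [exact: cvg_cst|exact: cvgV].
apply: cvgZ => //; apply: cvgM.
  by apply: cvgM; [exact: cvg_cst|apply: cvgM => //; exact: cvg_cst].
by apply: cvgV; [rewrite expf_neq0|rewrite expr2; exact: cvgM].
Qed.

Lemma C1_on_inversion q k : C1_on [set y | y != q] (inversion q k).
Proof.
move=> y yq; split; first exact: differentiable_inversion.
move=> v; pose G z := 'd (inversion q k) z v.
have GE z : z != q -> G z = dinversion q k z v.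
  move=> zq; rewrite -derive_inversion//; apply: esym.
  exact: (deriveE _ (differentiable_inversion k zq)).
have dc := continuous_dinversion (k := k) (v := v) yq.
suff : {for y, continuous G} by [].
apply/continuous_at_eball => e e0.
have [d [d0 dP]] := (continuous_at_eball _ _).1 dc e e0.
exists (Num.min d (enorm (y - q))); split.
  by rewrite lt_min d0 enorm_gt0 subr_eq0.
move=> z; rewrite lt_min => /andP[zd zy]; rewrite !GE//; first exact: dP.
by apply: contraTneq zy => ->; rewrite enormBC ltxx.
Qed.

End inversion.

(** * The sphere as a C^1-hypersurface *)

Section sphere_submanifold.
Context {R : realType} {n : nat}.
Implicit Types (x y z v w q g : 'rV[R]_n) (r k : R) (S L : set 'rV[R]_n).

(** An inversion centred at a point of the sphere carries the sphere to a
    hyperplane.  With centre the antipode of x and squared radius 2 r^2, it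
    takes x to the origin and the sphere to the linear hyperplane normal to
    x. *)
Lemma sphere_inversion r x y : 0 < r -> esphere 0 r x -> y != - x ->
  esphere 0 r y <-> dot (inversion (- x) (2 * r ^+ 2) y) x = 0.
Proof.
move=> r0 Sx yx; have xr : enorm x = r by move: (Sx); rewrite /esphere /= subr0.
have xx : dot x x = r ^+ 2 by rewrite -enorm_sqr xr.
have N0 : dot (y + x) (y + x) != 0 by rewrite dot_neq0// addr_eq0.
rewrite /inversion opprK dotDl dotNl dotZl xx.
have -> : esphere 0 r y <-> dot y y = r ^+ 2.
  rewrite /esphere /= subr0 -enorm_sqr; split=> [->//|/eqP].
  by rewrite eqrXn2 ?enorm_ge0 ?(ltW r0)// => /eqP.
have NE : dot (y + x) (y + x) = dot y y + 2 * dot y x + r ^+ 2.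
  by rewrite !dotE (dotC x y) xx; ring.
have DE : dot (y + x) x = dot y x + r ^+ 2 by rewrite dotDl xx.
have r2 : r ^+ 2 != 0 by rewrite expf_neq0 ?gt_eqF.
split=> [yy|].
  rewrite DE NE yy; rewrite NE yy in N0.
  have -> : r ^+ 2 + 2 * dot y x + r ^+ 2 = 2 * (dot y x + r ^+ 2) by ring.
  have h : dot y x + r ^+ 2 != 0 by apply: contraNneq N0 => h; apply/eqP; lra.
  by field.
move=> h; have : r ^+ 2 * (dot y y - r ^+ 2) = 0.
  have : - r ^+ 2 * dot (y + x) (y + x) + 2 * r ^+ 2 * dot (y + x) x = 0.
    transitivity ((- r ^+ 2 + 2 * r ^+ 2 / dot (y + x) (y + x) * dot (y + x) x) * dot (y + x) (y + x)).
      by field.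
    by rewrite h mul0r.
  by rewrite DE NE; lra.
by move/eqP; rewrite mulf_eq0 (negbTE r2) /= subr_eq0 => /eqP.
Qed.

Lemma eopen_neq q : eopen [set y | y != q].
Proof.
move=> y yq; exists (enorm (y - q)); split; first by rewrite enorm_gt0 subr_eq0.
by move=> z; rewrite /eball /=; apply: contraTneq => ->; rewrite enormBC ltxx.
Qed.

(** The chart at x is the inversion of [sphere_inversion], which is its own
    inverse. *)
Lemma sphere_C1_submanifold r : 0 < r -> C1_submanifold n.-1 (esphere (0 : 'rV[R]_n) r).
Proof.
move=> r0 x Sx; have xr : enorm x = r by move: (Sx); rewrite /esphere /= subr0.
have x0 : x != 0 by rewrite -enorm_gt0 xr.
have k0 : 2 * r ^+ 2 != 0 by rewrite mulf_neq0 ?expf_neq0 ?gt_eqF.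
pose f := inversion (- x) (2 * r ^+ 2).
have ff y : y != - x -> f y != - x /\ f (f y) = y.
  by move=> yx; split; [exact: inversion_neq|exact: inversionK].
exists [set y | y != - x], [set y | y != - x], (hyperplane x), f, f; split.
- split; [exact/eopen_open/eopen_neq|exact/eopen_open/eopen_neq|].
  by rewrite /= -subr_eq0 opprK -mulr2n -scaler_nat scaler_eq0 pnatr_eq0.
- by split; exact: C1_on_inversion.
- by [].
- exact: hyperplane_grassmannian.
- apply/seteqP; split=> [_ [y [Sy yx] <-]|z [zx zq]].
    split; first exact/(sphere_inversion r0 Sx yx).
    by have [] := ff _ yx.
  have [fz ffz] := ff _ zq; exists (f z) => //; split=> //.
  by apply/(sphere_inversion r0 Sx fz); rewrite -/f ffz.
Qed.

Lemma sphere_compact r : compact (esphere (0 : 'rV[R]_n) r).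
Proof.
apply: bounded_closed_compact.
  exists `|r|; split; first exact: num_real.
  move=> M rM x; rewrite /esphere /= subr0 => xr; apply: le_trans (ler_norm_enorm x) _.
  by rewrite xr (le_trans (ler_norm r))// ltW.
have -> : esphere (0 : 'rV[R]_n) r = enorm @^-1` [set r].
  by apply/seteqP; split=> x; rewrite /esphere /= subr0.
by apply: closed_comp; [move=> x _; exact: enorm_continuous|exact: closed_eq].
Qed.

(** The derivative of a curve as a first order expansion in the Euclidean
    norm. *)
Lemma velocityP (c : R -> 'rV[R]_n) x v : c 0 = x -> derivable c 0 1 -> derive1 c 0 = v ->
  forall e : R, 0 < e -> exists d : R, 0 < d /\
    forall t, `|t| < d -> enorm (c t - x - t *: v) <= e * `|t|.
Proof.
move=> c0 dc; rewrite derive1E => cv e e0.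
have n0 : 0 < n.+1%:R :> R by [].
have := dc; rewrite /derivable => /cvgrPdist_lt/(_ (e / n.+1%:R) (divr_gt0 e0 n0)).
rewrite -/(derive c 0 1) cv => -[d /= d0 dP]; exists d; split=> // t td.
have [->|t0] := eqVneq t 0; first by rewrite c0 subrr scale0r subr0 enorm0 normr0 mulr0.
have := dP t; rewrite /ball_ /= sub0r normrN => /(_ td t0).
rewrite addr0 c0 [t%:A]mulr1 => h.
have -> : c t - x - t *: v = t *: (t^-1 *: (c t - x) - v).
  by rewrite scalerBr scalerA divff// scale1r.
rewrite enormZ mulrC ler_wpM2r// enormBC; apply: le_trans (ler_enorm_norm _) _.
have : n%:R * `|v - t^-1 *: (c t - x)| <= n%:R * (e / n.+1%:R) by rewrite ler_wpM2l// ltW.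
move=> /le_trans; apply; rewrite mulrCA ler_piMr ?(ltW e0)//.
by rewrite ler_pdivrMr// mul1r ler_nat.
Qed.

Lemma small_zero (a K : R) : 0 <= K -> (forall e : R, 0 < e -> `|a| <= K * e) -> a = 0.
Proof.
move=> K0 h; apply/eqP; rewrite -normr_le0 leNgt; apply/negP => a0.
have K1 : 0 < 2 * (K + 1) by rewrite mulr_gt0// ltr_wpDl.
have := h (`|a| / (2 * (K + 1))) (divr_gt0 a0 K1).
rewrite mulrA ler_pdivlMr// => h1.
have : 0 <= K * `|a| by rewrite mulr_ge0.
lra.
Qed.

(** A curve in the sphere satisfies dot (c t - x) x = - |c t - x|^2 / 2, which is
    of second order, so its velocity is normal to x.  Conversely, for v normal
    to x, the inverse image of a line under the inversion chart at x is a curve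
    in the sphere with velocity v at x. *)
Lemma sphere_tangent_space r x : 0 < r -> esphere 0 r x ->
  tangent_space (esphere 0 r) x = hyperplane x.
Proof.
move=> r0 Sx; have xr : enorm x = r by move: (Sx); rewrite /esphere /= subr0.
have xx : dot x x = r ^+ 2 by rewrite -enorm_sqr xr.
have x0 : x != 0 by rewrite -enorm_gt0 xr.
have k0 : 2 * r ^+ 2 != 0 by rewrite mulf_neq0 ?expf_neq0 ?gt_eqF.
apply/seteqP; split=> v.
  move=> [c [e [e0 c0 cv cP]]]; rewrite /hyperplane /=.
  have [S0 dc _] := cP 0 ltac:(by rewrite normr0).
  pose K := r + (enorm v + 1) ^+ 2.
  apply: (@small_zero _ K); first by rewrite addr_ge0 ?(ltW r0)// sqr_ge0.
  move=> h h0; pose h' := Num.min h 1; have h'0 : 0 < h' by rewrite lt_min h0 ltr01.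
  have [d [d0 dP]] := velocityP c0 dc cv h'0.
  pose t := Num.min (Num.min e d) h' / 2.
  have m0 : 0 < Num.min (Num.min e d) h' by rewrite !lt_min e0 d0 h0 ltr01.
  have t0 : 0 < t by rewrite divr_gt0.
  have tm : t < Num.min (Num.min e d) h' by rewrite /t; lra.
  move: tm; rewrite !lt_min => /andP[/andP[te td] /andP[th t1]].
  have := dP t; rewrite gtr0_norm// => /(_ td) ht.
  have [St _ _] := cP t ltac:(by rewrite gtr0_norm).
  have h'h : h' <= h by rewrite ge_min lexx.
  have h'1 : h' <= 1 by rewrite ge_min lexx orbT.
  have ct : enorm (c t - x) <= (enorm v + 1) * t.
    have -> : c t - x = (c t - x - t *: v) + t *: v by rewrite subrK.
    apply: le_trans (ler_enormD _ _) _; rewrite enormZ gtr0_norm//.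
    have : h' * t <= 1 * t by rewrite ler_pM2r.
    lra.
  have sd := sphere_dot Sx St.
  have vx : t * dot v x = dot (c t - x) x - dot (c t - x - t *: v) x.
    by rewrite (dotBl (c t - x)) dotZl; ring.
  have a1 : `|dot (c t - x) x| <= (enorm v + 1) ^+ 2 * t * t.
    rewrite sd normrN ger0_norm ?divr_ge0 ?exprn_ge0 ?enorm_ge0//.
    apply: (@le_trans _ _ (enorm (c t - x) ^+ 2)).
      by have := exprn_ge0 2 (enorm_ge0 (c t - x)); lra.
    rewrite -mulrA -expr2 -exprMn lerXn2r ?nnegrE ?enorm_ge0//.
    by rewrite mulr_ge0 ?(ltW t0)// addr_ge0// enorm_ge0.
  have a2 : `|dot (c t - x - t *: v) x| <= h' * t * r.
    by apply: le_trans (cauchy_schwarz _ _) _; rewrite xr ler_pM2r.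
  have : `|t * dot v x| <= (enorm v + 1) ^+ 2 * t * t + h' * t * r.
    by rewrite vx (le_trans (ler_normB _ _))// lerD.
  rewrite normrM gtr0_norm// => a3.
  rewrite -(ler_pM2l t0); apply: le_trans a3 _.
  rewrite /K (_ : t * _ = (enorm v + 1) ^+ 2 * t * h + h * t * r); last by ring.
  rewrite lerD//.
    by rewrite ler_wpM2l// ?(ltW th)// mulr_ge0 ?sqr_ge0// ltW.
  by rewrite ler_pM2r// ler_pM2r.
(* the inversion has derivative 2 at the origin on vectors normal to x *)
rewrite /hyperplane /= => vx; pose w := 2^-1 *: v.
have wx : dot w x = 0 by rewrite dotZl vx mulr0.
pose f := inversion (- x) (2 * r ^+ 2); pose c t := f (t *: w).
have tw t : t *: w != - x.
  apply/eqP => /(congr1 (dot^~ x)); rewrite dotZl wx mulr0 dotNl xx => /eqP.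
  by rewrite eq_sym oppr_eq0 expf_eq0 gt_eqF.
have dl t : differentiable (fun t : R => t *: w) t.
  by apply: (@differentiableZl _ _ _ id).
have df z : z != - x -> differentiable f z by exact: differentiable_inversion.
have dc t : differentiable c t by apply: differentiable_comp; [exact: dl|exact: df].
have Dc t : derive1 c t = dinversion (- x) (2 * r ^+ 2) (t *: w) w.
  rewrite derive1E deriveE//.
  have -> : 'd c t 1 = 'd f (t *: w) ('d (fun t : R => t *: w) t 1).
    have := @diff_comp _ _ _ _ (fun t : R => t *: w) f t (dl t) (df _ (tw t)).
    by move=> /(congr1 (fun F => F 1)).
  have -> : 'd (fun t : R => t *: w) t 1 = w.
    have -> : 'd (fun t : R => t *: w) t = ( *:%R^~ w) :> (R -> _).
      exact: (@diff_val _ _ _ _ _ _ _ (is_diff_scalel t w)).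
    by rewrite scale1r.
  by rewrite -(deriveE w (df _ (tw t))) derive_inversion.
have vw : v = 2 *: w by rewrite scalerA mulfV// scale1r.
exists c, 1; split=> //.
- rewrite /c scale0r /f /inversion sub0r opprK xx.
  rewrite mulfK ?expf_neq0 ?gt_eqF// scaler_nat mulr2n addrA addNr add0r//.
- rewrite Dc scale0r /dinversion sub0r opprK xx (dotC x w) wx mulr0 mulr0 mul0r scale0r subr0.
  by rewrite mulfK ?expf_neq0 ?gt_eqF// -vw.
- move=> t _; split.
  + have [fw ffw] : f (t *: w) != - x /\ f (f (t *: w)) = t *: w.
      by split; [exact: inversion_neq|exact: inversionK].
    by apply/(sphere_inversion r0 Sx fw); rewrite -/f ffw dotZl wx mulr0.
  + exact: diff_derivable.
  + have -> : derive1 c = fun t => dinversion (- x) (2 * r ^+ 2) (t *: w) w.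
      by apply/funext => s; rewrite Dc.
    have cl : (s *: w) @[s --> t] --> t *: w by exact: scalel_continuous.
    apply: (@cvg_comp _ _ _ (fun s => s *: w) (fun z => dinversion (- x) (2 * r ^+ 2) z w) _ _ _ cl).
    exact: continuous_dinversion.
Qed.

(** That Phi sends S to L within U turns into an equivalence because Phi is
    injective. *)
Lemma flattening_of_C1 (S U V : set 'rV[R]_n) L (Phi Psi : 'rV[R]_n -> 'rV[R]_n) g :
  open U -> open V -> C1_on U Phi -> C1_on V Psi ->
  (forall y, U y -> V (Phi y) /\ Psi (Phi y) = y) ->
  (forall z, V z -> U (Psi z) /\ Phi (Psi z) = z) ->
  g != 0 -> L = hyperplane g -> Phi @` (S `&` U) = L `&` V ->
  flattening S U V Phi Psi g.
Proof.
move=> oU oV cPhi cPsi UV VU g0 LE img.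
have ec W F : C1_on W F -> forall y, W y -> econtinuous_at y F.
  move=> cF y Wy e e0; have n0 : 0 < n.+1%:R :> R by [].
  have /differentiable_continuous/continuous_at_eball/(_ (e / n.+1%:R) (divr_gt0 e0 n0)) := (cF y Wy).1.
  move=> [d [d0 dP]]; exists d; split=> // z zy; have := dP z zy => h.
  rewrite enormBC; apply: le_lt_trans (ler_enorm_norm _) _.
  move: h; rewrite ltr_pdivlMr// mulrC; apply: le_lt_trans.
  by rewrite ler_wpM2r// ler_nat.
split=> //.
- by split; exact/eopen_open.
- by move=> y Uy; have [] := UV y Uy; split=> //; exact: ec cPhi y Uy.
- by move=> z Vz; have [] := VU z Vz; split=> //; exact: ec cPsi z Vz.
- move=> y Uy; have [VPy Ky] := UV y Uy; split=> [Sy|py].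
    have : (L `&` V) (Phi y) by rewrite -img; exists y.
    by rewrite LE => -[].
  have : (L `&` V) (Phi y) by rewrite LE.
  rewrite -img => -[y' [Sy' Uy'] yy']; have [_ Ky'] := UV y' Uy'.
  by rewrite -Ky -yy' Ky'.
Qed.

End sphere_submanifold.

(** * The sphere as a fine set *)

Section sphere_fine.
Context {R : realType} {m : nat}.
Implicit Types (x y z v w u nu : 'rV[R]_m.+1) (r s : R) (S L : set 'rV[R]_m.+1).

Local Notation edist := Defs.edist.

Lemma one_sub_sqrt (t : R) : 0 <= t <= 1 -> 0 <= 1 - Num.sqrt (1 - t) <= t.
Proof.
move=> /andP[t0 t1]; have := sqr_sqrtr (_ : 0 <= 1 - t); rewrite subr_ge0 => /(_ t1).
have := sqrtr_ge0 (1 - t); move: (Num.sqrt _) => q q0 qt.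
have q1 : q <= 1 by rewrite -(@ler_pXn2r _ 2)// ?nnegrE// qt expr1n; lra.
have : q ^+ 2 <= q by rewrite expr2 ler_piMr.
by move=> h; apply/andP; split; lra.
Qed.

(** Intersect the sphere with the plane spanned by x and w: the chord of length
    |w| issuing from x in the direction of w ends at y, and y differs from x + w
    by a quadratic error. *)
Lemma sphere_chord r x w : 0 < r -> esphere 0 r x -> dot w x = 0 -> enorm w <= 2 * r ->
  let y := x - (enorm w ^+ 2 / (2 * r ^+ 2)) *: x + Num.sqrt (1 - enorm w ^+ 2 / (4 * r ^+ 2)) *: w in
  [/\ esphere 0 r y, enorm (y - x) = enorm w & enorm (y - (x + w)) <= enorm w ^+ 2 / r].
Proof.
move=> r0 Sx wx wr; have xr : enorm x = r by move: (Sx); rewrite /esphere /= subr0.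
have xx : dot x x = r ^+ 2 by rewrite -enorm_sqr xr.
have rn : r != 0 by rewrite gt_eqF.
set a := enorm w ^+ 2 / (2 * r ^+ 2); set t := enorm w ^+ 2 / (4 * r ^+ 2).
have at_ : a = 2 * t by rewrite /a /t; field.
have t01 : 0 <= t <= 1.
  rewrite divr_ge0 ?exprn_ge0 ?enorm_ge0 ?mulr_ge0 ?exprn_ge0 ?(ltW r0)//=.
  rewrite ler_pdivrMr ?mulr_gt0 ?exprn_gt0// mul1r.
  rewrite (_ : 4 * r ^+ 2 = (2 * r) ^+ 2); last by ring.
  by rewrite lerXn2r ?nnegrE ?enorm_ge0// mulr_ge0// ltW.
have wt : enorm w ^+ 2 = 4 * r ^+ 2 * t by rewrite /t; field.
have := sqr_sqrtr (_ : 0 <= 1 - t); rewrite subr_ge0 => /(_ (proj2 (andP t01))).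
have /andP[q0 q1] := one_sub_sqrt t01; have := sqrtr_ge0 (1 - t).
move: (Num.sqrt (1 - t)) q0 q1 => q q0 q1 q2 qt y.
have yx : y - x = - a *: x + q *: w.
  by rewrite /y; apply/rowP => i; rewrite !mxE; ring.
have wx' : dot x w = 0 by rewrite dotC.
split.
- rewrite /esphere /= subr0; apply/eqP.
  rewrite -(@eqrXn2 _ 2)// ?enorm_ge0 ?(ltW r0)//; apply/eqP.
  have -> : y = (1 - a) *: x + q *: w.
    by rewrite /y; apply/rowP => i; rewrite !mxE; ring.
  rewrite enorm_sqr !dotE xx wx wx' -enorm_sqr wt at_.
  transitivity ((1 - 2 * t) ^+ 2 * r ^+ 2 + q ^+ 2 * (4 * r ^+ 2 * t)); first by ring.
  by rewrite qt; ring.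
- apply/eqP; rewrite -(@eqrXn2 _ 2)// ?enorm_ge0//; apply/eqP.
  rewrite yx !enorm_sqr !dotE xx wx wx' -enorm_sqr wt at_.
  transitivity (4 * t ^+ 2 * r ^+ 2 + q ^+ 2 * (4 * r ^+ 2 * t)); first by ring.
  by rewrite qt; ring.
- have -> : y - (x + w) = - a *: x - (1 - q) *: w.
    by rewrite /y; apply/rowP => i; rewrite !mxE; ring.
  apply: le_trans (ler_enormB _ _) _; rewrite !enormZ normrN xr.
  have /andP[t0 t1] := t01.
  rewrite (ger0_norm q0) ger0_norm; last by rewrite at_ mulr_ge0.
  have h1 : (1 - q) * enorm w <= t * (2 * r) by rewrite ler_pM// enorm_ge0.
  have -> : enorm w ^+ 2 / r = 4 * r * t by rewrite wt; field.
  by rewrite at_; lra.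
Qed.

(** Lines parallel to x through points near x meet the sphere near x; the
    displacement along x is of second order. *)
Lemma sphere_density r x s : (0 < m)%N -> 0 < r -> esphere 0 r x -> 0 < s -> s <= 2 * r ->
  ((line_measure_bound (R := R) (m := m) / 4 ^+ m * s ^+ m)%:E <=
   hausdorff_measure m (esphere 0 r `&` eball x s))%E.
Proof.
move=> m0 r0 Sx s0 sr; have xr : enorm x = r by move: (Sx); rewrite /esphere /= subr0.
have x0 : x != 0 by rewrite -enorm_gt0 xr.
have xx : dot x x = r ^+ 2 by rewrite -enorm_sqr xr.
have rn : r != 0 by rewrite gt_eqF.
have s4 : 0 < s / 4 by rewrite divr_gt0.
rewrite -mulrA [_^-1 * _]mulrC -expr_div_n.
apply: (@hausdorff_measure_lines R m _ x x) => // w wx.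
pose h := w - x; have hs : enorm h < s / 4 by exact: wx.
pose p := h - (dot h x / r ^+ 2) *: x.
have px : dot p x = 0 by rewrite /p dotBl dotZl xx divfK ?subrr// expf_neq0.
have ph : enorm p <= enorm h.
  rewrite -(@ler_pXn2r _ 2)// ?nnegrE ?enorm_ge0// /p enorm_subZ_sqr xr.
  have -> : enorm h ^+ 2 - 2 * (dot h x / r ^+ 2) * dot h x + (dot h x / r ^+ 2) ^+ 2 * r ^+ 2
    = enorm h ^+ 2 - (dot h x / r) ^+ 2 by field.
  by rewrite lerBlDr lerDl sqr_ge0.
have wE q : w + (q - 1 - dot h x / r ^+ 2) *: x = p + q *: x.
  by rewrite /p /h; apply/rowP => i; rewrite !mxE; ring.
clearbody p; pose t := enorm p ^+ 2 / r ^+ 2.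
have p1 : enorm p <= r / 2 by lra.
have t01 : 0 <= t <= 1.
  rewrite divr_ge0 ?exprn_ge0 ?enorm_ge0 ?(ltW r0)//= ler_pdivrMr ?exprn_gt0// mul1r.
  by rewrite lerXn2r ?nnegrE ?enorm_ge0 ?(ltW r0)//; lra.
have pt : enorm p ^+ 2 = r ^+ 2 * t by rewrite /t; field.
have := sqr_sqrtr (_ : 0 <= 1 - t); rewrite subr_ge0 => /(_ (proj2 (andP t01))).
have /andP[q0 q1] := one_sub_sqrt t01.
move: (Num.sqrt (1 - t)) q0 q1 => q q0 q1 qt.
exists (q - 1 - dot h x / r ^+ 2); rewrite wE; split.
  rewrite /esphere /= subr0; apply/eqP.
  rewrite -(@eqrXn2 _ 2)// ?enorm_ge0 ?(ltW r0)//; apply/eqP.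
  rewrite enorm_sqr !dotE px (dotC x p) px xx -enorm_sqr pt.
  transitivity (r ^+ 2 * t + q ^+ 2 * r ^+ 2); first by ring.
  by rewrite qt; ring.
rewrite /eball /=; have -> : p + q *: x - x = p - (1 - q) *: x.
  by apply/rowP => i; rewrite !mxE; ring.
apply: le_lt_trans (ler_enormB _ _) _; rewrite enormZ xr ger0_norm//.
have : (1 - q) * r <= t * r by rewrite ler_pM2r.
have -> : t * r = enorm p * (enorm p / r) by rewrite /t; field.
have : enorm p * (enorm p / r) <= enorm p * 1.
  by rewrite ler_wpM2l ?enorm_ge0// ler_pdivrMr// mul1r; lra.
lra.
Qed.

Lemma sphere_hausdorff_dist r x s : 0 < r -> esphere 0 r x -> 0 < s -> s <= 2 * r ->
  (hausdorff_dist (esphere 0 r `&` ecball x s) (affine x (hyperplane x) `&` ecball x s) <=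
   (s ^+ 2 / (2 * r) + s ^+ 2 / r)%:E)%E.
Proof.
move=> r0 Sx s0 sr; have xr : enorm x = r by move: (Sx); rewrite /esphere /= subr0.
have xx : dot x x = r ^+ 2 by rewrite -enorm_sqr xr.
have rn : r != 0 by rewrite gt_eqF.
rewrite EFinD; apply: leeD; apply: ge_ereal_sup => _ [y [Sy ys] <-]; rewrite lee_fin.
  have {}ys : enorm (y - x) <= s := ys.
  pose d := dot (y - x) x / r ^+ 2.
  have px : dot (y - x - d *: x) x = 0 by rewrite (dotBl (y - x)) dotZl xx divfK ?subrr// expf_neq0.
  have F : (affine x (hyperplane x) `&` ecball x s) (x + (y - x - d *: x)).
    split; first by exists (y - x - d *: x).
    rewrite /ecball /= addrC addKr; apply: le_trans ys.
    rewrite -(@ler_pXn2r _ 2)// ?nnegrE ?enorm_ge0// enorm_subZ_sqr xr.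
    have -> : enorm (y - x) ^+ 2 - 2 * d * dot (y - x) x + d ^+ 2 * r ^+ 2
      = enorm (y - x) ^+ 2 - (dot (y - x) x / r) ^+ 2 by rewrite /d; field.
    by rewrite lerBlDr lerDl sqr_ge0.
  apply: le_trans (edist_le y F) _.
  have -> : y - (x + (y - x - d *: x)) = d *: x.
    by apply/rowP => i; rewrite !mxE; ring.
  rewrite enormZ xr /d (sphere_dot Sx Sy) mulNr normrN ger0_norm; last first.
    by rewrite !divr_ge0// exprn_ge0// ?enorm_ge0// ltW.
  have -> : enorm (y - x) ^+ 2 / 2 / r ^+ 2 * r = enorm (y - x) ^+ 2 / (2 * r) by field.
  by rewrite ler_pM2r ?invr_gt0 ?mulr_gt0// lerXn2r ?nnegrE ?enorm_ge0// ltW.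
case: Sy => w wx yE; have {}ys : enorm (y - x) <= s := ys.
have ws : enorm w <= s by move: ys; rewrite -yE addrC addKr.
have wr : enorm w <= 2 * r by exact: le_trans sr.
have [Sz zx zw] := sphere_chord r0 Sx wx wr.
have F : (esphere 0 r `&` ecball x s) (x - (enorm w ^+ 2 / (2 * r ^+ 2)) *: x + Num.sqrt (1 - enorm w ^+ 2 / (4 * r ^+ 2)) *: w).
  by split=> //; rewrite /ecball /= zx.
apply: le_trans (edist_le y F) _; rewrite enormBC -yE; apply: le_trans zw _.
by rewrite ler_pM2r ?invr_gt0// lerXn2r ?nnegrE ?enorm_ge0// ltW.
Qed.

(** No hyperplane approximates the sphere to more than second order.  For a
    unit vector u tangent at x, the chords of length s / 2 in the directions u
    and - u have offsets a + b and a - b along nu, where a comes from the normal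
    part of the chord and b from its tangential part.  One of them has absolute
    value |a| + |b|.  If nu is mostly normal, a is large; if nu is mostly
    tangential, b is large for u the direction of the tangential part of nu. *)
Lemma sphere_beta_lower r x s nu : (0 < m)%N -> 0 < r -> esphere 0 r x -> 0 < s -> s <= 2 * r ->
  enorm nu = 1 -> exists z, (esphere 0 r `&` eball x s) z /\
    s ^+ 2 / (16 * r) <= `|dot (z - x) nu|.
Proof.
move=> m0 r0 Sx s0 sr nu1; have xr : enorm x = r by move: (Sx); rewrite /esphere /= subr0.
have xx : dot x x = r ^+ 2 by rewrite -enorm_sqr xr.
have rn : r != 0 by rewrite gt_eqF.
have [l ls] : exists l, l = s / 2 by exists (s / 2).
have l0 : 0 < l by rewrite ls divr_gt0.
have lr : l <= r by lra.
have key u : enorm u = 1 -> dot u x = 0 -> exists z, (esphere 0 r `&` eball x s) z /\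
    l ^+ 2 / (2 * r ^+ 2) * `|dot x nu| <= `|dot (z - x) nu| /\ l / 2 * `|dot u nu| <= `|dot (z - x) nu|.
  move=> u1 ux.
  pose a := - (l ^+ 2 / (2 * r ^+ 2) * dot x nu).
  pose t := l ^+ 2 / (4 * r ^+ 2).
  have t4 : 0 <= t <= 1 / 4.
    rewrite divr_ge0 ?exprn_ge0 ?mulr_ge0 ?exprn_ge0 ?(ltW r0) ?(ltW l0)//=.
    rewrite ler_pdivrMr ?mulr_gt0 ?exprn_gt0// mulrA mulfVK// mul1r.
    by rewrite lerXn2r ?nnegrE ?(ltW l0) ?(ltW r0).
  have [t40 t41] := andP t4.
  have t01 : 0 <= t <= 1 by apply/andP; split; lra.
  pose q := Num.sqrt (1 - t).
  have q2 : 1 / 2 <= q by have := one_sub_sqrt t01; rewrite -/q => /andP[_ ?]; lra.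
  pose b := q * (l * dot u nu).
  have z_ (e : R) : `|e| = 1 -> exists z, (esphere 0 r `&` eball x s) z /\ dot (z - x) nu = a + e * b.
    move=> e1; have wn : enorm ((e * l) *: u) = l by rewrite enormZ u1 mulr1 normrM e1 mul1r gtr0_norm.
    have wx : dot ((e * l) *: u) x = 0 by rewrite dotZl ux mulr0.
    have wr : enorm ((e * l) *: u) <= 2 * r by rewrite wn; lra.
    have := sphere_chord r0 Sx wx wr; rewrite wn -/t -/q => -[Sz zx _].
    eexists; split; first split; [exact: Sz| |].
      by rewrite /eball /= zx; lra.
    set c := l ^+ 2 / _; have -> : x - c *: x + q *: ((e * l) *: u) - x = - c *: x + (q * e * l) *: u.
      by apply/rowP => i; rewrite !mxE; ring.
    by rewrite dotDl !dotZl /a /b /c; ring.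
  have la : `|a| = l ^+ 2 / (2 * r ^+ 2) * `|dot x nu|.
    rewrite normrN normrM ger0_norm// divr_ge0 ?exprn_ge0 ?mulr_ge0 ?exprn_ge0 ?(ltW r0) ?(ltW l0)//.
  have lb : l / 2 * `|dot u nu| <= `|b|.
    rewrite !normrM (gtr0_norm l0) (ger0_norm (sqrtr_ge0 _)) mulrA -/q.
    by rewrite ler_wpM2r// mulrC ler_pM2r//; lra.
  rewrite -la; have [ab|ab] := leP 0 (a * b).
    have [z [Sz zE]] := z_ 1 (normr1 _); exists z; split=> //; rewrite zE mul1r.
    have : `|a + b| = `|a| + `|b|.
      have [a0|a0] := leP 0 a; last first.
        have b0 : b <= 0 by move: ab; rewrite nmulr_rge0.
        by rewrite (ltr0_norm a0) (ler0_norm b0) ler0_norm; lra.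
      have [a00|a00] := eqVneq a 0; first by rewrite a00 add0r normr0 add0r.
      have b0 : 0 <= b by move: ab; rewrite pmulr_rge0// lt_def a00.
      by rewrite (ger0_norm a0) (ger0_norm b0) ger0_norm; lra.
    by move=> ->; split; [rewrite lerDl|apply: le_trans lb _; rewrite lerDr].
  have [z [Sz zE]] := z_ (-1) (normrN1 _); exists z; split=> //; rewrite zE mulN1r.
  have : `|a - b| = `|a| + `|b|.
    have [a0|a0|a0] := ltrgtP 0 a; last by move: ab; rewrite -a0 mul0r ltxx.
      have b0 : b < 0 by move: ab; rewrite pmulr_rlt0.
      by rewrite (gtr0_norm a0) (ltr0_norm b0) gtr0_norm; lra.
    have b0 : 0 < b by move: ab; rewrite nmulr_rlt0.
    by rewrite (ltr0_norm a0) (gtr0_norm b0) ltr0_norm; lra.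
  by move=> ->; split; [rewrite lerDl|apply: le_trans lb _; rewrite lerDr].
have sl : s ^+ 2 / (16 * r) = l ^+ 2 / (4 * r) by rewrite ls; field.
have lmul c : 1 / 2 <= c -> l ^+ 2 / (4 * r) <= l / 2 * c.
  move=> c2; apply: (@le_trans _ _ (l / 2 * (1 / 2))); last by rewrite ler_pM2l// divr_gt0.
  rewrite ler_pdivrMr ?mulr_gt0// expr2.
  have : l * l <= l * r by rewrite ler_pM2l.
  lra.
have [ax|ax] := leP (r / 2) `|dot x nu|.
  have [u [u1 ux]] := ex_dot0 x (m0 : (2 <= m.+1)%N).
  have [z [Sz [h _]]] := key u u1 ux; exists z; split=> //; rewrite sl; apply: le_trans h.
  apply: (@le_trans _ _ (l ^+ 2 / (2 * r ^+ 2) * (r / 2))).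
    by rewrite le_eqVlt; apply/orP; left; apply/eqP; field.
  by rewrite ler_wpM2l// divr_ge0 ?exprn_ge0 ?mulr_ge0 ?exprn_ge0 ?(ltW r0) ?(ltW l0).
pose p := nu - (dot nu x / r ^+ 2) *: x.
have px : dot p x = 0 by rewrite /p dotBl dotZl xx divfK ?subrr// expf_neq0.
have pp : enorm p ^+ 2 = 1 - (dot x nu / r) ^+ 2.
  by rewrite /p enorm_subZ_sqr xr nu1 (dotC nu x); field.
have ar : `|dot x nu / r| <= 1 / 2.
  by rewrite normrM normfV (gtr0_norm r0) ler_pdivrMr//; lra.
have ar2 : (dot x nu / r) ^+ 2 <= (1 / 2) ^+ 2.
  by rewrite -real_normK ?num_real// lerXn2r ?nnegrE.
have p2 : 1 / 2 <= enorm p.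
  by rewrite -(@ler_pXn2r _ 2)// ?nnegrE ?enorm_ge0// pp; move: ar2; lra.
have p0 : p != 0 by rewrite -enorm_gt0; lra.
have pnu : dot p nu = enorm p ^+ 2.
  by rewrite enorm_sqr {3}/p dotBr dotZr px mulr0 subr0.
have ux : dot (normalize p) x = 0 by rewrite dotZl px mulr0.
have [z [Sz [_ h]]] := key _ (enorm_normalize p0) ux; exists z; split=> //; rewrite sl.
apply: le_trans h; apply: lmul.
by rewrite dotZl pnu expr2 mulKf ?enorm_eq0// ger0_norm// enorm_ge0.
Qed.

(** Both numbers are of the order of s / r: theta <= 3 s / (2 r) from the
    tangent plane and beta >= s / (16 r), whence the constant 24. *)
Lemma sphere_fine_set r : (0 < m)%N -> 0 < r -> fine_set m (esphere (0 : 'rV[R]_m.+1) r).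
Proof.
move=> m0 r0; split; first exact: sphere_compact.
exists (line_measure_bound (R := R) (m := m) / 4 ^+ m), 24; split.
- by rewrite divr_gt0 ?line_measure_bound_gt0 ?exprn_gt0.
- by lra.
move=> x s Sx s0 sd; have sr : s <= 2 * r.
  rewrite -lee_fin; apply: le_trans sd _; apply: ediam_le => y z.
  rewrite /esphere /= !subr0 => yr zr; apply: le_trans (ler_enormB _ _) _.
  by rewrite yr zr; lra.
split; first exact: sphere_density.
have x0 : x != 0 by rewrite -enorm_gt0; move: Sx; rewrite /esphere /= subr0 => ->.
have th : (theta_number m (esphere 0 r) x s <= (3 / 2 * s / r)%:E)%E.
  rewrite /theta_number -lee_pdivlMl ?invr_gt0// invrK.
  apply: le_trans (ereal_inf_lbound _) _.
    by exists (hyperplane x) => //; exact: hyperplane_grassmannian.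
  apply: le_trans (sphere_hausdorff_dist r0 Sx s0 sr) _.
  by rewrite -EFinM lee_fin le_eqVlt; apply/orP; left; apply/eqP; field; rewrite gt_eqF.
apply: le_trans th _.
have be : ((s / (16 * r))%:E <= beta_number m (esphere 0 r) x s)%E.
  rewrite /beta_number lee_pdivlMl//.
  apply: le_ereal_inf_tmp => _ [L /(grassmannianP (ltn0Sn m))[nu [nu1 ->]] <-].
  have [z [[Sz zx] zn]] := sphere_beta_lower m0 r0 Sx s0 sr nu1.
  apply: (@le_trans _ _ (edist z (affine x (hyperplane nu)))%:E).
    rewrite -EFinM lee_fin edist_hyperplane//; apply: le_trans zn.
    by rewrite le_eqVlt; apply/orP; left; apply/eqP; field; rewrite gt_eqF.
  by apply: ereal_sup_ubound; exists z.
apply: (@le_trans _ _ (24%:E * (s / (16 * r))%:E)%E); last by rewrite lee_wpmul2l.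
by rewrite -EFinM lee_fin le_eqVlt; apply/orP; left; apply/eqP; field; rewrite gt_eqF.
Qed.

End sphere_fine.

(** * C^1-hypersurfaces *)

Section C1_hypersurfaces.
Context {R : realType} {n : nat}.
Implicit Types (x y z v w u h g nu : 'rV[R]_n) (S U V : set 'rV[R]_n).
Implicit Types (Phi Psi : 'rV[R]_n -> 'rV[R]_n).

Lemma differentiable_first_order Phi x : differentiable Phi x ->
  forall e : R, 0 < e -> exists d : R, 0 < d /\
    forall h, enorm h < d -> enorm (Phi (x + h) - Phi x - 'd Phi x h) <= e * enorm h.
Proof.
move=> dPhi e e0; have n0 : 0 < n.+1%:R :> R by [].
have /diff_locally/eqaddoP/(_ (e / n.+1%:R) (divr_gt0 e0 n0)) := dPhi.
move=> /nbhs_eballP[d [d0 dP]]; exists d; split=> // h hd.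
have /dP : eball 0 d h by rewrite /eball /= subr0.
rewrite /= => h1; apply: le_trans (ler_enorm_norm _) _.
have {}h1 : `|Phi (x + h) - Phi x - 'd Phi x h| <= e / n.+1%:R * enorm h.
  move: h1; rewrite !fctE /= opprD addrA [h + x]addrC => /le_trans; apply.
  by rewrite ler_wpM2l ?ler_norm_enorm// divr_ge0// ltW.
apply: (@le_trans _ _ (n%:R * (e / n.+1%:R * enorm h))); first by rewrite ler_wpM2l.
rewrite mulrA ler_wpM2r ?enorm_ge0// mulrCA ler_piMr ?(ltW e0)//.
by rewrite ler_pdivrMr// mul1r ler_nat.
Qed.

(** The normal of S at x in the chart Phi: the transpose of the derivative of
    Phi, applied to g ([dot_diff_normal]). *)
Definition diff_normal Phi x g : 'rV[R]_n := \row_j dot ('d Phi x (delta_mx 0 j)) g.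

Lemma dot_diff_normal Phi x g v : dot v (diff_normal Phi x g) = dot ('d Phi x v) g.
Proof.
rewrite [in RHS](row_sum_delta v) linear_sum -[RHS]/(dotr g _) linear_sum.
apply: eq_bigr => j _; rewrite mxE /dotr -dotZl; congr (dot _ _).
by rewrite linearZ.
Qed.

(** The defining function dot (Phi _) g of S is linear up to a small error. *)
Lemma flattening_first_order S U V Phi Psi g x : flattening S U V Phi Psi g ->
  differentiable Phi x -> S x -> U x ->
  forall e : R, 0 < e -> exists d : R, 0 < d /\ eball x d `<=` U /\
    forall h, enorm h < d ->
      `|dot (Phi (x + h)) g - dot h (diff_normal Phi x g)| <= e * enorm h.
Proof.
move=> [[oU _] _ _ g0 SP] dPhi Sx Ux e e0.
have g1 : 0 < enorm g by rewrite enorm_gt0.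
have [d1 [d10 d1P]] := differentiable_first_order dPhi (divr_gt0 e0 g1).
have [d2 [d20 d2P]] := oU x Ux.
exists (Num.min d1 d2); split; first by rewrite lt_min d10.
split; first by apply: subset_trans d2P; apply: eballW; rewrite ge_min lexx orbT.
move=> h; rewrite lt_min => /andP[h1 _].
have /(SP x Ux) Px := Sx.
have -> : dot (Phi (x + h)) g - dot h (diff_normal Phi x g) =
    dot (Phi (x + h) - Phi x - 'd Phi x h) g.
  by rewrite dot_diff_normal (dotBl (Phi (x + h) - Phi x)) (dotBl (Phi (x + h))) Px subr0.
apply: le_trans (cauchy_schwarz _ _) _.
apply: (@le_trans _ _ (e / enorm g * enorm h * enorm g)); first by rewrite ler_wpM2r ?enorm_ge0// d1P.
by rewrite mulrAC divfK// gt_eqF.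
Qed.

(** The derivative of Phi is onto because Phi has a differentiable inverse. *)
Lemma diff_normal_neq0 S U V Phi Psi g x : flattening S U V Phi Psi g -> U x ->
  differentiable Phi x -> differentiable Psi (Phi x) -> diff_normal Phi x g != 0.
Proof.
move=> [[oU oV] PhiP PsiP g0 SP] Ux dPhi dPsi.
have [Vz Kx _] := PhiP x Ux.
have dPhi' : differentiable Phi (Psi (Phi x)) by rewrite Kx.
have E : 'd Phi x ('d Psi (Phi x) g) = g.
  pose D p u : 'rV[R]_n := 'd Phi p u.
  have DK u : D x u = D (Psi (Phi x)) u by rewrite Kx.
  rewrite -/(D x _) DK.
  have := congr1 (fun F : 'rV[R]_n -> 'rV[R]_n => F g) (diff_comp dPsi dPhi').
  rewrite -[X in _ = X]/(D (Psi (Phi x)) ('d Psi (Phi x) g)) => <-.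
  rewrite -(deriveE g (differentiable_comp dPsi dPhi')).
  rewrite -[RHS](derive_id (Phi x) g); apply: near_eq_derive => //.
  apply/nbhs_eballP; have [d [d0 dP]] := oV _ Vz; exists d; split=> // z /dP Vz'.
  by have [_ ] := PsiP z Vz'.
apply: contraNneq g0 => G0.
by rewrite -dot_eq0 -{1}E -dot_diff_normal G0 dot0r.
Qed.

(** The defining function vanishes along a curve in S. *)
Lemma flattening_tangent_space S U V Phi Psi g x : flattening S U V Phi Psi g ->
  differentiable Phi x -> S x -> U x ->
  tangent_space S x `<=` hyperplane (diff_normal Phi x g).
Proof.
move=> flat dPhi Sx Ux v [c [e [e0 c0 cv cP]]]; rewrite /hyperplane /=.
set G := diff_normal Phi x g.
have [S0 dc _] := cP 0 ltac:(by rewrite normr0).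
have [_ _ _ _ SP] := flat.
pose K := enorm v + 1 + enorm G.
apply: (@small_zero _ _ K); first by rewrite !addr_ge0 ?enorm_ge0.
move=> h h0; pose h' := Num.min h 1; have h'0 : 0 < h' by rewrite lt_min h0 ltr01.
have h'h : h' <= h by rewrite ge_min lexx.
have h'1 : h' <= 1 by rewrite ge_min lexx orbT.
have [d1 [d10 d1P]] := velocityP c0 dc cv h'0.
have [d2 [d20 [d2U d2P]]] := flattening_first_order flat dPhi Sx Ux h'0.
have v1 : 0 < enorm v + 1 by rewrite ltr_wpDl ?enorm_ge0.
pose M := Num.min (Num.min e d1) (d2 / (enorm v + 1)).
have M0 : 0 < M by rewrite !lt_min e0 d10 divr_gt0.
pose t := M / 2; have t0 : 0 < t by rewrite divr_gt0.
have : t < M by rewrite /t; lra.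
rewrite !lt_min => /andP[/andP[te td1]]; rewrite ltr_pdivlMr// => td2.
have := d1P t; rewrite gtr0_norm// => /(_ td1) ht.
have [St _ _] := cP t ltac:(by rewrite gtr0_norm).
have ct : enorm (c t - x) <= (enorm v + 1) * t.
  have -> : c t - x = (c t - x - t *: v) + t *: v by rewrite subrK.
  apply: le_trans (ler_enormD _ _) _; rewrite enormZ gtr0_norm//.
  have : h' * t <= 1 * t by rewrite ler_pM2r.
  lra.
have ctd : enorm (c t - x) < d2 by apply: le_lt_trans ct _; rewrite mulrC.
have Uc : U (c t) by apply: d2U.
have := d2P _ ctd; rewrite [x + _]addrC subrK.
have /(SP _ Uc) -> := St; rewrite sub0r normrN => a1.
have vG : t * dot v G = dot (c t - x) G - dot (c t - x - t *: v) G.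
  by rewrite (dotBl (c t - x)) dotZl; ring.
have a2 : `|dot (c t - x - t *: v) G| <= h' * t * enorm G.
  by apply: le_trans (cauchy_schwarz _ _) _; rewrite ler_wpM2r ?enorm_ge0.
have a3 : `|t * dot v G| <= h' * ((enorm v + 1) * t) + h' * t * enorm G.
  rewrite vG (le_trans (ler_normB _ _))// lerD//; apply: le_trans a1 _.
  by rewrite ler_pM2l.
move: a3; rewrite normrM gtr0_norm// => a3.
rewrite -(ler_pM2l t0); apply: le_trans a3 _.
have -> : h' * ((enorm v + 1) * t) + h' * t * enorm G = t * (K * h') by rewrite /K; ring.
by rewrite ler_pM2l// ler_wpM2l// !addr_ge0 ?enorm_ge0.
Qed.

(** To first order the defining function equals t |G| at x + t nu and - t |G| at
    x - t nu. *)
Lemma flattening_crossing S U V Phi Psi g x : flattening S U V Phi Psi g ->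
  differentiable Phi x -> S x -> U x -> diff_normal Phi x g != 0 ->
  let nu := normalize (diff_normal Phi x g) in
  forall d : R, 0 < d -> exists t, 0 < t < d /\
     dot (Phi (x + t *: nu)) g * dot (Phi (x - t *: nu)) g < 0.
Proof.
move=> flat dPhi Sx Ux; set G := diff_normal Phi x g => G0 nu d d0.
have g1 : 0 < enorm G by rewrite enorm_gt0.
have e0 : 0 < enorm G / 2 by rewrite divr_gt0.
have [d1 [d10 [d1U d1P]]] := flattening_first_order flat dPhi Sx Ux e0.
have m0 : 0 < Num.min d d1 by rewrite lt_min d0.
pose t := Num.min d d1 / 2; have t0 : 0 < t by rewrite divr_gt0.
have : t < Num.min d d1 by rewrite /t; lra.
rewrite lt_min => /andP[td td1]; exists t; split; first by rewrite t0.
have nu1 : enorm nu = 1 by exact: enorm_normalize.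
have nuG : dot nu G = enorm G.
  by rewrite /nu /normalize dotZl -enorm_sqr expr2 mulKf// gt_eqF.
have tn : enorm (t *: nu) = t by rewrite enormZ nu1 mulr1 gtr0_norm.
have := d1P (t *: nu); rewrite tn => /(_ td1).
have := d1P (- (t *: nu)); rewrite enormN tn => /(_ td1).
rewrite -/G dotNl dotZl nuG opprK !ler_norml => /andP[a1 a2] /andP[b1 b2].
have tG : 0 < t * enorm G by rewrite mulr_gt0.
rewrite pmulr_rlt0; lra.
Qed.

End C1_hypersurfaces.

Section C1_enclosure.
Context {R : realType} {m : nat}.
Implicit Types (x : 'rV[R]_m.+1) (S : set 'rV[R]_m.+1).

Lemma C1_flattening S x : C1_submanifold m S -> S x ->
  exists U V Phi Psi g, [/\ U x, flattening S U V Phi Psi g,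
    differentiable Phi x & differentiable Psi (Phi x)].
Proof.
move=> CS Sx; have [U [V [L [Phi [Psi [[oU oV Ux] [cPhi cPsi] [UV VU] GL img]]]]]] := CS x Sx.
have [g [g1 LE]] := grassmannianP (ltn0Sn m) GL.
exists U, V, Phi, Psi, g; split=> //.
- exact: (flattening_of_C1 oU oV cPhi cPsi UV VU (unit_neq0 g1) LE img).
- by have [] := cPhi x Ux.
- by have [] := cPsi _ (UV x Ux).1.
Qed.

Lemma C1_locally_flat S : C1_submanifold m S -> locally_flat S.
Proof.
move=> CS x Sx; have [U [V [Phi [Psi [g [Ux flat _ _]]]]]] := C1_flattening CS Sx.
by exists U, V, Phi, Psi, g.
Qed.

Lemma tangent_space_neq0 S x : S x -> tangent_space S x !=set0.
Proof.
move=> Sx; exists 0; exists (cst x), 1; split=> //.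
  by rewrite derive1_cst.
move=> t _; split=> //.
have -> : derive1 (cst x : R -> 'rV[R]_m.+1) = cst 0 by apply/funext => s; rewrite derive1_cst.
exact: cvg_cst.
Qed.

(** [Ktp_tangent_ball] and [flattening_crossing] for the normal of the chart
    are the hypotheses of [tangent_ball_enclosed]. *)
Lemma C1_enclosure S x (r : R) : (0 < m)%N -> compact_C1_hypersurface S -> S x -> 0 < r ->
  (Ktp S (tangent_space S) x <= (r^-1)%:E)%E -> exists c, encloses S c r.
Proof.
move=> m0 [cS CS] Sx r0 Kr.
have [U [V [Phi [Psi [g [Ux flat dPhi dPsi]]]]]] := C1_flattening CS Sx.
have G0 := diff_normal_neq0 flat Ux dPhi dPsi.
apply: (tangent_ball_enclosed (n := m.+1) m0 cS (C1_locally_flat CS) Sx (enorm_normalize G0) r0 _ Ux flat).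
  apply: (Ktp_tangent_ball (enorm_normalize G0) (tangent_space_neq0 Sx) _ r0 Kr).
  by rewrite hyperplane_normalize//; exact: (flattening_tangent_space flat).
exact: (flattening_crossing flat dPhi Sx Ux G0).
Qed.

End C1_enclosure.

(** * Sets flat at all scales are Lipschitz graphs *)

Section reifenberg_graph.
Context {R : realType} {n : nat}.
Implicit Types (x y z u v w : 'rV[R]_n) (s t d : R).

(** Inside the ball of radius s about x, the set S and the hyperplane through x
    normal to nu are eta s close, in both directions. *)
Definition flat_at (S : set 'rV[R]_n) x s (eta : R) (nu : 'rV[R]_n) :=
  [/\ enorm nu = 1,
      forall y, S y -> enorm (y - x) <= s -> `|dot (y - x) nu| <= eta * s &
      forall w, dot w nu = 0 -> enorm w <= s ->
        exists y, [/\ S y, enorm (y - x) <= s & enorm (y - (x + w)) <= eta * s]].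

(** The sine of the angle between the hyperplanes normal to nu and to e is at
    most t.  In this form the bound is insensitive to the sign of the
    normals. *)
Definition tilt_le (nu e : 'rV[R]_n) t := forall u, dot u nu = 0 -> `|dot u e| <= t * enorm u.

Definition proj (e : 'rV[R]_n) v := v - dot v e *: e.

Lemma dot_proj (e v : 'rV[R]_n) : enorm e = 1 -> dot (proj e v) e = 0.
Proof. by move=> e1; rewrite /proj dotBl dotZl dot_unit// mulr1 subrr. Qed.

Lemma projD (e u v : 'rV[R]_n) : proj e (u + v) = proj e u + proj e v.
Proof. by rewrite /proj dotDl; apply/rowP => i; rewrite !mxE; ring. Qed.

Lemma projZ (e v : 'rV[R]_n) t : proj e (t *: v) = t *: proj e v.
Proof. by rewrite /proj dotZl; apply/rowP => i; rewrite !mxE; ring. Qed.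

Lemma projB (e u v : 'rV[R]_n) : proj e (u - v) = proj e u - proj e v.
Proof. by rewrite projD -scaleN1r projZ scaleN1r. Qed.

Lemma proj_id (e v : 'rV[R]_n) : dot v e = 0 -> proj e v = v.
Proof. by rewrite /proj => ->; rewrite scale0r subr0. Qed.

Lemma proj_axis (e : 'rV[R]_n) t : enorm e = 1 -> proj e (t *: e) = 0.
Proof. by move=> e1; rewrite /proj dotZl dot_unit// mulr1 subrr. Qed.

Lemma projE (e v : 'rV[R]_n) : v = proj e v + dot v e *: e.
Proof. by rewrite /proj subrK. Qed.

Lemma enorm_proj_sqr (e v : 'rV[R]_n) : enorm e = 1 ->
  enorm (proj e v) ^+ 2 = enorm v ^+ 2 - dot v e ^+ 2.
Proof. by move=> e1; rewrite /proj enorm_subZ_sqr e1; ring. Qed.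

Lemma enorm_proj_le (e v : 'rV[R]_n) : enorm e = 1 -> enorm (proj e v) <= enorm v.
Proof.
move=> e1; rewrite -(@ler_pXn2r _ 2)// ?nnegrE ?enorm_ge0// enorm_proj_sqr//.
by rewrite lerBlDr lerDl sqr_ge0.
Qed.

Lemma enorm_le_proj (e v : 'rV[R]_n) : enorm e = 1 ->
  enorm v <= enorm (proj e v) + `|dot v e|.
Proof.
move=> e1; rewrite {1}(projE e v); apply: le_trans (ler_enormD _ _) _.
by rewrite enormZ e1 mulr1.
Qed.

(** Split u along nu and its orthogonal hyperplane. *)
Lemma tilt_dot (nu e : 'rV[R]_n) t u : enorm nu = 1 -> enorm e = 1 -> 0 <= t ->
  tilt_le nu e t -> `|dot u e| <= `|dot u nu| + t * enorm u.
Proof.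
move=> nu1 e1 t0 T; rewrite {1}(projE nu u) dotDl dotZl.
apply: le_trans (ler_normD _ _) _; rewrite addrC lerD//.
  rewrite normrM ler_piMr//.
  by apply: le_trans (cauchy_schwarz _ _) _; rewrite nu1 e1 mulr1.
apply: le_trans (T _ _) _; first exact: dot_proj.
by rewrite ler_wpM2l// enorm_proj_le.
Qed.

(* the normal nu x k describes S near x at the scale s0 / 2^k *)
Context (S : set 'rV[R]_n) (s0 : R) (eta : nat -> R) (nu : 'rV[R]_n -> nat -> 'rV[R]_n).
Context (s00 : 0 < s0) (eta_ge0 : forall k, 0 <= eta k).
Context (eta_sum : forall k, \sum_(j < k) eta j <= 1 / 64).

Let sc k : R := s0 / 2 ^+ k.

Context (flat : forall x k, S x -> flat_at S x (sc k) (eta k) (nu x k)).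
Context (x0 : 'rV[R]_n) (Sx0 : S x0) (cS : compact S).

Let e := nu x0 0.

Let sc_gt0 k : 0 < sc k.
Proof. by rewrite divr_gt0// exprn_gt0. Qed.

Let scS k : sc k = 2 * sc k.+1.
Proof. by rewrite /sc exprS; field; rewrite expf_neq0. Qed.

Let sc0 : sc 0 = s0. Proof. by rewrite /sc expr0 divr1. Qed.

Let e1 : enorm e = 1. Proof. by have [] := flat 0 Sx0. Qed.

Let eta_small k : eta k <= 1 / 64.
Proof.
apply: le_trans (eta_sum k.+1); rewrite big_ord_recr /= lerDr.
by apply: sumr_ge0 => j _.
Qed.

Let tilt_bound k := 4 * \sum_(j < k) eta j + eta k.

Let tilt_bound_ge0 k : 0 <= tilt_bound k.
Proof. by rewrite addr_ge0// mulr_ge0// sumr_ge0. Qed.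

Let tilt_bound_le k : tilt_bound k <= 1 / 16.
Proof.
have := eta_sum k.+1; rewrite big_ord_recr /= /tilt_bound.
by have := eta_ge0 k; lra.
Qed.

(** To bound the angle between two planes it suffices to test on S: a unit
    vector of the plane of y is realized at scale sc k, up to eta k, by a point
    z of S. *)
Let tilt_test y k (f : 'rV[R]_n) (c : R) : S y ->
  (forall z, S z -> enorm (z - y) <= sc k -> `|dot (z - y) f| <= c * sc k) ->
  enorm f = 1 -> tilt_le (nu y k) f (c + eta k).
Proof.
move=> Sy zc f1 u unu; have [->|u0] := eqVneq u 0.
  by rewrite dot0l normr0 enorm0 mulr0.
have u1 : 0 < enorm u by rewrite enorm_gt0.
have [_ _ /(_ (sc k *: normalize u))] := flat k Sy.
rewrite dotZl /normalize dotZl unu !mulr0 -/(normalize u) => /(_ erefl).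
rewrite enormZ enorm_normalize// mulr1 gtr0_norm// => /(_ (lexx _))[z [Sz zy zw]].
have h1 := zc z Sz zy.
have h2 : `|dot (z - (y + sc k *: normalize u)) f| <= eta k * sc k.
  by apply: le_trans (cauchy_schwarz _ _) _; rewrite f1 mulr1.
have h3 : sc k * `|dot (normalize u) f| <= (c + eta k) * sc k.
  rewrite -[X in X * _](gtr0_norm (sc_gt0 k)) -normrM mulrDl.
  have -> : sc k * dot (normalize u) f = dot (z - y) f - dot (z - (y + sc k *: normalize u)) f.
    by rewrite !dotE; ring.
  by apply: le_trans (ler_normB _ _) _; rewrite lerD.
rewrite mulrC ler_pM2r// in h3.
rewrite -{1}(normalizeK u0) dotZl normrM gtr0_norm// mulrC.
by rewrite ler_wpM2r// ltW.
Qed.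

(** The planes at two consecutive scales are both close to S on the ball of the
    finer scale, so the sine of their angle is at most
    2 eta k+1 + eta k+2; the first step also moves the centre from x0 to y.
    Summing over the scales, every plane at y is at an angle with sine at most
    1/16 from the plane of x0 at the scale s0. *)
Let tilt y k : S y -> enorm (y - x0) <= s0 / 2 -> tilt_le (nu y k.+1) e (tilt_bound k.+1).
Proof.
move=> Sy yx0; elim: k => [|k IH].
  rewrite /tilt_bound big_ord1; apply: tilt_test => // z Sz zy.
  have sc1 : sc 1 = s0 / 2 by rewrite /sc expr1.
  rewrite sc1 in zy *.
  have zx0 : enorm (z - x0) <= sc 0.
    by have := enorm_triangle y z x0; rewrite sc0; lra.
  have yx0' : enorm (y - x0) <= sc 0 by rewrite sc0; have := s00; lra.
  have [_ f _] := flat 0 Sx0; have := f z Sz zx0; have := f y Sy yx0'; rewrite -/e sc0.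
  have -> : dot (z - y) e = dot (z - x0) e - dot (y - x0) e by rewrite !dotE; ring.
  move=> a b; apply: le_trans (ler_normB _ _) _; lra.
have [nu1 f _] := flat k.+1 Sy; have [nu2 _ _] := flat k.+2 Sy.
have T2 : tilt_le (nu y k.+2) (nu y k.+1) (2 * eta k.+1 + eta k.+2).
  apply: tilt_test => // z Sz zy.
  have h : enorm (z - y) <= sc k.+1 by rewrite scS; have := sc_gt0 k.+2; lra.
  by apply: le_trans (f z Sz h) _; rewrite scS; lra.
move=> u unu; have h1 := T2 u unu; have := tilt_dot u nu1 e1 (tilt_bound_ge0 k.+1) IH.
move=> h2; apply: le_trans h2 _; apply: le_trans (lerD h1 (lexx _)) _.
rewrite -mulrDl ler_wpM2r ?enorm_ge0// /tilt_bound [in leRHS]big_ord_recr /=.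
have := eta_ge0 k.+1; lra.
Qed.

Let dyadic d : 0 < d -> d <= sc 1 -> exists k, sc k.+2 < d <= sc k.+1.
Proof.
move=> d0 d1; have ex : exists k, sc k.+2 < d.
  pose k := Num.bound (s0 / d); exists k.
  have := archi_boundP (ltW (divr_gt0 s00 d0)); rewrite -/k => h.
  rewrite /sc ltr_pdivrMr ?exprn_gt0// mulrC -ltr_pdivrMr//; apply: lt_le_trans h _.
  rewrite -natrX ler_nat; apply: leq_trans (ltnW (ltn_expl k (ltnSn 1))) _.
  by rewrite leq_exp2l// -addn2 leq_addr.
case: (ex_minnP ex) => k kd kmin; exists k; rewrite kd /=.
case: k kd kmin => [//|k] kd kmin; rewrite leNgt; apply/negP => h.
by have := kmin k h; rewrite ltnn.
Qed.

(** Look at the scale just larger than |z - y|: the plane of y at that scale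
    almost contains z - y and is hardly tilted against e. *)
Let cone y z : S y -> S z -> enorm (y - x0) <= s0 / 2 -> enorm (z - y) <= s0 / 2 ->
  `|dot (z - y) e| <= enorm (z - y) / 4.
Proof.
move=> Sy Sz yx0 zy; have [->|zy0] := eqVneq z y.
  by rewrite subrr dot0l normr0 enorm0 mul0r.
have d0 : 0 < enorm (z - y) by rewrite enorm_gt0 subr_eq0.
have d1 : enorm (z - y) <= sc 1 by rewrite /sc expr1.
have [k /andP[dk kd]] := dyadic d0 d1.
have [nu1 f _] := flat k.+1 Sy; have h1 := f z Sz kd.
apply: le_trans (tilt_dot _ nu1 e1 (tilt_bound_ge0 k.+1) (tilt Sy yx0)) _.
have h2 : eta k.+1 * sc k.+1 <= 1 / 64 * sc k.+1 by rewrite ler_wpM2r// ltW.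
have h3 : tilt_bound k.+1 * enorm (z - y) <= 1 / 16 * enorm (z - y) by rewrite ler_pM2r.
by have := scS k.+1; lra.
Qed.

Let near_x0 y : S y -> enorm (y - x0) <= s0 / 2 ->
  enorm (y - x0) <= 4 / 3 * enorm (proj e (y - x0)).
Proof.
move=> Sy yx0; have h0 : enorm (x0 - x0) <= s0 / 2 by rewrite subrr enorm0 divr_ge0// ltW.
have := cone Sx0 Sy h0 yx0; have := enorm_le_proj (y - x0) e1; lra.
Qed.

(** Over each point w of the base plane there is a point of S.  Take y in S
    whose projection is closest to w, at distance d, and suppose d > 0.  At the
    scale of d the plane of y is close to S, so S has a point y' near
    y + d u0, where u0 points from the projection of y to w; its projection is
    closer to w than that of y. *)
Let surj w : dot w e = 0 -> enorm w < s0 / 16 ->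
  exists y, [/\ S y, enorm (y - x0) <= s0 / 4 & proj e (y - x0) = w].
Proof.
move=> we ws; pose K := S `&` ecball x0 (s0 / 4).
have s04 : 0 <= s0 / 4 by rewrite divr_ge0// ltW.
have cK : compact K.
  apply: (subclosed_compact _ cS) => [|y [] //].
  rewrite -openC; apply/eopen_open => y nKy; have [Sy|Sy] := pselect (S y); last first.
    have [r [r0 rP]] := compact_eclosed cS Sy.
    by exists r; split=> // z /rP Sz [].
  have yx : s0 / 4 < enorm (y - x0) by rewrite ltNge; apply/negP => h; apply: nKy.
  exists (enorm (y - x0) - s0 / 4); split; first by rewrite subr_gt0.
  move=> z; rewrite /eball /= => zy [_]; rewrite /ecball /= => zx.
  by have := enorm_triangle z y x0; rewrite (enormBC y z); lra.
pose F y := enorm (proj e (y - x0) - w).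
have Fc : {within K, continuous F}.
  apply: continuous_subspaceT => y; apply/continuous_at_eball => r r0; exists r; split=> // z zy.
  apply: le_lt_trans (ler_dist_enorm _ _) _.
  have -> : proj e (y - x0) - w - (proj e (z - x0) - w) = proj e (y - z).
    by rewrite !projB; apply/rowP => i; rewrite !mxE; ring.
  by apply: le_lt_trans (enorm_proj_le _ e1) _; rewrite enormBC.
have K0 : K x0 by split=> //; rewrite /ecball /= subrr enorm0.
have [y Ky ymin] : exists2 y, K y & forall z, K z -> F y <= F z.
  have [y /set_mem Ky yP] := @EVT_min_rV R n F K (ex_intro _ x0 K0) cK Fc.
  by exists y => // z Kz; apply: yP; exact: mem_set.
have [Sy yx0] := Ky; have {}yx0 : enorm (y - x0) <= s0 / 4 := yx0.
have [Fy0|Fy0] := eqVneq (F y) 0.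
  exists y; split=> //; apply/eqP; rewrite -subr_eq0 -enorm_eq0; exact/eqP.
(* the minimizer stays well inside the ball of radius s0 / 4, so the
   improved point y' is still in K *)
exfalso; pose d := F y; have d0 : 0 < d by rewrite lt_def Fy0 enorm_ge0.
have dw : d <= enorm w.
  have := ymin x0 K0; rewrite /d {2}/F subrr -(scale0r e) proj_axis//.
  by rewrite sub0r enormN.
have py : enorm (proj e (y - x0)) <= enorm w + d.
  have := enorm_triangle w (proj e (y - x0)) 0; rewrite !subr0 /d /F; lra.
have yx2 : enorm (y - x0) <= s0 / 2 by lra.
have yx6 := near_x0 Sy yx2.
have sc1 : sc 1 = s0 / 2 by rewrite /sc expr1.
have d1 : d <= sc 1 by rewrite sc1; lra.
have [k /andP[dk kd]] := dyadic d0 d1.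
have [nu1 f g] := flat k.+1 Sy; set nuk := nu y k.+1 in nu1 f g.
have T : tilt_le nuk e (tilt_bound k.+1) by exact: tilt.
pose u0 := d^-1 *: (w - proj e (y - x0)).
have du0 : d *: u0 = w - proj e (y - x0) by rewrite scalerA divff ?scale1r// gt_eqF.
have u01 : enorm u0 = 1.
  by rewrite enormZ gtr0_norm ?invr_gt0// enormBC -/(F y) -/d mulVf// gt_eqF.
have u0e : dot u0 e = 0 by rewrite dotZl dotBl we dot_proj// subrr mulr0.
have tb := tilt_bound_le k.+1.
(* u0 lies in the base plane and the plane of y is at a small angle *)
have small : `|dot u0 nuk| <= 1 / 8.
  pose u := proj nuk e; pose a := dot e nuk.
  have un : enorm u <= 1 / 16.
    have u_e : dot u e = enorm u ^+ 2.
      rewrite enorm_proj_sqr// e1 /u /proj dotBl dotZl dot_unit// (dotC nuk e).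
      by ring.
    have := T u (dot_proj _ nu1); rewrite u_e ger0_norm ?exprn_ge0 ?enorm_ge0//.
    have [->|u_0] := eqVneq (enorm u) 0; first by move=> _; lra.
    rewrite expr2 ler_pM2r; last by rewrite lt_def u_0 enorm_ge0.
    by move=> h; lra.
  have a2 : 1 / 2 <= `|a|.
    by have := enorm_le_proj e nu1; rewrite e1 -/u -/a; lra.
  have eq0 : dot u0 nuk * a = - dot u0 u.
    have := u0e; rewrite {1}(projE nuk e) -/u -/a dotDr dotZr => h; lra.
  have : `|dot u0 nuk| * `|a| <= 1 / 16.
    rewrite -normrM eq0 normrN; apply: le_trans (cauchy_schwarz _ _) _.
    by rewrite u01 mul1r.
  have : `|dot u0 nuk| * (1 / 2) <= `|dot u0 nuk| * `|a| by rewrite ler_wpM2l.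
  lra.
pose v := proj nuk u0.
have vn : enorm (d *: v) <= sc k.+1.
  rewrite enormZ gtr0_norm//; apply: le_trans kd; rewrite ler_piMr ?(ltW d0)//.
  by rewrite -u01 enorm_proj_le.
have vnu : dot (d *: v) nuk = 0 by rewrite dotZl dot_proj// mulr0.
have [y' [Sy' y'y y'v]] := g _ vnu vn.
have h2 : eta k.+1 * sc k.+1 <= 1 / 64 * sc k.+1 by rewrite ler_wpM2r// ltW.
have y'u : enorm (y' - y - d *: u0) < d / 4.
  have -> : y' - y - d *: u0 = (y' - (y + d *: v)) - (d * dot u0 nuk) *: nuk.
    by rewrite /v /proj; apply/rowP => i; rewrite !mxE; ring.
  apply: le_lt_trans (ler_enormB _ _) _; rewrite enormZ nu1 mulr1 normrM gtr0_norm//.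
  have : d * `|dot u0 nuk| <= d * (1 / 8) by rewrite ler_pM2l.
  by have := scS k.+1; lra.
have Fy' : F y' < d.
  rewrite /F; have -> : proj e (y' - x0) - w = proj e (y' - y - d *: u0).
    have -> : y' - x0 = (y' - y) + (y - x0) by rewrite addrA subrK.
    rewrite projD [in RHS]projB projZ (proj_id u0e) du0.
    by apply/rowP => i; rewrite !mxE; ring.
  apply: le_lt_trans (enorm_proj_le _ e1) _; apply: lt_trans y'u _.
  by lra.
have Ky' : K y'.
  split=> //; rewrite /ecball /=.
  have y'y2 : enorm (y' - y) <= d + d / 4.
    have -> : y' - y = (y' - y - d *: u0) + d *: u0 by rewrite subrK.
    apply: le_trans (ler_enormD _ _) _; rewrite enormZ u01 mulr1 gtr0_norm//.
    by lra.
  have := enorm_triangle y y' x0; lra.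
by have := ymin y' Ky'; rewrite leNgt Fy'.
Qed.

(** By the cone condition, S is a graph over its projection. *)
Let inj y z : S y -> S z -> enorm (y - x0) <= s0 / 4 -> enorm (z - x0) <= s0 / 4 ->
  enorm (z - y) <= 4 / 3 * enorm (proj e (z - y)).
Proof.
move=> Sy Sz yx zx; have zy : enorm (z - y) <= s0 / 2.
  by have := enorm_triangle x0 z y; rewrite (enormBC x0 y); lra.
have yx2 : enorm (y - x0) <= s0 / 2 by have := s00; lra.
have := cone Sy Sz yx2 zy; have := enorm_le_proj (z - y) e1; lra.
Qed.

(** By [surj] and [inj], S is near x0 the graph over the base plane of a
    function h, which is Lipschitz of constant 1/3 by the cone condition; the
    shear subtracting h flattens S.  For the last clause, let f be the normal of
    two balls touching S at x0 and a the cosine of its angle with e.  The point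
    of S above the projection of x0 + q f is within t of the tangent plane, with
    t = |q|, since the touching condition is quadratic; so the height over the
    graph of x0 + q f, multiplied by a, has the sign of q.  The case a = 0 is
    excluded by the same estimate. *)
Lemma reifenberg_flattening : exists U V Phi Psi g,
  [/\ U x0, flattening S U V Phi Psi g &
   forall f (r : R), enorm f = 1 -> 0 < r ->
    (forall y, S y -> `|dot (y - x0) f| * (2 * r) <= enorm (y - x0) ^+ 2) ->
    forall d : R, 0 < d -> exists t, 0 < t < d /\
     dot (Phi (x0 + t *: f)) g * dot (Phi (x0 - t *: f)) g < 0].
Proof.
pose rho := s0 / 16; have rho0 : 0 < rho by rewrite divr_gt0.
have [Y YP] : exists Y : 'rV[R]_n -> 'rV[R]_n, forall w, dot w e = 0 -> enorm w < rho ->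
    [/\ S (Y w), enorm (Y w - x0) <= s0 / 4 & proj e (Y w - x0) = w].
  have ex w : exists y, dot w e = 0 -> enorm w < rho ->
      [/\ S y, enorm (y - x0) <= s0 / 4 & proj e (y - x0) = w].
    have [[we wr]|nw] := pselect (dot w e = 0 /\ enorm w < rho).
      by have [y yP] := surj we wr; exists y.
    by exists x0 => we wr; case: nw.
  by have [Y YP] := choice ex; exists Y.
pose h w := dot (Y w - x0) e.
pose D w := dot w e = 0 /\ enorm w < rho.
have YE w : D w -> Y w = x0 + (w + h w *: e).
  move=> [we wr]; have [_ _ pw] := YP w we wr.
  have E := projE e (Y w - x0); rewrite pw -/(h w) in E.
  by rewrite -E addrC subrK.
have hL w w' : D w -> D w' -> `|h w - h w'| <= enorm (w - w') / 3.
  move=> Dw Dw'; have [Sy yx yw] := YP w Dw.1 Dw.2; have [Sy' yx' yw'] := YP w' Dw'.1 Dw'.2.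
  have i := inj Sy' Sy yx' yx.
  have pw : proj e (Y w - Y w') = w - w'.
    by rewrite -[in RHS]yw -[in RHS]yw' -projB; congr proj; apply/rowP => j; rewrite !mxE; ring.
  rewrite pw in i.
  have Y4 : enorm (Y w - Y w') <= s0 / 2.
    by have := enorm_triangle x0 (Y w) (Y w'); rewrite (enormBC x0 (Y w')); lra.
  have yx2 : enorm (Y w' - x0) <= s0 / 2 by have := s00; lra.
  have := cone Sy' Sy yx2 Y4.
  have -> : dot (Y w - Y w') e = h w - h w' by rewrite /h !dotE; ring.
  lra.
have D0 : D 0 by split; rewrite ?dot0l ?enorm0.
have S4 y : S y -> enorm (y - x0) <= s0 / 4 -> D (proj e (y - x0)) ->
    dot (y - x0) e = h (proj e (y - x0)).
  move=> Sy yx Dy; have [Sz zx zw] := YP _ Dy.1 Dy.2.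
  have := inj Sz Sy zx yx.
  have -> : y - Y (proj e (y - x0)) = (y - x0) - (Y (proj e (y - x0)) - x0).
    by apply/rowP => j; rewrite !mxE; ring.
  rewrite (projB e (y - x0)) zw subrr enorm0 mulr0 => yz.
  have : y - x0 - (Y (proj e (y - x0)) - x0) = 0.
    by apply/eqP; rewrite -enorm_eq0 eq_le yz enorm_ge0.
  by move/subr0_eq => {1}->.
have h0 : h 0 = 0.
  have xx : enorm (x0 - x0) <= s0 / 4 by rewrite subrr enorm0 divr_ge0// ltW.
  have p0 : proj e (x0 - x0) = 0 by rewrite subrr /proj dot0l scale0r subr0.
  by have := S4 x0 Sx0 xx; rewrite p0 subrr dot0l => /(_ D0) <-.
have hb w : D w -> `|h w| <= enorm w / 3 by move=> Dw; have := hL w 0 Dw D0; rewrite h0 !subr0.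
pose P y := proj e (y - x0).
have Pe y : dot (P y) e = 0 by exact: dot_proj.
have PL y z : enorm (P y - P z) <= enorm (y - z).
  rewrite /P -projB; apply: le_trans (enorm_proj_le _ e1) _.
  by rewrite (_ : y - x0 - (z - x0) = y - z)//; apply/rowP => j; rewrite !mxE; ring.
pose U := [set y | enorm (P y) < rho /\ `|dot (y - x0) e - h (P y)| < rho].
pose V := [set z | enorm (proj e z) < rho /\ `|dot z e| < rho].
pose Phi y := y - x0 - h (P y) *: e.
pose Psi z := x0 + (z + h (proj e z) *: e).
have DP y : enorm (P y) < rho -> D (P y) by [].
have Dp z : enorm (proj e z) < rho -> D (proj e z) by split=> //; exact: dot_proj.
have pPhi y : proj e (Phi y) = P y by rewrite /Phi projB proj_axis// subr0.
have dPhi y : dot (Phi y) e = dot (y - x0) e - h (P y).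
  by rewrite /Phi (dotBl (y - x0)) dotZl dot_unit// mulr1.
have PPsi z : P (Psi z) = proj e z.
  by rewrite /P /Psi addrC addKr projD proj_axis// addr0.
have Ux0 : U x0.
  rewrite /U /= /P subrr (_ : proj e 0 = 0); last by rewrite /proj dot0l scale0r subr0.
  by rewrite enorm0 dot0l h0 subrr normr0.
exists U, V, Phi, Psi, e; split=> //.
  split.
  - split=> [y [Uy1 Uy2]|z [Vz1 Vz2]].
      pose d := Num.min (rho - enorm (P y)) ((rho - `|dot (y - x0) e - h (P y)|) / 2).
      have d0 : 0 < d by rewrite lt_min subr_gt0 Uy1 divr_gt0 ?subr_gt0.
      exists d; split=> // z; rewrite /eball /= lt_min => /andP[zy1 zy2].
      have Pz : enorm (P z) < rho.
        have := enorm_triangle (P y) (P z) 0; rewrite !subr0; have := PL z y; lra.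
      split=> //.
      have := hL _ _ (DP z Pz) (DP y Uy1).
      have a1 : `|dot (z - y) e| <= enorm (z - y).
        by apply: le_trans (cauchy_schwarz _ _) _; rewrite e1 mulr1.
      have -> : dot (z - x0) e - h (P z) =
          (dot (y - x0) e - h (P y)) + (dot (z - y) e - (h (P z) - h (P y))).
        by rewrite !dotE; ring.
      move=> a2; apply: le_lt_trans (ler_normD _ _) _.
      have := ler_normB (dot (z - y) e) (h (P z) - h (P y)).
      have := PL z y; have := enorm_ge0 (z - y); lra.
    pose d := Num.min (rho - enorm (proj e z)) (rho - `|dot z e|).
    have d0 : 0 < d by rewrite lt_min !subr_gt0 Vz1.
    exists d; split=> // y; rewrite /eball /= lt_min => /andP[y1 y2]; split.
      have := enorm_triangle (proj e z) (proj e y) 0; rewrite !subr0 -projB.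
      by have := enorm_proj_le (y - z) e1; lra.
    have a1 : `|dot (y - z) e| <= enorm (y - z).
      by apply: le_trans (cauchy_schwarz _ _) _; rewrite e1 mulr1.
    have -> : dot y e = dot z e + dot (y - z) e by rewrite !dotE; ring.
    apply: le_lt_trans (ler_normD _ _) _; lra.
  - move=> y [Uy1 Uy2]; split.
    + by split; rewrite ?pPhi ?dPhi.
    + by rewrite /Psi pPhi /Phi subrK addrC subrK.
    + move=> r r0; pose d := Num.min (rho - enorm (P y)) (r / 2).
      have d0 : 0 < d by rewrite lt_min subr_gt0 Uy1 divr_gt0.
      exists d; split=> // z; rewrite lt_min => /andP[zy1 zy2].
      have Pz : enorm (P z) < rho.
        have := enorm_triangle (P y) (P z) 0; rewrite !subr0; have := PL z y; lra.
      have := hL _ _ (DP z Pz) (DP y Uy1).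
      have -> : Phi z - Phi y = (z - y) - (h (P z) - h (P y)) *: e.
        by rewrite /Phi; apply/rowP => j; rewrite !mxE; ring.
      move=> a2; apply: le_lt_trans (ler_enormB _ _) _; rewrite enormZ e1 mulr1.
      have := PL z y; lra.
  - move=> z [Vz1 Vz2]; split.
    + split; rewrite PPsi//.
      have -> : dot (Psi z - x0) e = dot z e + h (proj e z).
        by rewrite /Psi addrC addKr dotDl dotZl dot_unit// mulr1.
      by rewrite addrK.
    + by rewrite /Phi PPsi /Psi [x0 + _ - x0]addrC addKr addrK.
    + move=> r r0; pose d := Num.min (rho - enorm (proj e z)) (r / 2).
      have d0 : 0 < d by rewrite lt_min subr_gt0 Vz1 divr_gt0.
      exists d; split=> // y; rewrite lt_min => /andP[zy1 zy2].
      have pL : enorm (proj e y - proj e z) <= enorm (y - z).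
        by rewrite -projB; exact: enorm_proj_le.
      have Py : enorm (proj e y) < rho.
        have := enorm_triangle (proj e z) (proj e y) 0; rewrite !subr0; lra.
      have := hL _ _ (Dp y Py) (Dp z Vz1).
      have -> : Psi y - Psi z = (y - z) + (h (proj e y) - h (proj e z)) *: e.
        by rewrite /Psi; apply/rowP => j; rewrite !mxE; ring.
      move=> a2; apply: le_lt_trans (ler_enormD _ _) _; rewrite enormZ e1 mulr1; lra.
  - exact: unit_neq0.
  - move=> y [Uy1 Uy2]; rewrite dPhi; split=> [Sy|/subr0_eq yh].
      have yx : enorm (y - x0) <= s0 / 4.
        have := enorm_le_proj (y - x0) e1; rewrite -/(P y).
        have := hb _ (DP y Uy1); have := ler_normD (dot (y - x0) e - h (P y)) (h (P y)).
        rewrite subrK; move: Uy1 Uy2; rewrite /rho; have := s00; lra.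
      by rewrite (S4 y)// ?subrr//; exact: DP.
    have [Sz _ _] := YP _ (Pe y) Uy1; move: Sz; rewrite YE; last exact: DP.
    by rewrite -yh /P -projE addrC subrK.
move=> f r f1 r0 tan d d0.
pose a := dot f e.
(* t < r / 2 makes the quadratic error of the touching condition less than t *)
pose t := Num.min (Num.min d rho) (r / 2) / 2.
have m0 : 0 < Num.min (Num.min d rho) (r / 2) by rewrite !lt_min d0 rho0 divr_gt0.
have t0 : 0 < t by rewrite divr_gt0.
have : t < Num.min (Num.min d rho) (r / 2) by rewrite /t; lra.
rewrite !lt_min => /andP[/andP[td tr] trr]; exists t; split; first by rewrite t0.
have key (q : R) : `|q| = t -> exists E : R, `|E| < t /\
    dot (Phi (x0 + q *: f)) e * a = q - E.
  move=> qt; pose w := q *: proj e f.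
  have wn : enorm w <= t.
    by rewrite enormZ qt ler_piMr ?(ltW t0)// -f1 enorm_proj_le.
  have Dw : D w by split; [rewrite dotZl dot_proj// mulr0|exact: le_lt_trans tr].
  have Pq : P (x0 + q *: f) = w by rewrite /P addrC addKr projZ.
  have [Sy yx yw] := YP w Dw.1 Dw.2; have := tan _ Sy.
  have yE : Y w - x0 = w + h w *: e by rewrite YE// addrC addKr.
  rewrite yE; pose E := dot (w + h w *: e) f.
  have hw := hb w Dw.
  have n2 : enorm (w + h w *: e) <= 4 / 3 * t.
    by apply: le_trans (ler_enormD _ _) _; rewrite enormZ e1 mulr1; lra.
  have n3 : enorm (w + h w *: e) ^+ 2 <= (4 / 3 * t) ^+ 2.
    by rewrite lerXn2r ?nnegrE ?enorm_ge0// mulr_ge0 ?(ltW t0).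
  move=> /le_trans/(_ n3); rewrite -/E => n4; exists E; split.
    have n5 : (4 / 3 * t) ^+ 2 < t * (2 * r).
      have : t * t < t * (r / 2) by rewrite ltr_pM2l.
      by have := mulr_gt0 t0 r0; rewrite expr2; lra.
    by have := le_lt_trans n4 n5; rewrite ltr_pM2r// mulr_gt0.
  rewrite dPhi Pq [x0 + _]addrC addrK dotZl -/a.
  (* E is the component along f of the point of the graph *)
  have -> : E = q * (1 - a ^+ 2) + h w * a.
    rewrite /E /w dotDl !dotZl (dotC e f) -/a; congr (q * _ + _).
    by rewrite /proj dotBl dotZl dot_unit// (dotC e f) -/a expr2.
  by ring.
have [E1 [E1t k1]] := key t (gtr0_norm t0).
have [E2 [E2t k2]] := key (- t) (etrans (normrN t) (gtr0_norm t0)).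
rewrite scaleNr in k2; move: E1t E2t; rewrite !ltr_norml => /andP[_ E1t] /andP[E2t _].
set D1 := dot (Phi (x0 + t *: f)) e in k1 *; set D2 := dot (Phi (x0 - t *: f)) e in k2 *.
have p1 : 0 < D1 * a by rewrite k1 subr_gt0.
have p2 : D2 * a < 0 by rewrite k2 subr_lt0.
have : (D1 * D2) * a ^+ 2 < 0.
  have -> : D1 * D2 * a ^+ 2 = (D1 * a) * (D2 * a) by ring.
  by rewrite pmulr_rlt0.
by rewrite pmulr_llt0// exprn_even_gt0//= ; apply: contraTneq p1 => ->; rewrite mulr0 ltxx.
Qed.

End reifenberg_graph.

(** * Fine sets of finite energy *)

Section fine_sets.
Context {R : realType} {m : nat}.
Implicit Types (x y z u v w nu : 'rV[R]_m.+1) (S L : set 'rV[R]_m.+1) (s t b : R).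
Implicit Type H : 'rV[R]_m.+1 -> set 'rV[R]_m.+1.

Local Notation edist := Defs.edist.

Lemma hausdorff_dist_flat S x s nu b : 0 < s -> S x -> enorm nu = 1 ->
  (hausdorff_dist (S `&` ecball x s) (affine x (hyperplane nu) `&` ecball x s) < (b * s)%:E)%E ->
  flat_at S x s b nu.
Proof.
move=> s0 Sx nu1.
have xx : ecball x s x by rewrite /ecball /= subrr enorm0 ltW.
have Px : affine x (hyperplane nu) x.
  by exists 0; rewrite ?addr0// /hyperplane /= dot0l.
rewrite /hausdorff_dist; set A := ereal_sup _; set B := ereal_sup _ => hd.
have A0 : (0 <= A)%E.
  apply: (@le_trans _ _ (edist x (affine x (hyperplane nu) `&` ecball x s))%:E).
    by rewrite lee_fin edist_ge0.
  by apply: ereal_sup_ubound; exists x.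
have B0 : (0 <= B)%E.
  apply: (@le_trans _ _ (edist x (S `&` ecball x s))%:E); first by rewrite lee_fin edist_ge0.
  by apply: ereal_sup_ubound; exists x.
split=> // [y Sy yx|w wnu ws].
  rewrite -lee_fin; apply: le_trans (ltW hd); apply: le_trans (leeDl _ B0).
  apply: (@le_trans _ _ (edist y (affine x (hyperplane nu) `&` ecball x s))%:E); last first.
    by apply: ereal_sup_ubound; exists y.
  rewrite lee_fin; apply: le_edist; first by exists x.
  move=> z [Pz _]; rewrite -(edist_hyperplane x y nu1); exact: edist_le.
have Bw : ((edist (x + w) (S `&` ecball x s))%:E < (b * s)%:E)%E.
  apply: le_lt_trans hd; apply: le_trans (leeDr _ A0).
  apply: ereal_sup_ubound; exists (x + w) => //; split; first by exists w.
  by rewrite /ecball /= addrC addKr.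
have [|y [[Sy yx] yw]] := ex_edist_lt _ Bw; first by exists x.
by exists y; split=> //; rewrite enormBC; exact: ltW.
Qed.

(** A bound b on the distance from S to some hyperplane bounds beta, hence theta
    by fineness; the factor 2 leaves room for a hyperplane almost
    realizing the infimum that defines theta. *)
Lemma theta_le_beta_flat S (M : R) x s b nu : 0 < s -> 0 < M -> 0 < b -> S x ->
  (theta_number m S x s <= M%:E * beta_number m S x s)%E -> enorm nu = 1 ->
  (forall y, S y -> enorm (y - x) < s -> `|dot (y - x) nu| <= b) ->
  exists nu', flat_at S x s (2 * M * b / s) nu'.
Proof.
move=> s0 M0 b0 Sx th nu1 yb.
have be : (beta_number m S x s <= (b / s)%:E)%E.
  rewrite /beta_number mulrC EFinM lee_wpmul2l ?lee_fin ?invr_ge0 ?(ltW s0)//.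
  apply: le_trans (ereal_inf_lbound _) _.
    by exists (hyperplane nu) => //; apply: hyperplane_grassmannian; exact: unit_neq0.
  apply: ge_ereal_sup => _ [y [Sy yx] <-]; rewrite lee_fin edist_hyperplane//.
  exact: yb.
have : (theta_number m S x s <= (M * (b / s))%:E)%E.
  by apply: le_trans th _; rewrite EFinM lee_wpmul2l// lee_fin ltW.
rewrite /theta_number lee_pdivrMl// -EFinM.
have -> : s * (M * (b / s)) = M * b by field; rewrite gt_eqF.
move=> inf_le; have : (ereal_inf [set hausdorff_dist (S `&` ecball x s) (affine x L `&` ecball x s) | L in grassmannian m] < (2 * M * b)%:E)%E.
  apply: le_lt_trans inf_le _; rewrite lte_fin -mulrA ltr_pMl ?mulr_gt0//.
  by rewrite ltr1n.
move=> /ereal_inf_lt[_ [L /(grassmannianP (ltn0Sn m))[nu' [nu'1 ->]] <-]] h.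
exists nu'; apply: hausdorff_dist_flat => //; apply: lt_le_trans h _.
by rewrite lee_fin divfK// gt_eqF.
Qed.

Lemma hausdorff_measure_single x : (0 < m)%N -> hausdorff_measure m [set x] = 0%E.
Proof.
move=> m0; apply/eqP; rewrite eq_le hausdorff_measure_ge0 andbT.
apply: ge_ereal_sup => _ [d /= d0 <-].
apply: le_trans (hausdorff_premeasure_le_gauge _ _) _.
  by apply: ediam_le => y z -> ->; rewrite subrr enorm0 ltW.
apply: le_trans (hausdorff_gauge_le m (lexx 0) _) _.
  by move=> y z -> ->; rewrite subrr enorm0.
by rewrite mul0r expr0n gtn_eqF// mulr0.
Qed.

(** A set of positive m-dimensional measure, m > 0, has two points; this bounds
    from below the range of radii in the definition of fine sets. *)
Lemma ex_diam S : (0 < m)%N -> (0 < hausdorff_measure m S)%E ->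
  exists D : R, 0 < D /\ (D%:E <= ediam S)%E.
Proof.
move=> m0 S0; have [[x [y [Sx Sy xy]]]|h] := pselect (exists x y, [/\ S x, S y & x != y]).
  by exists (enorm (x - y)); rewrite enorm_gt0 subr_eq0; split=> //; exact: le_ediam.
exfalso; move: S0; rewrite ltNge => /negP; apply.
have [[x Sx]|nS] := pselect (exists x, S x).
  rewrite -(hausdorff_measure_single x m0); apply: le_hausdorff_measure => y Sy.
  by apply/eqP; apply: contra_notT h => yx; exists y, x.
by rewrite (_ : S = set0) ?hausdorff_measure0// -subset0 => x Sx; apply: nS; exists x.
Qed.

(** By Markov's inequality the set where K > t has measure less than the lower
    density bound of B(x, s), so it does not exhaust it.  The 1 in I + 1 makes
    the inequality strict. *)
Lemma Ktp_small_point S H p (I A : R) x s : 0 < p -> 0 <= I -> 0 < A -> 0 < s ->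
  (forall t, 0 <= t ->
     ((t `^ p)%:E * hausdorff_measure m (S `&` [set x | (t%:E < Ktp S H x)%E]) <= I%:E)%E) ->
  ((A * s ^+ m)%:E <= hausdorff_measure m (S `&` eball x s))%E ->
  let t := ((I + 1) / (A * s ^+ m)) `^ p^-1 in
  exists x', [/\ S x', enorm (x' - x) < s & (Ktp S H x' <= t%:E)%E].
Proof.
move=> p0 I0 A0 s0 mark dens t; apply: contrapT => nx.
have As : 0 < A * s ^+ m by rewrite mulr_gt0// exprn_gt0.
have tp : t `^ p = (I + 1) / (A * s ^+ m).
  by rewrite /t -powRrM mulVf ?gt_eqF// powRr1// divr_ge0 ?addr_ge0// ltW.
have sub : S `&` eball x s `<=` S `&` [set x | (t%:E < Ktp S H x)%E].
  move=> y [Sy yx]; split=> //=; rewrite ltNge; apply/negP => h.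
  by apply: nx; exists y.
have := mark t (powR_ge0 _ _); rewrite tp leNgt => /negP; apply.
apply: (@lt_le_trans _ _ (((I + 1) / (A * s ^+ m))%:E * (A * s ^+ m)%:E)%E).
  by rewrite -EFinM divfK ?gt_eqF// lte_fin ltrDl.
rewrite lee_wpmul2l//; first by rewrite lee_fin divr_ge0 ?addr_ge0// ltW.
exact: le_trans dens (le_hausdorff_measure m sub).
Qed.

(** At the point x' of [Ktp_small_point] the touching balls of radius 1/t confine
    S near x to a slab of width of order t s^2, with t of order s^(-m/p). So
    beta(x, s) is of order t s, i.e. of order s^(1 - m/p), and the exponent
    is positive as p > m. *)
Lemma fine_flat_decay S H p : (0 < m)%N -> fine_set m S -> m%:R < p ->
  (forall x, S x -> grassmannian m (H x)) -> (0 < hausdorff_measure m S)%E ->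
  tp_energy m p S H != +oo%E ->
  exists (C al D : R), [/\ 0 <= C, 0 < al, 0 < D &
    forall x s, S x -> 0 < s -> s <= D -> exists nu, flat_at S x s (C * s `^ al) nu].
Proof.
move=> m0 [cS [A [M [A0 M2 fineS]]]] mp GH S0 Eoo.
have p0 : 0 < p by apply: le_lt_trans mp; rewrite ler0n.
have M0 : 0 < M by lra.
have [D [D0 DS]] := ex_diam m0 S0.
have [I [I0 mark]] : exists I : R, 0 <= I /\ forall t, 0 <= t ->
     ((t `^ p)%:E * hausdorff_measure m (S `&` [set x | (t%:E < Ktp S H x)%E]) <= I%:E)%E.
  have fin : (tp_energy m p S H `^ p < +oo)%E by apply: poweR_lty; rewrite ltey.
  exists (fine (tp_energy m p S H `^ p)%E); split; first by rewrite fine_ge0// poweR_ge0.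
  move=> t t0; rewrite fineK; first exact: tp_energy_markov.
  by rewrite ge0_fin_numE// poweR_ge0.
pose C1 := ((I + 1) / A) `^ p^-1.
have C10 : 0 < C1 by rewrite powR_gt0// divr_gt0// ltr_wpDl.
pose al := 1 - m%:R / p.
have al0 : 0 < al by rewrite subr_gt0 ltr_pdivrMr// mul1r.
exists (6 * M * C1), al, D; split=> //; first by rewrite !mulr_ge0// ltW.
move=> x s Sx s0 sD.
have sS : (s%:E <= ediam S)%E by apply: le_trans DS; rewrite lee_fin.
have [dens th] := fineS x s Sx s0 sS.
have [x' [Sx' x'x Kx']] := Ktp_small_point p0 I0 A0 s0 mark dens.
set t := _ `^ p^-1 in Kx'.
have t0 : 0 < t by rewrite powR_gt0// divr_gt0 ?mulr_gt0 ?exprn_gt0// ltr_wpDl.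
have ts : t * s = C1 * s `^ al.
  rewrite /t invfM mulrA powRM ?invr_ge0 ?exprn_ge0 ?(ltW s0)//; last first.
    by rewrite divr_ge0 ?addr_ge0// ltW.
  rewrite -/C1 -mulrA; congr (C1 * _).
  rewrite /al powRD; last by rewrite gt_eqF// implybT.
  rewrite powRr1 ?(ltW s0)// mulrC; congr (s * _).
  rewrite -powR_mulrn ?(ltW s0)// -powRN -powRrM; congr (s `^ _).
  by rewrite mulNr.
have [nu [nu1 HE]] := grassmannianP (ltn0Sn m) (GH x' Sx').
have H0 : H x' !=set0 by rewrite HE; exists 0; rewrite /hyperplane /= dot0l.
have Hs : H x' `<=` hyperplane nu by rewrite HE.
have ti : 0 < t^-1 by rewrite invr_gt0.
have Kx'' : (Ktp S H x' <= (t^-1^-1)%:E)%E by rewrite invrK.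
have tan := Ktp_tangent_ball nu1 H0 Hs ti Kx''.
(* y and x are within 2 s and s of x', and 4 t s^2 / 2 + t s^2 / 2 <= 3 t s^2 *)
have b0 : 0 < 3 * t * s ^+ 2 by rewrite !mulr_gt0// exprn_gt0.
have yb y : S y -> enorm (y - x) < s -> `|dot (y - x) nu| <= 3 * t * s ^+ 2.
  move=> Sy yx.
  have bnd z (r : R) : S z -> 0 <= r -> enorm (z - x') <= r -> `|dot (z - x') nu| <= t * r ^+ 2 / 2.
    move=> Sz r0 zr; have := tan z Sz; rewrite mulrA ler_pdivrMr// => h.
    have : enorm (z - x') ^+ 2 <= r ^+ 2 by rewrite lerXn2r ?nnegrE ?enorm_ge0.
    move=> /(ler_wpM2r (ltW t0)); lra.
  have h1 : enorm (y - x') <= 2 * s.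
    by have := enorm_triangle x y x'; rewrite (enormBC x x'); lra.
  have h2 : enorm (x - x') <= s by rewrite enormBC ltW.
  have b1 := bnd y _ Sy (mulr_ge0 (ler0n R 2) (ltW s0)) h1.
  have b2 := bnd x _ Sx (ltW s0) h2.
  have -> : dot (y - x) nu = dot (y - x') nu - dot (x - x') nu by rewrite !dotE; ring.
  apply: le_trans (ler_normB _ _) _.
  have s2 : 0 <= t * s ^+ 2 by rewrite mulr_ge0 ?exprn_ge0 ?(ltW t0) ?(ltW s0).
  by rewrite exprMn in b1; lra.
have [nu' fl] := theta_le_beta_flat s0 M0 b0 Sx th nu1 yb.
exists nu'; suff -> : 6 * M * C1 * s `^ al = 2 * M * (3 * t * s ^+ 2) / s by [].
rewrite -[LHS]mulrA -ts; field; by rewrite gt_eqF.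
Qed.

(** A geometric series of ratio 2^(-al), made small by starting at a small
    scale. *)
Lemma ex_dyadic_scale (C al D : R) : 0 <= C -> 0 < al -> 0 < D ->
  exists s, [/\ 0 < s, s <= D & forall k, \sum_(j < k) C * (s / 2 ^+ j) `^ al <= 1 / 64].
Proof.
move=> C0 al0 D0; pose q : R := 2^-1 `^ al.
have q0 : 0 < q by rewrite powR_gt0.
have q1 : q < 1.
  have h1 : (1 : R) `^ al = 1 by rewrite powR1.
  rewrite -[ltRHS]h1; apply: gt0_ltr_powR => //; rewrite ?nnegrE//.
  by rewrite invf_lt1// ltr1n.
pose E := (1 - q) / (64 * (C + 1)).
have E0 : 0 < E by rewrite divr_gt0 ?subr_gt0// mulr_gt0// ltr_wpDl.
pose s := Num.min D (E `^ al^-1).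
have s0 : 0 < s by rewrite lt_min D0 powR_gt0.
exists s; split=> //; first by rewrite ge_min lexx.
have sE : s `^ al <= E.
  rewrite -[leRHS](powRr1 (ltW E0)) -(mulVf (lt0r_neq0 al0)) powRrM.
  apply: ge0_ler_powR; rewrite ?nnegrE ?(ltW al0) ?(ltW s0) ?powR_ge0//.
  by rewrite /s ge_min lexx orbT.
move=> k; have -> : \sum_(j < k) C * (s / 2 ^+ j) `^ al = C * s `^ al * \sum_(j < k) q ^+ j.
  rewrite big_distrr /=; apply: eq_bigr => j _; rewrite -mulrA; congr (C * _).
  rewrite -exprVn powRM ?exprn_ge0 ?(ltW s0)// ?invr_ge0//; congr (_ * _).
  have h2 : 0 <= 2^-1 :> R by rewrite invr_ge0.
  by rewrite -(powR_mulrn j h2) -powRrM mulrC powRrM powR_mulrn ?powR_ge0.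
have geo : (1 - q) * \sum_(j < k) q ^+ j <= 1.
  have -> : (1 - q) * \sum_(j < k) q ^+ j = 1 - q ^+ k by rewrite -[in RHS](expr1n _ k) subrXX /= ; congr (_ * _); apply: eq_bigr => j _; rewrite expr1n mul1r.
  by rewrite lerBlDr lerDl exprn_ge0// ltW.
have sum0 : 0 <= \sum_(j < k) q ^+ j by apply: sumr_ge0 => j _; rewrite exprn_ge0// ltW.
apply: (@le_trans _ _ ((C + 1) * E * \sum_(j < k) q ^+ j)).
  rewrite ler_wpM2r// ler_pM ?powR_ge0//.
  by rewrite lerDl.
have -> : (C + 1) * E * \sum_(j < k) q ^+ j = 1 / 64 * ((1 - q) * \sum_(j < k) q ^+ j).
  by rewrite /E; field; rewrite gt_eqF// ltr_wpDl.
by rewrite ler_piMr.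
Qed.

(** The dyadic flatness of [fine_flat_decay] is summable, so that
    [reifenberg_flattening] applies. *)
Lemma fine_chart S H p : (0 < m)%N -> fine_set m S -> m%:R < p ->
  (forall x, S x -> grassmannian m (H x)) -> (0 < hausdorff_measure m S)%E ->
  tp_energy m p S H != +oo%E -> forall x, S x -> exists U V Phi Psi g,
  [/\ U x, flattening S U V Phi Psi g &
   forall nu (r : R), enorm nu = 1 -> 0 < r ->
    (forall y, S y -> `|dot (y - x) nu| * (2 * r) <= enorm (y - x) ^+ 2) ->
    forall d : R, 0 < d -> exists t, 0 < t < d /\
     dot (Phi (x + t *: nu)) g * dot (Phi (x - t *: nu)) g < 0].
Proof.
move=> m0 fS mp GH S0 Eoo x Sx; have cS : compact S by case: fS.
have [C [al [D [C0 al0 D0 fl]]]] := fine_flat_decay m0 fS mp GH S0 Eoo.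
have [s [s0 sD sum]] := ex_dyadic_scale C0 al0 D0.
have [nu nuP] : exists nu : 'rV[R]_m.+1 * nat -> 'rV[R]_m.+1, forall yk, S yk.1 ->
    flat_at S yk.1 (s / 2 ^+ yk.2) (C * (s / 2 ^+ yk.2) `^ al) (nu yk).
  suff : forall yk : 'rV[R]_m.+1 * nat, exists f, S yk.1 -> flat_at S yk.1 (s / 2 ^+ yk.2) (C * (s / 2 ^+ yk.2) `^ al) f.
    by move=> /choice[f fP]; exists f.
  move=> [y k] /=; have [Sy|nSy] := pselect (S y); last by exists 0.
  have sk : 0 < s / 2 ^+ k by rewrite divr_gt0// exprn_gt0.
  have skD : s / 2 ^+ k <= D.
    by apply: le_trans sD; rewrite ler_pdivrMr ?exprn_gt0// ler_peMr ?(ltW s0)// exprn_ege1// ler1n.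
  by have [f fP] := fl y _ Sy sk skD; exists f.
apply: (@reifenberg_flattening R m.+1 S s (fun k => C * (s / 2 ^+ k) `^ al) (fun y k => nu (y, k)) s0 _ sum _ x Sx cS).
  by move=> k; rewrite mulr_ge0// powR_ge0.
by move=> y k Sy; exact: (nuP (y, k)).
Qed.

Lemma fine_locally_flat S H p : (0 < m)%N -> fine_set m S -> m%:R < p ->
  (forall x, S x -> grassmannian m (H x)) -> (0 < hausdorff_measure m S)%E ->
  tp_energy m p S H != +oo%E -> locally_flat S.
Proof.
move=> m0 fS mp GH S0 Eoo x Sx.
have [U [V [Phi [Psi [g [Ux fl _]]]]]] := fine_chart m0 fS mp GH S0 Eoo Sx.
by exists U, V, Phi, Psi, g.
Qed.

Lemma fine_enclosure S H p x (r : R) : (0 < m)%N -> fine_set m S -> m%:R < p ->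
  (forall x, S x -> grassmannian m (H x)) -> (0 < hausdorff_measure m S)%E ->
  tp_energy m p S H != +oo%E -> S x -> 0 < r -> (Ktp S H x <= (r^-1)%:E)%E ->
  exists c, encloses S c r.
Proof.
move=> m0 fS mp GH S0 Eoo Sx r0 Kr.
have [U [V [Phi [Psi [g [Ux flat cross]]]]]] := fine_chart m0 fS mp GH S0 Eoo Sx.
have [nu [nu1 HE]] := grassmannianP (ltn0Sn m) (GH x Sx).
have H0 : H x !=set0 by rewrite HE; exists 0; rewrite /hyperplane /= dot0l.
have Hs : H x `<=` hyperplane nu by rewrite HE.
have tan := Ktp_tangent_ball nu1 H0 Hs r0 Kr.
have cS : compact S by case: fS.
apply: (tangent_ball_enclosed (n := m.+1) m0 cS (fine_locally_flat m0 fS mp GH S0 Eoo) Sx nu1 r0 tan Ux flat).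
exact: (cross nu r nu1 r0 tan).
Qed.

End fine_sets.

(** * Minimality of the sphere *)

Section sphere_minimality.
Context {R : realType} {m : nat}.
Implicit Types (x y z c : 'rV[R]_m.+1) (S Sigma : set 'rV[R]_m.+1).
Implicit Type H : 'rV[R]_m.+1 -> set 'rV[R]_m.+1.

Lemma sphere_congruent c (r : R) : congruent (esphere c r) (esphere 0 r).
Proof.
exists (fun z => c + z); split.
  by move=> x y; rewrite opprD addrACA subrr add0r.
apply/seteqP; split=> [z zc|_ [z z0 <-]].
  exists (z - c); last by rewrite addrC subrK.
  by rewrite /esphere /= subr0.
by move: z0; rewrite /esphere /= subr0 addrC addKr.
Qed.

Lemma sphere_energy (p a r : R) : (0 < m)%N -> 0 < p -> 0 < r ->
  hausdorff_measure m (esphere (0 : 'rV[R]_m.+1) r) = a%:E ->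
  (tp_energy m p (esphere 0 r) (tangent_space (esphere (0 : 'rV[R]_m.+1) r)) `^ p =
   (r^-1 `^ p)%:E * a%:E)%E.
Proof.
move=> m0 p0 r0 Sa; rewrite (@tp_energy_cst _ _ m p _ _ r^-1)// ?Sa//.
- by apply: compact_eclosed; exact: sphere_compact.
- by rewrite invr_ge0 ltW.
by move=> x Sx; apply: Ktp_sphere => //; exact: sphere_tangent_space.
Qed.

Lemma encloses_sphere_le Sigma c (a r s : R) : (0 < m)%N -> 0 < r -> 0 < s ->
  hausdorff_measure m (esphere (0 : 'rV[R]_m.+1) r) = a%:E ->
  hausdorff_measure m Sigma = a%:E -> encloses Sigma c s -> s <= r.
Proof.
move=> m0 r0 s0 Sa Sigmaa enc; rewrite leNgt; apply/negP => rs.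
have := encloses_area s0 enc; rewrite Sigmaa -Sa (hausdorff_measure_sphere_scale c s0) (hausdorff_measure_sphere_scale 0 r0).
have := hausdorff_measure_unit_sphere_fin (R := R) (m := m).
have := hausdorff_measure_unit_sphere_gt0 (R := R) m0.
case: (hausdorff_measure m _) => // q; rewrite lte_fin => q0 _.
by rewrite -!EFinM lee_fin ler_pM2r// leNgt ltrXn2r ?nnegrE ?(ltW r0) ?(ltW s0)// -lt0n m0.
Qed.

(** The comparison, common to both classes of competitors: the hypothesis asks
    that a competitor of finite energy is locally flat and encloses a ball of
    radius s as soon as K <= 1/s at one of its points. *)
Lemma sphere_minimizes (p a r : R) Sigma H : (0 < m)%N -> 0 < p -> 0 < a -> 0 < r ->
  (forall c, hausdorff_measure m (esphere c r : set 'rV[R]_m.+1) = a%:E) ->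
  compact Sigma -> hausdorff_measure m Sigma = a%:E ->
  (tp_energy m p Sigma H != +oo%E -> locally_flat Sigma /\
     forall x (s : R), Sigma x -> 0 < s -> (Ktp Sigma H x <= (s^-1)%:E)%E ->
       exists c, encloses Sigma c s) ->
  let S : set 'rV[R]_m.+1 := esphere 0 r in
  let E0 := tp_energy m p S (tangent_space S) in
  let E := tp_energy m p Sigma H in
  (E0 <= E)%E /\ (E = E0 -> congruent Sigma S).
Proof.
move=> m0 p0 a0 r0 Sa cS Sigmaa enc S E0 E.
have E0p := sphere_energy m0 p0 r0 (Sa 0); rewrite -/S -/E0 in E0p.
have [Eoo|Eoo] := eqVneq E +oo%E.
  split=> [|EE0]; first by rewrite Eoo leey.
  by move: E0p; rewrite -EE0 Eoo poweRyr ?gt_eqF.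
have [flat {}enc] := enc Eoo.
have ecS := compact_eclosed cS.
have rV0 : 0 <= r^-1 by rewrite invr_ge0 ltW.
have Kge x : Sigma x -> ((r^-1)%:E <= Ktp Sigma H x)%E.
  move=> Sx; rewrite leNgt; apply/negP => Kr.
  have K0 := Ktp_restrict_ge0 Sigma H x; rewrite patchE mem_set// in K0.
  case: (Ktp Sigma H x) K0 Kr (enc x) => // q; rewrite lee_fin lte_fin => q0 qr encx.
  (* if K = q < 1/r at x, a ball of some radius s > r is enclosed *)
  pose s := ((q + r^-1) / 2)^-1.
  have rV : 0 < r^-1 by rewrite invr_gt0.
  have s0 : 0 < s by rewrite invr_gt0 divr_gt0// ltr_wpDl.
  have [c sc] : exists c, encloses Sigma c s.
    by apply: encx => //; rewrite invrK lee_fin; lra.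
  have := encloses_sphere_le m0 r0 s0 (Sa 0) Sigmaa sc.
  rewrite leNgt => /negP; apply; rewrite -[ltLHS]invrK ltf_pV2 ?posrE//; last first.
    by rewrite divr_gt0// ltr_wpDl.
  by lra.
split.
  apply: poweR_le_tp_energy => //; rewrite -/E0 E0p -Sigmaa.
  exact: tp_energy_ge.
move=> EE0.
have [x [Sx Kx]] : exists x, Sigma x /\ (Ktp Sigma H x <= (r^-1)%:E)%E.
  apply: contrapT => nx.
  have : ((r^-1 `^ p)%:E * hausdorff_measure m Sigma < E `^ p)%E.
    apply: tp_energy_gt => //; rewrite ?Sigmaa ?lte_fin ?ltry//.
    by move=> y Sy; rewrite ltNge; apply/negP => h; apply: nx; exists y.
  by rewrite EE0 E0p Sigmaa ltxx.
have [c sc] := enc x r Sx r0 Kx.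
have -> : Sigma = esphere c r.
  apply: (encloses_rigid m0 r0 sc).
  - by move=> y d Sy d0; exact: locally_flat_measure_gt0.
  - by rewrite Sigmaa ltry.
  - by rewrite Sigmaa Sa.
exact: sphere_congruent.
Qed.

End sphere_minimality.

Unset Implicit Arguments.

Theorem theorem1p5 (R : realType) (n : nat) (p a : R) :
  (2 <= n)%N -> 0 < p -> 0 < a ->
  exists r : R,
    let S : set 'rV[R]_n := esphere 0 r in
    let E0 := tp_energy n.-1 p S (tangent_space S) in
    [/\ 0 < r,
        hausdorff_measure n.-1 S = a%:E,
        compact_C1_hypersurface S /\
        (forall Sigma : set 'rV[R]_n,
          compact_C1_hypersurface Sigma ->
          hausdorff_measure n.-1 Sigma = a%:E ->
          let E := tp_energy n.-1 p Sigma (tangent_space Sigma) in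
          (E0 <= E)%E /\ (E = E0 -> congruent Sigma S)) &
        (n.-1)%:R < p ->
        [/\ fine_set n.-1 S,
            (forall x, S x -> grassmannian n.-1 (tangent_space S x)) &
            forall (Sigma : set 'rV[R]_n) (H : 'rV[R]_n -> set 'rV[R]_n),
              fine_set n.-1 Sigma ->
              (forall x, Sigma x -> grassmannian n.-1 (H x)) ->
              hausdorff_measure n.-1 Sigma = a%:E ->
              let E := tp_energy n.-1 p Sigma H in
              (E0 <= E)%E /\ (E = E0 -> congruent Sigma S)]].
Proof.
case: n => [//|m]; rewrite ltnS => m0 p0 a0.
have [r [r0 Sa]] := @ex_sphere_of_measure R m a m0 a0.
exists r => S E0; split=> //; first exact: Sa.
  split; first by split; [exact: sphere_compact|exact: sphere_C1_submanifold].
  move=> Sigma cS Sigmaa; apply: (sphere_minimizes m0 p0 a0 r0 Sa cS.1 Sigmaa) => _.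
  split; first exact: C1_locally_flat cS.2.
  by move=> x s Sx s0; exact: C1_enclosure.
move=> mp; split.
- exact: sphere_fine_set.
- move=> x Sx; rewrite sphere_tangent_space//; apply: hyperplane_grassmannian.
  by rewrite -enorm_gt0; move: Sx; rewrite /S /esphere /= subr0 => ->.
move=> Sigma H fS GH Sigmaa; have cS : compact Sigma by case: fS.
have S0 : (0 < hausdorff_measure m Sigma)%E by rewrite Sigmaa lte_fin.
apply: (sphere_minimizes m0 p0 a0 r0 Sa cS Sigmaa) => Eoo.
split; first exact: (fine_locally_flat m0 fS mp GH S0 Eoo).
by move=> x s Sx s0; exact: (fine_enclosure m0 fS mp GH S0 Eoo Sx s0).
Qed.
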